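(* Let $1\le p<\infty$, let $\phi$ be a normal weight, and let $w=(w_n)_{n\ge 1}$ be a sequence of non-zero complex numbers such that the weighted backward shift $B_w$ is bounded on the weighted Bergman space $A^p_\phi$. Then the following statements are equivalent. (i) $B_w$ is hypercyclic on $A^p_\phi$. (ii) $\displaystyle \limsup_{n\to\infty}\left(|w_1\cdots w_n|\Big(\int_0^1 r^{pn+1}\phi(r)\,dr\Big)^{-1/p}\right)=\infty$. (iii) $\displaystyle \liminf_{n\to\infty}\left(\frac{1}{|w_1\cdots w_n|}\,\|z^n\|_{A^p_\phi}\right)=0$.
   Context: $\mathbb{D}$ is the open unit disc in $\mathbb{C}$ and $dA=\frac1\pi dx\,dy$ is normalized area measure on $\mathbb{D}$. A weight is a strictly positive function $\phi$ on $\mathbb{D}$ that is integrable with respect to $dA$; it is radial if $\phi(z)=\phi(|z|)$. A continuous radial weight $\phi(r)$, $r\in[0,1)$, is called normal if there are constants $k>\epsilon>-1$ and $0<r_0<1$ such that, for $r_0\le r<1$ and as $r\to1^-$, $\phi(r)/(1-r)^{\epsilon}$ decreases to $0$ and $\phi(r)/(1-r)^{k}$ increases to $\infty$. For $1\le p<\infty$, $A^p_\phi$ is the space of analytic functions $f$ on $\mathbb{D}$ with $\|f\|_{A^p_\phi}^p=\int_{\mathbb{D}}|f|^p\phi\,dA<\infty$. The weighted backward shift is $B_w\big(\sum_{n\ge0}\lambda_n z^n\big)=\sum_{n\ge0}w_{n+1}\lambda_{n+1}z^n$. A bounded operator $T$ on $X$ is hypercyclic if some $x\in X$ has dense orbit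 $\{x,Tx,T^2x,\dots\}$. Throughout, weight sequences $w$ have non-zero terms. *)

(* Defs.v *)
From mathcomp Require Export all_boot all_order all_algebra.
From mathcomp Require Export all_classical all_reals all_analysis.
From mathcomp Require Export complex.

Set Implicit Arguments.
Unset Strict Implicit.
Unset Printing Implicit Defensive.

Import Order.TTheory GRing.Theory Num.Theory.
Export numFieldNormedType.Exports.

Local Open Scope classical_set_scope.
Local Open Scope ring_scope.
Local Open Scope complex_scope.

(* The modulus as an element of R; [`|z|] is an element of R[i]. *)
Notation cmod := Normc.normc.

Definition unit_disc (R : realType) : set R[i] := [set z | cmod z < 1].

(* The series \sum_n a_n (z - z0)^n converges, with sum s.  The topology on the
   complex numbers is that of the normed space R[i]^o. *)
Definition psum_at (R : realType) (a : nat -> R[i]) (z0 z s : R[i]) : Prop :=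
  (series (fun n => a n * (z - z0) ^+ n) : nat -> R[i]^o) @ \oo --> (s : R[i]^o).

(* Functions on the disc are represented by total functions whose values
   outside of the disc are never used. *)
Definition analytic_on_disc (R : realType) (f : R[i] -> R[i]) : Prop :=
  forall z0, unit_disc z0 ->
    exists2 r : R, 0 < r &
      exists a : nat -> R[i], forall z, cmod (z - z0) < r -> psum_at a z0 z (f z).

(* f(z) = \sum_n a_n z^n for every z in the disc. *)
Definition has_power_series (R : realType) (f : R[i] -> R[i])
    (a : nat -> R[i]) : Prop :=
  forall z, unit_disc z -> psum_at a 0 z (f z).

(* A sequence a such that f = \sum_n a_n z^n on the disc, if there is one; it is
   then unique. *)
Definition taylor_coef (R : realType) (f : R[i] -> R[i]) : nat -> R[i] :=
  get [set a : nat -> R[i]^o | has_power_series f a].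

Lemma invpi_ge0 (R : realType) : 0 <= (pi : R)^-1.
Proof. by rewrite invr_ge0 pi_ge0. Qed.

(* Normalized area measure dx dy / pi, with (x, y) standing for x + i y. *)
Definition dA (R : realType) : {measure set (measurableTypeR R * measurableTypeR R) -> \bar R} :=
  mscale (NngNum (invpi_ge0 R)) (@lebesgue_measure R \x @lebesgue_measure R)%E.

Definition disc2 (R : realType) : set (R * R) :=
  [set u | unit_disc (u.1 +i* u.2)].

Definition is_weight (R : realType) (phi : R[i] -> R) : Prop :=
  (forall z, unit_disc z -> 0 < phi z) /\
  (dA R).-integrable (@disc2 R) (fun u => (phi (u.1 +i* u.2))%:E).

Definition is_radial (R : realType) (phi : R[i] -> R) : Prop :=
  forall z, unit_disc z -> phi z = phi (cmod z)%:C.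

Definition profile (R : realType) (phi : R[i] -> R) (r : R) : R := phi r%:C.

Definition normal_weight (R : realType) (phi : R[i] -> R) : Prop :=
  [/\ is_weight phi, is_radial phi,
      {within `[0, 1[, continuous (profile phi)} &
      exists k eps r0 : R,
        let lower r := profile phi r / (1 - r) `^ eps in
        let upper r := profile phi r / (1 - r) `^ k in
        [/\ -1 < eps, eps < k, 0 < r0 < 1,
            {in `[r0, 1[ &, {homo lower : r s /~ r <= s}} /\
              lower r @[r --> 1^'-] --> 0 &
            {in `[r0, 1[ &, {homo upper : r s / r <= s}} /\
              upper r @[r --> 1^'-] --> +oo]].

Section Bergman.
Variables (R : realType) (p : R) (phi : R[i] -> R).

(* \int_D |f|^p phi dA *)
Definition bergman_int (f : R[i] -> R[i]) : \bar R :=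
  (\int[dA R]_(u in @disc2 R)
     (cmod (f (u.1 +i* u.2)) `^ p * phi (u.1 +i* u.2))%:E)%E.

Definition in_bergman (f : R[i] -> R[i]) : Prop :=
  analytic_on_disc f /\ (bergman_int f < +oo)%E.

Definition bergman_norm (f : R[i] -> R[i]) : R := fine (bergman_int f) `^ p^-1.

Definition bounded_on_bergman (T : (R[i] -> R[i]) -> R[i] -> R[i]) : Prop :=
  exists M : R, forall f, in_bergman f ->
    in_bergman (T f) /\ bergman_norm (T f) <= M * bergman_norm f.

(* Some orbit is dense in A^p_phi for the distance ||f - g||. *)
Definition hypercyclic (T : (R[i] -> R[i]) -> R[i] -> R[i]) : Prop :=
  exists2 f, in_bergman f &
    forall g, in_bergman g -> forall e : R, 0 < e ->
      exists n : nat, bergman_norm (iter n T f \- g) < e.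

End Bergman.

(* The sequence w is indexed from 1; w 0 is never used. *)
Definition Bcoef (R : realType) (w : nat -> R[i]) (a : nat -> R[i]) : nat -> R[i] :=
  fun n => w n.+1 * a n.+1.

Definition Bshift (R : realType) (w : nat -> R[i]) (f : R[i] -> R[i]) : R[i] -> R[i] :=
  fun z => limn (series (fun n => Bcoef w (taylor_coef f) n * z ^+ n)
                 : nat -> R[i]^o).

(* The first conjunct says that the series defining B_w f converges on the whole
   disc, so that boundedness never rests on the default value of [limn]. *)
Definition Bshift_bounded (R : realType) (p : R) (phi : R[i] -> R)
    (w : nat -> R[i]) : Prop :=
  (forall f, in_bergman p phi f ->
     has_power_series (Bshift w f) (Bcoef w (taylor_coef f))) /\
  bounded_on_bergman p phi (Bshift w).

(* Main.v *)
Require Import Defs.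
From mathcomp Require Import all_boot all_order all_algebra.
From mathcomp Require Import all_classical all_reals all_analysis.
From mathcomp Require Import complex measurable_realfun.
From mathcomp Require Import cyclic separable cyclotomic.
From mathcomp Require Import ring lra zify.
Import Order.TTheory GRing.Theory Num.Theory.
Import numFieldNormedType.Exports.
Set Implicit Arguments.
Unset Strict Implicit.
Unset Printing Implicit Defensive.
Local Open Scope classical_set_scope.
Local Open Scope ring_scope.

(* Put W_n = w_1 ... w_n and b_n = ||z^n|| / |W_n|.  Averaging rotations of f over
   roots of unity gives |a_n| ||z^n|| <= ||f|| for f = \sum_n a_n z^n, so that the
   constant term of B_w^n f, which is W_n a_n, has modulus at most ||f|| / b_n.  If
   the orbit of f comes close to every constant, the b_n are not bounded below:
   this is (i) => (ii).  Polar coordinates give ||z^n||^p = kappa \int r^(pn+1) phi,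
   whence (ii) <=> (iii).  For (iii) => (i), rational polynomials are dense because
   the Cesaro means of f converge to f in norm; the polynomial
   F = \sum_j c_j (W_j / W_(n+j)) z^(n+j) is mapped by B_w^n to q = \sum_j c_j z^j
   and has norm at most \sum_j |c_j W_j| b_(n+j), which can be made small since
   b_n <= C b_(n+1).  A rapidly chosen sum of such polynomials F, where q runs over
   all rational polynomials, has a dense orbit. *)

(** * Complex sequences and power series *)

(** Analyticity is given only locally, so the expansion f = \sum_n a_n z^n on the whole disc has to
    be earned first. No contour integral occurs: averages over n-th roots of unity, with n tending
    to infinity, take its place. They give the Cauchy inequality, the coefficient bound in A^p_phi
    and the contractivity of the Cesaro means. Each average is a finite sum of rotations, so the
    triangle inequality bounds its norm, and Fatou's lemma carries the bound to the pointwise limit.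
    Fatou also stands in for completeness: the hypercyclic vector is built from coefficients
    summable against ||z^n||. In that construction a late block must be small itself and stay small
    under every B_w^n used for an earlier block. As B_w^n has norm at most M^n, the admissible size
    is divided by M^n in advance. Every rational polynomial is listed infinitely often, because the
    error left after the k-th block is only known to be at most 2^-k. *)

Section ComplexSequences.
Variable R : realType.
Implicit Types (u v : nat -> R[i]) (l m z : R[i]).

Lemma cmod_norm z : (cmod z)%:C%C = `|z|.
Proof. by []. Qed.

Lemma cmod_ge0 z : 0 <= cmod z.
Proof. by case: z => x y /=; rewrite sqrtr_ge0. Qed.

Lemma cmod_eq0 z : (cmod z == 0) = (z == 0).
Proof. by apply/eqP/eqP => [/Normc.eq0_normc//|->]; rewrite Normc.normc0. Qed.

Lemma cmod_gt0 z : (0 < cmod z) = (z != 0).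
Proof. by rewrite lt_neqAle eq_sym cmod_eq0 cmod_ge0 andbT. Qed.

Lemma cmodD z l : cmod (z + l) <= cmod z + cmod l.
Proof. exact: le_normcD. Qed.

Lemma cmodN z : cmod (- z) = cmod z.
Proof. exact: normcN. Qed.

Lemma cmodB z l : cmod (z - l) <= cmod z + cmod l.
Proof. by rewrite -(cmodN l) cmodD. Qed.

Lemma cmodBC z l : cmod (z - l) = cmod (l - z).
Proof. by rewrite -cmodN opprB. Qed.

Lemma cmodM z l : cmod (z * l) = cmod z * cmod l.
Proof. exact: Normc.normcM. Qed.

Lemma cmodX z n : cmod (z ^+ n) = cmod z ^+ n.
Proof. by elim: n => [|n IH]; rewrite ?Normc.normc1// !exprS cmodM IH. Qed.

Lemma cmodV z : cmod z^-1 = (cmod z)^-1.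
Proof. exact: Normc.normcV. Qed.

Lemma cmod0 : cmod (0 : R[i]) = 0. Proof. exact: Normc.normc0. Qed.
Lemma cmod1 : cmod (1 : R[i]) = 1. Proof. exact: Normc.normc1. Qed.

Lemma cmod_real (x : R) : cmod x%:C%C = `|x|.
Proof. by rewrite /= expr0n addr0 sqrtr_sqr. Qed.

Lemma cmod_nat n : cmod (n%:R : R[i]) = n%:R.
Proof.
by rewrite -(rmorph_nat (real_complex R)) cmod_real ger0_norm.
Qed.

Lemma cmod_Re z : `|complex.Re z| <= cmod z.
Proof. by rewrite -lecR cmod_norm; exact: normc_ge_Re. Qed.

Lemma cmod_Im z : `|complex.Im z| <= cmod z.
Proof.
case: z => x y /=; rewrite -sqrtr_sqr ler_sqrt ?addr_ge0 ?sqr_ge0//.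
by rewrite lerDr sqr_ge0.
Qed.

Lemma cmod_ReIm z : cmod z <= `|complex.Re z| + `|complex.Im z|.
Proof.
rewrite [z in X in X <= _]complexE (le_trans (cmodD _ _))// cmodM cmod_real.
by rewrite cmod_real /= expr0n expr1n add0r sqrtr1 mul1r.
Qed.

Lemma cmod_sum (I : Type) (r : seq I) (P : pred I) (F : I -> R[i]) :
  cmod (\sum_(i <- r | P i) F i) <= \sum_(i <- r | P i) cmod (F i).
Proof.
elim/big_rec2: _ => [|i x y _ xy]; first by rewrite cmod0.
by rewrite (le_trans (cmodD _ _))// lerD2l.
Qed.

Lemma cmod_lerB z l : cmod z - cmod l <= cmod (z - l).
Proof. by rewrite lerBlDr (le_trans _ (cmodD _ _))// subrK. Qed.

Definition ccvg u l := (fun n => cmod (u n - l)) @ \oo --> (0 : R).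

Lemma ccvgP u l : ccvg u l <->
  forall e, 0 < e -> exists N, forall n, (N <= n)%N -> cmod (u n - l) < e.
Proof.
split => [/cvgrPdist_lt h e /h [N _ Nh]|h].
  exists N => n /Nh /=.
  by rewrite sub0r normrN ger0_norm// cmod_ge0.
apply/cvgrPdist_lt => e /h [N Nh]; exists N => //= n /= Nn.
by rewrite sub0r normrN ger0_norm ?cmod_ge0//; exact: Nh.
Qed.

Lemma ccvgE u l :
  ((u : nat -> R[i]^o) @ \oo --> (l : R[i]^o)) <-> ccvg u l.
Proof.
split => [/cvgrPdist_lt h|/ccvgP h].
  apply/ccvgP => e e0; have [|N _ Nh] := h e%:C%C; first by rewrite ltcR.
  exists N => n /Nh /=; rewrite distrC -[`|_|]/((cmod _)%:C%C).
  by rewrite ltcR.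
apply/cvgrPdist_lt => e; rewrite ltcE /= => /andP[/eqP e0 /h[N Nh]].
exists N => //= n /= /Nh; rewrite distrC -[`|_|]/((cmod _)%:C%C) => ?.
by rewrite ltcE /= e0 eqxx.
Qed.

Lemma ccvg_cst l : ccvg (fun=> l) l.
Proof. by apply/ccvgE; exact: cvg_cst. Qed.

Lemma ccvgD u v l m : ccvg u l -> ccvg v m -> ccvg (fun n => u n + v n) (l + m).
Proof.
move=> /ccvgP ul /ccvgP vm; apply/ccvgP => e e0.
have [|N Nh] := ul (e / 2); first by rewrite divr_gt0.
have [|M Mh] := vm (e / 2); first by rewrite divr_gt0.
exists (maxn N M) => n; rewrite geq_max => /andP[/Nh h1 /Mh h2].
have -> : u n + v n - (l + m) = (u n - l) + (v n - m) by ring.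
by have := cmodD (u n - l) (v n - m); lra.
Qed.

Lemma ccvgN u l : ccvg u l -> ccvg (fun n => - u n) (- l).
Proof. by rewrite /ccvg => ul; under eq_fun do rewrite -opprD cmodN. Qed.

Lemma ccvgB u v l m : ccvg u l -> ccvg v m -> ccvg (fun n => u n - v n) (l - m).
Proof. by move=> ul vm; apply: ccvgD => //; exact: ccvgN. Qed.

Lemma ccvgZ u l m : ccvg u l -> ccvg (fun n => m * u n) (m * l).
Proof.
rewrite /ccvg => ul; under eq_fun do rewrite -mulrBr cmodM.
by rewrite -(mulr0 (cmod m)); apply: cvgM => //; exact: cvg_cst.
Qed.

Lemma ccvg_sum (I : Type) (r : seq I) (F : I -> nat -> R[i]) (G : I -> R[i]) :
  (forall i, ccvg (F i) (G i)) ->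
  ccvg (fun n => \sum_(i <- r) F i n) (\sum_(i <- r) G i).
Proof.
move=> h; elim: r => [|i r IH].
  by rewrite big_nil; under eq_fun do rewrite big_nil; exact: ccvg_cst.
by rewrite big_cons; under eq_fun do rewrite big_cons; exact: ccvgD.
Qed.

Lemma ccvg_cmod u l : ccvg u l -> (fun n => cmod (u n)) @ \oo --> cmod l.
Proof.
move=> /ccvgP ul; apply/cvgrPdist_lt => e /ul[N Nh].
exists N => //= n /= /Nh; apply: le_lt_trans.
have h1 := cmod_lerB l (u n); have h2 := cmod_lerB (u n) l.
by rewrite cmodBC in h1; rewrite ler_norml; apply/andP; split; lra.
Qed.

Lemma ccvg_unique u l m : ccvg u l -> ccvg u m -> l = m.
Proof.
move=> /ccvgE ul /ccvgE um.
exact: (cvg_unique (@norm_hausdorff _ R[i]^o) ul um).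
Qed.

Lemma ccvg_eventually u v l N :
  (forall n, (N <= n)%N -> u n = v n) -> ccvg u l -> ccvg v l.
Proof.
move=> uv /ccvgP ul; apply/ccvgP => e /ul[M Mh]; exists (maxn N M) => n.
by rewrite geq_max => /andP[/uv <- /Mh].
Qed.

Lemma ccvg_shift u l N : ccvg (fun n => u (n + N)%N) l <-> ccvg u l.
Proof.
split => /ccvgP h; apply/ccvgP => e /h[M Mh].
  exists (M + N)%N => n Mn; have Nn : (N <= n)%N by lia.
  by rewrite -(subnK Nn); apply: Mh; lia.
by exists M => n Mn; apply: Mh; lia.
Qed.

Lemma ccvg_ReIm u l : (fun n => complex.Re (u n)) @ \oo --> complex.Re l ->
  (fun n => complex.Im (u n)) @ \oo --> complex.Im l -> ccvg u l.
Proof.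
move=> hR hI; rewrite /ccvg.
have h : (fun n => `|complex.Re (u n) - complex.Re l| +
                   `|complex.Im (u n) - complex.Im l|) @ \oo --> (0 : R).
  have -> : 0 = `|complex.Re l - complex.Re l| + `|complex.Im l - complex.Im l|.
    by rewrite !subrr !normr0 addr0.
  by apply: cvgD; apply: cvg_norm; apply: cvgB => //; exact: cvg_cst.
apply: squeeze_cvgr (@cvg_cst _ _ _ _ _) h.
near=> n; rewrite cmod_ge0/=.
apply: le_trans (cmod_ReIm _) _.
by rewrite !raddfB.
Unshelve. all: by end_near. Qed.

Lemma ccvg_Re u l : ccvg u l -> (fun n => complex.Re (u n)) @ \oo --> complex.Re l.
Proof.
move=> /ccvgP ul; apply/cvgrPdist_lt => e /ul[N Nh].
exists N => //= n /= /Nh; apply: le_lt_trans; rewrite distrC.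
by apply: le_trans (cmod_Re _); rewrite raddfB.
Qed.

Lemma ccvg_Im u l : ccvg u l -> (fun n => complex.Im (u n)) @ \oo --> complex.Im l.
Proof.
move=> /ccvgP ul; apply/cvgrPdist_lt => e /ul[N Nh].
exists N => //= n /= /Nh; apply: le_lt_trans; rewrite distrC.
by apply: le_trans (cmod_Im _); rewrite raddfB.
Qed.

Lemma ccvg_le u l (B : R) N : (forall n, (N <= n)%N -> cmod (u n) <= B) ->
  ccvg u l -> cmod l <= B.
Proof.
move=> h /ccvg_cmod ul; apply: (cvgr_to_le ul).
by exists N => // n /= /h.
Qed.


Lemma bounded_series_tail (c : nat -> R) B : (forall n, 0 <= c n) ->
  (forall N, series c N <= B) ->
  forall e, 0 < e -> exists N, forall M, \sum_(N <= k < M) c k <= e.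
Proof.
move=> c0 cB e e0.
have nd : nondecreasing_seq (series c).
  by apply/nondecreasing_seqP => n; rewrite !seriesEnat /= big_nat_recr//= lerDl.
have cv : cvgn (series c).
  by apply: nondecreasing_is_cvgn => //; exists B => _ [n _ <-].
have [N _ Nh] := cvgr_gt _ cv (limn (series c) - e) ltac:(by rewrite ltrBlDr ltrDl).
exists N => M; have [NM|MN] := leqP N M; last by rewrite big_geq ?ltW// ltnW.
have h1 := nondecreasing_cvgn_le nd cv M; have h2 := Nh N (leqnn N).
have h3 : series c M = series c N + \sum_(N <= k < M) c k.
  by rewrite /series /= (@big_cat_nat _ _ _ N 0 M).
rewrite h3 /= in h1 h2; lra.
Qed.

Lemma ccvg_series_tail u l N (e : R) : ccvg (series u) l ->
  (forall M, \sum_(N <= k < M) cmod (u k) <= e) -> cmod (l - series u N) <= e.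
Proof.
move=> ul h.
apply: (@ccvg_le (fun n => series u n - series u N) _ _ N).
  move=> M NM; rewrite /series /= (@big_cat_nat _ _ _ N 0 M)//= addrAC subrr add0r.
  exact: le_trans (cmod_sum _ _ _) (h M).
by apply: ccvgB => //; exact: ccvg_cst.
Qed.

Lemma ccvg_series_le u l (B : R) : ccvg (series u) l ->
  (forall N, series (fun n => cmod (u n)) N <= B) -> cmod l <= B.
Proof.
move=> ul h; have := @ccvg_series_tail u l 0 B ul h.
by rewrite /series /= big_geq// subr0.
Qed.

Lemma ccvg_series_abs u (B : R) : (forall N, series (fun n => cmod (u n)) N <= B) ->
  exists l, ccvg (series u) l.
Proof.
move=> uB.
have cv : cvgn (series (fun n => cmod (u n))).
  apply: nondecreasing_is_cvgn; last by exists B => _ [n _ <-].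
  apply/nondecreasing_seqP => n.
  by rewrite !seriesEnat /= big_nat_recr//= lerDl cmod_ge0.
have cR : cvgn (series (fun n => complex.Re (u n))).
  apply: normed_cvg; apply: series_le_cvg cv => n /=; rewrite ?cmod_ge0 ?normr_ge0//.
  exact: cmod_Re.
have cI : cvgn (series (fun n => complex.Im (u n))).
  apply: normed_cvg; apply: series_le_cvg cv => n /=; rewrite ?cmod_ge0 ?normr_ge0//.
  exact: cmod_Im.
exists (Complex (limn (series (fun n => complex.Re (u n))))
                (limn (series (fun n => complex.Im (u n))))).
by apply: ccvg_ReIm => /=; under eq_fun do rewrite /series /= raddf_sum.
Qed.

(** Dominated convergence for series. Past an index [N] where the tail of [c] is at most e/4, both
    full sums differ from their [N]-th partial sums by at most e/4, and the partial sums converge as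
    finite sums do. *)
Lemma tannery (c : nat -> R) B (U : nat -> nat -> R[i]) v (S : nat -> R[i]) T :
  (forall N, series c N <= B) -> (forall K n, cmod (U K n) <= c n) ->
  (forall n, ccvg (U ^~ n) (v n)) -> (forall K, ccvg (series (U K)) (S K)) ->
  ccvg (series v) T -> ccvg S T.
Proof.
move=> cB Uc Uv US vT; apply/ccvgP => e e0.
have c0 n : 0 <= c n by exact: le_trans (cmod_ge0 _) (Uc 0%N n).
have [|N Nh] := bounded_series_tail c0 cB (e := e / 4); first by rewrite divr_gt0.
have vc n : cmod (v n) <= c n by apply: (ccvg_le (N := 0%N) _ (Uv n)).
have /ccvgP/(_ (e / 4)) [|M Mh] :
  ccvg (fun K => series (U K) N) (series v N).
- by apply: ccvg_sum => i; exact: Uv.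
- by rewrite divr_gt0.
exists M => K /Mh h1.
have h2 : cmod (S K - series (U K) N) <= e / 4.
  by apply: ccvg_series_tail => // M'; apply: le_trans (Nh M'); exact: ler_sum.
have h3 : cmod (T - series v N) <= e / 4.
  by apply: ccvg_series_tail => // M'; apply: le_trans (Nh M'); exact: ler_sum.
have -> : S K - T = (S K - series (U K) N) + (series (U K) N - series v N) -
                    (T - series v N) by ring.
have := cmodB (S K - series (U K) N + (series (U K) N - series v N)) (T - series v N).
have := cmodD (S K - series (U K) N) (series (U K) N - series v N).
lra.
Qed.

Lemma ccvg_series_terms_bounded u l : ccvg (series u) l -> exists M, forall n, cmod (u n) <= M.
Proof.
move=> /ccvgP/(_ 1 ltr01)[N Nh].
exists (2 + \sum_(0 <= k < N) cmod (u k)) => n.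
have [nN|Nn] := ltnP n N.
  rewrite (bigD1_seq n) ?mem_index_iota ?iota_uniq//= addrCA lerDl.
  by rewrite addr_ge0// sumr_ge0// => k _; exact: cmod_ge0.
rewrite (@le_trans _ _ 2)//; last first.
  by rewrite lerDl sumr_ge0// => k _; exact: cmod_ge0.
have h1 := Nh n Nn; have h2 := Nh n.+1 (leqW Nn).
have -> : u n = (series u n.+1 - l) - (series u n - l).
  by rewrite /series /= big_nat_recr//=; ring.
have := cmodB (series u n.+1 - l) (series u n - l); lra.
Qed.


Lemma series_terms_le (a : nat -> R[i]) (M r s : R) N :
  (forall n, cmod (a n) * s ^+ n <= M) -> 0 <= r < s ->
  series (fun n => cmod (a n) * r ^+ n) N <= M / (1 - r / s).
Proof.
move=> aM /andP[r0 rs].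
have s0 : 0 < s by exact: le_lt_trans rs.
pose q := r / s.
have q0 : 0 <= q by rewrite divr_ge0// ltW.
have q1 : q < 1 by rewrite ltr_pdivrMr// mul1r.
have M0 : 0 <= M by apply: le_trans (aM 0%N); rewrite expr0 mulr1 cmod_ge0.
rewrite -/q ler_pdivlMr ?subr_gt0//.
apply: (@le_trans _ _ (\sum_(0 <= k < N) M * q ^+ k * (1 - q))).
  rewrite -mulr_suml ler_wpM2r ?subr_ge0 ?(ltW q1)//.
  rewrite /series /= ler_sum// => n _.
  have -> : r = s * q by rewrite /q mulrCA divff ?mulr1// gt_eqF.
  by rewrite exprMn mulrA ler_wpM2r ?exprn_ge0.
have -> : \sum_(0 <= k < N) M * q ^+ k * (1 - q) = M * (1 - q ^+ N).
  elim: N => [|N IH]; first by rewrite big_geq// expr0 subrr mulr0.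
  by rewrite big_nat_recr//= IH exprS; ring.
by rewrite ler_piMr// gerBl exprn_ge0.
Qed.

Lemma power_series_abs (a : nat -> R[i]) z l (r : R) :
  ccvg (series (fun n => a n * z ^+ n)) l -> 0 <= r < cmod z ->
  exists B, forall N, series (fun n => cmod (a n) * r ^+ n) N <= B.
Proof.
move=> /ccvg_series_terms_bounded[M Mh] rz; exists (M / (1 - r / cmod z)) => N.
by apply: series_terms_le => // n; rewrite -cmodX -cmodM.
Qed.

(** Identity theorem at 0, by strong induction: once the coefficients below [n] vanish, c_n h^n is
    minus the tail, which is at most (|h| / r)^(n+1) B. For small h this is of smaller order than
    |c_n| |h|^n. *)
Lemma power_series_zero (c : nat -> R[i]) (r B : R) : 0 < r ->
  (forall N, series (fun n => cmod (c n) * r ^+ n) N <= B) ->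
  (forall e, 0 < e -> exists2 h, 0 < cmod h < e &
    ccvg (series (fun n => c n * h ^+ n)) 0) ->
  forall n, c n = 0.
Proof.
move=> r0 cB ch n; have [m nm] := ubnP n; elim: m n nm => // m IH n nm.
have {}IH k : (k < n)%N -> c k = 0 by move=> kn; apply: IH; lia.
apply/eqP; rewrite -cmod_eq0; apply/negP => /negP cn0.
have {}cn0 : 0 < cmod (c n) by rewrite lt_neqAle eq_sym cn0 cmod_ge0.
have B0 : 0 <= B by have := cB 0%N; rewrite /series /= big_geq.
(* Below this threshold |h| B < |c_n| r^(n+1), which contradicts the bound on the tail; [B + 1]
   avoids a division by zero. *)
have [|h /andP[h0]] := ch (Num.min r (cmod (c n) * r ^+ n.+1 / (B + 1))).
  by rewrite lt_min r0 !mulr_gt0 ?exprn_gt0 ?invr_gt0 ?ltr_wpDl.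
rewrite lt_min => /andP[hr hc] /ccvg_series_tail ct.
suff /ct : forall M, \sum_(n.+1 <= k < M) cmod (c k * h ^+ k) <= (cmod h / r) ^+ n.+1 * B.
  rewrite sub0r cmodN /series /= big_nat_recr//= big1_seq ?add0r; last first.
    by move=> k; rewrite mem_index_iota /= => /IH ->; rewrite mul0r.
  apply/negP; rewrite -ltNge cmodM cmodX.
  rewrite expr_div_n mulrAC ltr_pdivrMr ?exprn_gt0//.
  have -> : cmod h ^+ n.+1 * B = cmod h ^+ n * (cmod h * B) by rewrite exprS; ring.
  have -> : cmod (c n) * cmod h ^+ n * r ^+ n.+1 =
            cmod h ^+ n * (cmod (c n) * r ^+ n.+1) by ring.
  rewrite ltr_pM2l ?exprn_gt0//.
  move: hc; rewrite ltr_pdivlMr ?ltr_wpDl//; apply: le_lt_trans.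
  by rewrite ler_wpM2l ?cmod_ge0// lerDl.
have hr1 : cmod h / r < 1 by rewrite ltr_pdivrMr// mul1r.
have hr0 : 0 <= cmod h / r by rewrite divr_ge0 ?cmod_ge0 ?ltW.
move=> M.
  have [nM|Mn] := leqP n.+1 M; last first.
    by rewrite big_geq ?(ltnW Mn)// mulr_ge0// exprn_ge0.
  apply: le_trans (_ : (cmod h / r) ^+ n.+1 * series (fun n => cmod (c n) * r ^+ n) M <= _).
    rewrite /series /= (@big_cat_nat _ _ _ n.+1 0 M)//= mulrDr ler_wpDl//.
      rewrite mulr_ge0 ?exprn_ge0// sumr_ge0// => k _.
      by rewrite mulr_ge0 ?cmod_ge0// exprn_ge0 ?ltW.
    rewrite mulr_sumr big_nat_cond [leRHS]big_nat_cond ler_sum// => k /andP[/andP[nk _] _].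
    rewrite cmodM cmodX.
    have -> : cmod h ^+ k = (cmod h / r) ^+ k * r ^+ k.
      by rewrite -exprMn divfK// gt_eqF.
    rewrite mulrCA ler_wpM2r//.
      by rewrite mulr_ge0 ?cmod_ge0// exprn_ge0 ?ltW.
    by rewrite ler_wiXn2l// ltW.
by rewrite ler_wpM2l ?exprn_ge0.
Qed.

(** The truncation [K] is unrelated to [n]: terms with k > n vanish with the binomial coefficient,
    so the truncated subtraction [n - k] is harmless. *)
Lemma binomial_partial_le (s t : R) K n : 0 <= s -> 0 <= t ->
  \sum_(0 <= k < K) 'C(n, k)%:R * s ^+ (n - k) * t ^+ k <= (s + t) ^+ n.
Proof.
move=> s0 t0.
have h0 k : 0 <= 'C(n, k)%:R * s ^+ (n - k) * t ^+ k.
  by rewrite !mulr_ge0 ?exprn_ge0.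
apply: (@le_trans _ _ (\sum_(0 <= k < K + n.+1) 'C(n, k)%:R * s ^+ (n - k) * t ^+ k)).
  by rewrite [leRHS](@big_cat_nat _ _ _ K) ?leq_addr//= lerDl sumr_ge0.
rewrite exprDn (@big_cat_nat _ _ _ n.+1) ?leq_addl//= [X in _ + X]big1_seq ?addr0.
  rewrite big_mkord ler_sum// => k _.
  by rewrite -mulrA mulr_natl.
by move=> k; rewrite mem_index_iota /= => /andP[nk _]; rewrite bin_small ?mul0r.
Qed.

(** Expand (z0 + h)^n by the binomial formula and exchange the sums; everything is dominated by
    |a_n| (s + t)^n. The first conclusion keeps each [b k] as an explicit series, since it will
    later be read as a function of z0. *)
Lemma power_series_recenter (a : nat -> R[i]) z0 (s t B : R) :
  0 <= s -> 0 < t -> cmod z0 <= s ->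
  (forall N, series (fun n => cmod (a n) * (s + t) ^+ n) N <= B) ->
  exists b : nat -> R[i], [/\
    forall k, ccvg (series (fun n => 'C(n, k)%:R * a n * z0 ^+ (n - k))) (b k),
    forall k, cmod (b k) * t ^+ k <= B &
    forall h l, cmod h <= t -> ccvg (series (fun n => a n * (z0 + h) ^+ n)) l ->
      ccvg (series (fun k => b k * h ^+ k)) l].
Proof.
move=> s0 t0 z0s aB.
have hb k : forall N, series (fun n => cmod ('C(n, k)%:R * a n * z0 ^+ (n - k))) N
    <= B / t ^+ k.
  move=> N; rewrite ler_pdivlMr ?exprn_gt0//; apply: le_trans (aB N).
  rewrite /series /= mulr_suml ler_sum// => n _.
  rewrite !cmodM cmod_nat cmodX.
  have -> : 'C(n, k)%:R * cmod (a n) * cmod z0 ^+ (n - k) * t ^+ k =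
            cmod (a n) * ('C(n, k)%:R * cmod z0 ^+ (n - k) * t ^+ k) by ring.
  rewrite ler_wpM2l ?cmod_ge0//.
  apply: le_trans (@binomial_partial_le s t k.+1 n s0 (ltW t0)).
  rewrite big_nat_recr//= ler_wpDl//.
    by rewrite sumr_ge0// => i _; rewrite !mulr_ge0 ?exprn_ge0// ltW.
  rewrite ler_wpM2r ?exprn_ge0 ?(ltW t0)// ler_wpM2l// lerXn2r ?nnegrE//.
  exact: cmod_ge0.
have /choice[b bh] : forall k, exists b,
    ccvg (series (fun n => 'C(n, k)%:R * a n * z0 ^+ (n - k))) b.
  by move=> k; exact: ccvg_series_abs (hb k).
exists b; split; [exact: bh|move=> k|move=> h l ht al].
  by rewrite -ler_pdivlMr ?exprn_gt0//; exact: ccvg_series_le (bh k) (hb k).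
(* [K] truncates the binomial expansion at k < K. Summing over n then gives the K-th partial sum of
   the recentred series, so Tannery's theorem performs the exchange. *)
apply: (@tannery (fun n => cmod (a n) * (s + t) ^+ n) B
  (fun K n => a n * \sum_(0 <= k < K) 'C(n, k)%:R * z0 ^+ (n - k) * h ^+ k)
  _ _ _ aB _ _ _ al).
- move=> K n; rewrite cmodM ler_wpM2l ?cmod_ge0//.
  apply: le_trans (cmod_sum _ _ _) _.
  apply: le_trans (@binomial_partial_le s t K n s0 (ltW t0)).
  rewrite ler_sum// => k _; rewrite !cmodM cmod_nat !cmodX.
  rewrite ler_pM ?mulr_ge0 ?exprn_ge0 ?cmod_ge0//.
    by rewrite ler_wpM2l// lerXn2r ?nnegrE ?cmod_ge0.
  by rewrite lerXn2r ?nnegrE ?cmod_ge0// ltW.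
- move=> n; apply: (@ccvg_eventually (fun=> a n * (z0 + h) ^+ n) _ _ n.+1 _
    (ccvg_cst _)) => K nK.
  rewrite exprDn; congr (_ * _).
  rewrite [RHS](@big_cat_nat _ _ _ n.+1 0 K)//= [X in _ = _ + X]big1_seq ?addr0.
    by rewrite big_mkord; apply: eq_bigr => k _; rewrite -mulrA mulr_natl.
  by move=> k; rewrite mem_index_iota /= => /andP[nk _]; rewrite bin_small ?mul0r.
- move=> K; rewrite /series /=.
  have -> : (fun N => \sum_(0 <= n < N) (a n * \sum_(0 <= k < K)
      'C(n, k)%:R * z0 ^+ (n - k) * h ^+ k)) =
    (fun N => \sum_(0 <= k < K) h ^+ k * \sum_(0 <= n < N)
      'C(n, k)%:R * a n * z0 ^+ (n - k)).
    apply/funext => N; under eq_bigr do rewrite mulr_sumr.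
    rewrite exchange_big /=; apply: eq_bigr => k _; rewrite mulr_sumr.
    by apply: eq_bigr => n _; ring.
  under [X in ccvg _ X]eq_bigr do rewrite mulrC.
  by apply: ccvg_sum => k; apply: ccvgZ; exact: bh.
Qed.

End ComplexSequences.

(** * Roots of unity and Taylor series *)

Section RootsOfUnity.
Variable R : realType.
Implicit Types (a : nat -> R[i]) (z w : R[i]).

(** X^n - 1 splits over an algebraically closed field and has n distinct roots in characteristic 0;
    among n distinct n-th roots of unity one is primitive. *)
Lemma prim_root_exists n : (0 < n)%N -> exists w : R[i], n.-primitive_root w.
Proof.
pose p : {poly R[i]} := 'X^n - 1; have [r Dp] := closed_field_poly_normal p.
move=> n_gt0; rewrite (monicP _) ?monicXnsubC // scale1r in Dp.
have rn1 : all n.-unity_root r by apply/allP=> z; rewrite -root_prod_XsubC -Dp.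
have sz_r : (n < (size r).+1)%N.
  by rewrite -(size_prod_XsubC r id) -Dp size_XnsubC.
have [|z] := hasP (has_prim_root n_gt0 rn1 _ sz_r); last by exists z.
rewrite -separable_prod_XsubC -Dp separable_Xn_sub_1 //.
by rewrite pnatr_eq0 -lt0n.
Qed.

Lemma prim_root_cmod n w : (0 < n)%N -> n.-primitive_root w -> cmod w = 1.
Proof.
move=> n0 /prim_expr_order h; have : cmod (w ^+ n) = 1 by rewrite h cmod1.
rewrite cmodX => /eqP; rewrite pexpr_eq1//; last exact: cmod_ge0.
by move/eqP.
Qed.

(** Orthogonality of characters: for i != m the ratio q = w^i / w^m differs from 1 while q^n = 1, so
    its geometric sum vanishes. The bounds on i and m turn congruence modulo n into equality. *)
Lemma prim_root_average n w i m : (0 < n)%N -> n.-primitive_root w ->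
  (i < n)%N -> (m < n)%N ->
  n%:R^-1 * \sum_(0 <= k < n) (w ^+ k) ^+ i / (w ^+ k) ^+ m = (i == m)%:R.
Proof.
move=> n0 hw lin lmn.
have w0 : w != 0 by rewrite -cmod_eq0 (prim_root_cmod n0 hw) oner_eq0.
have nn0 : n%:R != 0 :> R[i] by rewrite pnatr_eq0 -lt0n.
have [->|im] := eqVneq i m.
  under eq_bigr do rewrite divff ?expf_neq0//.
  by rewrite sumr_const_nat subn0 mulVf.
pose q := w ^+ i / w ^+ m.
have q1 : q != 1.
  rewrite /q -subr_eq0 -(@divff _ (w ^+ m)) ?expf_neq0// -mulrBl mulf_eq0 negb_or.
  rewrite subr_eq0 (eq_prim_root_expr hw) !modn_small// im invr_eq0 expf_neq0//.
apply/eqP; rewrite mulf_eq0 invr_eq0 (negbTE nn0)/=.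
have -> : \sum_(0 <= k < n) (w ^+ k) ^+ i / (w ^+ k) ^+ m = \sum_(k < n) q ^+ k.
  rewrite big_mkord; apply: eq_bigr => k _.
  by rewrite /q expr_div_n -!exprM mulnC [in X in _ / X]mulnC.
have := subrX1 q n.
have -> : q ^+ n = 1.
  by rewrite /q expr_div_n -!exprM ![(_ * n)%N]mulnC !exprM (prim_expr_order hw) !expr1n divr1.
rewrite subrr => /esym/eqP; rewrite mulf_eq0 subr_eq0 (negbTE q1)//.
Qed.

(** A discrete Fourier coefficient of frequency j - i. Two natural numbers encode the frequency
    because negative ones occur as well: summed over all i, j < N the factors form the Fejer
    kernel. *)
Definition root_average (w : R[i]) n i j (G : R[i] -> R[i]) z :=
  n%:R^-1 * \sum_(0 <= k < n) (w ^+ k) ^+ i / (w ^+ k) ^+ j * G (w ^+ k * z).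

(* The averages pick out the coefficients m with i + m = j mod n, so that only
   m = j - i survives in the limit. *)
Lemma root_average_cvg a (om : nat -> R[i]) z B G i j :
  (forall n, n.+1.-primitive_root (om n)) ->
  (forall N, series (fun n => cmod (a n) * cmod z ^+ n) N <= B) ->
  (forall x, cmod x = cmod z -> ccvg (series (fun m => a m * x ^+ m)) (G x)) ->
  ccvg (fun n => root_average (om n) n.+1 i j G z)
       (if (i <= j)%N then a (j - i)%N * z ^+ (j - i) else 0).
Proof.
move=> hom aB aG.
(* The factor multiplying a_m z^m in the average. Its modulus is at most 1, which gives the
   domination, and it equals 1 or 0 according to i + m = j once i + m and j are at most n. *)
pose cf n m := n.+1%:R^-1 * \sum_(0 <= k < n.+1) (om n ^+ k) ^+ (i + m) / (om n ^+ k) ^+ j.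
have cf1 n m : cmod (cf n m) <= 1.
  rewrite cmodM cmodV cmod_nat mulrC ler_pdivrMr ?ltr0n// mul1r.
  apply: le_trans (cmod_sum _ _ _) _.
  rewrite -[leRHS](_ : \sum_(0 <= k < n.+1) 1 = _); last first.
    by rewrite sumr_const_nat subn0.
  apply: ler_sum => k _; rewrite cmodM cmodV !cmodX (prim_root_cmod _ (hom n))//.
  by rewrite !expr1n divr1.
apply: (@tannery _ (fun n => cmod (a n) * cmod z ^+ n) B
  (fun n m => a m * z ^+ m * cf n m)
  (fun m => if (i + m == j)%N then a m * z ^+ m else 0)) => //.
- move=> n m; rewrite cmodM cmodM cmodX; apply: ler_piMr (cf1 n m).
  by rewrite mulr_ge0 ?exprn_ge0 ?cmod_ge0.
- move=> m; apply: (@ccvg_eventually _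
    (fun=> if (i + m == j)%N then a m * z ^+ m else 0) _ _ (i + m + j)%N _ (ccvg_cst _)).
  move=> n hn; rewrite /cf (prim_root_average _ (hom n))//; [|lia|lia].
  by case: ifP => _; rewrite ?mulr1 ?mulr0.
- move=> n; rewrite /root_average.
  have -> : series (fun m => a m * z ^+ m * cf n m) =
     (fun N => n.+1%:R^-1 * \sum_(0 <= k < n.+1) ((om n ^+ k) ^+ i / (om n ^+ k) ^+ j) *
       series (fun m => a m * (om n ^+ k * z) ^+ m) N).
    apply/funext => N; rewrite /series /= /cf.
    under [in RHS]eq_bigr do rewrite mulr_sumr.
    rewrite exchange_big/= mulr_sumr; apply: eq_bigr => m _.
    rewrite mulrCA !mulr_sumr; apply: eq_bigr => k _.
    by rewrite exprD exprMn; ring.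
  apply: ccvgZ; apply: ccvg_sum => k; apply: ccvgZ; apply: aG.
  by rewrite cmodM cmodX (prim_root_cmod _ (hom n))// expr1n mul1r.
- apply: (@ccvg_eventually _ (fun=> if (i <= j)%N then a (j - i)%N * z ^+ (j - i) else 0)
    _ _ j.+1 _ (ccvg_cst _)) => N jN.
  rewrite /series /=; case: leqP => ij.
    rewrite (bigD1_seq (j - i)%N) ?mem_index_iota ?iota_uniq//=; last by lia.
    rewrite subnKC// eqxx big1 ?addr0// => m mj; case: eqP => // h.
    by move: mj; rewrite -h addKn eqxx.
  by rewrite big1// => m _; case: eqP => // h; lia.
Qed.

Lemma prim_root_choice : exists om : nat -> R[i], forall n, n.+1.-primitive_root (om n).
Proof.
have /choice[om hom] : forall n, exists w : R[i], n.+1.-primitive_root w.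
  by move=> n; exact: prim_root_exists.
by exists om.
Qed.

(** The j-th term is a limit of averages of [G] over points of the circle |x| = |z|, with weights
    whose moduli add up to 1. Hence a bound for [G] on that circle is enough. *)
Lemma cauchy_inequality a z (B M : R) (G : R[i] -> R[i]) j :
  (forall N, series (fun n => cmod (a n) * cmod z ^+ n) N <= B) ->
  (forall x, cmod x = cmod z -> ccvg (series (fun m => a m * x ^+ m)) (G x)) ->
  (forall x, cmod x = cmod z -> cmod (G x) <= M) ->
  cmod (a j) * cmod z ^+ j <= M.
Proof.
move=> aB aG GM; have [om hom] := prim_root_choice.
have := root_average_cvg 0 j hom aB aG; rewrite leq0n subn0.
rewrite -cmodX -cmodM; apply: (@ccvg_le _ _ _ _ 0) => n _.
rewrite cmodM cmodV cmod_nat mulrC ler_pdivrMr ?ltr0n//.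
apply: le_trans (cmod_sum _ _ _) _.
rewrite -[leRHS](_ : \sum_(0 <= k < n.+1) M = _); last first.
  by rewrite sumr_const_nat subn0 mulr_natr.
apply: ler_sum => k _; rewrite !cmodM cmodV !cmodX (prim_root_cmod _ (hom n))//.
rewrite !expr1n divr1 mul1r; apply: GM.
by rewrite cmodM cmodX (prim_root_cmod _ (hom n))// expr1n mul1r.
Qed.

End RootsOfUnity.

(** * From local power series to one expansion on the disc *)

Section TaylorSeries.
Variable R : realType.
Implicit Types (a b : nat -> R[i]) (z w : R[i]) (f : R[i] -> R[i]).

Lemma psum_atE a z0 z s :
  psum_at a z0 z s <-> ccvg (series (fun n => a n * (z - z0) ^+ n)) s.
Proof. exact: ccvgE. Qed.

(** One integer controls both the radius 1/(m+1) and the coefficients, and the condition weakens as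
    [m] grows. Uniformity over a compact set thus becomes a statement about all large [m], the form
    that the covering argument along [\oo] expects. *)
Definition uniformly_analytic_at f (m : nat) z0 := exists b,
  (forall k, cmod (b k) <= m.+1%:R ^+ k.+1) /\
  (forall z, cmod (z - z0) < m.+1%:R^-1 ->
    ccvg (series (fun k => b k * (z - z0) ^+ k)) (f z)).

(** The expansion at z, recentred at z0, has radius r/4 and coefficients at most B (4/r)^k; any m
    with m + 1 >= 4/r + B absorbs both constants. *)
Lemma analytic_near f z : analytic_on_disc f -> unit_disc z ->
  exists2 d : R, 0 < d & exists m0, forall z0 m,
    cmod (z0 - z) < d -> (m0 <= m)%N -> uniformly_analytic_at f m z0.
Proof.
move=> fa /fa[r r0 [a ha]].
(* Convergence at distance 3r/4 gives absolute convergence at radius r/4 + r/4: one quarter for the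
   move from z to z0, one for the new radius. *)
pose y : R[i] := (r * (3 / 4))%:C%C.
have ycm : cmod y = r * (3 / 4) by rewrite cmod_real ger0_norm// mulr_ge0 ?ltW//; lra.
have /psum_atE := ha (z + y) ltac:(rewrite addrAC subrr add0r ycm; lra).
rewrite addrAC subrr add0r => hy.
have [|B aB] := @power_series_abs _ a y _ (r / 4 + r / 4) hy; first by rewrite ycm; lra.
exists (r / 4); first lra.
have [m0 m0h] : exists m0, 4 / r + B <= m0%:R.
  by exists (Num.truncn (4 / r + B)).+1; rewrite ltW// truncnS_gt.
have r4 : 0 < 4 / r by rewrite divr_gt0.
have B0 : 0 <= B by have := aB 0%N; rewrite /series /= big_geq.
exists m0 => z0 m zz0 m0m.
have m0m' : m0%:R <= m.+1%:R :> R by rewrite ler_nat leqW.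
have [| |b [_ bB bh]] := @power_series_recenter _ a (z0 - z) (r / 4) (r / 4) B _ _ (ltW zz0) aB.
- lra.
- lra.
exists b; split=> [k|x xz0].
  have {}bB := bB k.
  have : cmod (b k) <= B * (4 / r) ^+ k.
    have -> : 4 / r = (r / 4)^-1 by rewrite invf_div.
    by rewrite exprVn ler_pdivlMr// exprn_gt0// divr_gt0.
  move/le_trans; apply; rewrite exprS ler_pM ?exprn_ge0 ?(ltW r4)//; first lra.
  by apply: lerXn2r; rewrite ?nnegrE ?(ltW r4)//; lra.
have hx : cmod (x - z0) < r / 4.
  apply: lt_le_trans xz0 _; rewrite -[leRHS]invrK invf_div lef_pV2 ?posrE//; lra.
apply: bh; first exact: ltW.
have -> : (fun n => a n * (z0 - z + (x - z0)) ^+ n) = (fun n => a n * (x - z) ^+ n).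
  by apply/funext => n; congr (_ * _ ^+ n); ring.
apply/psum_atE; apply: ha.
have -> : x - z = (x - z0) + (z0 - z) by ring.
by have := cmodD (x - z0) (z0 - z); lra.
Qed.

(** Compactness of the square [-1, 1]^2. Points of modulus above rho have a neighbourhood where the
    claim is vacuous; the others are covered by [analytic_near]. *)
Lemma analytic_uniform f (rho : R) : analytic_on_disc f -> 0 < rho < 1 ->
  exists m, forall z, cmod z <= rho -> uniformly_analytic_at f m z.
Proof.
move=> fa /andP[rho0 rho1].
have /compact_near_coveringP cK : compact (`[-1, 1] `*` `[-1, 1] : set (R * R)).
  by apply: compact_setX; exact: segment_compact.
pose P (m : nat) (u : R * R) := cmod (Complex u.1 u.2) <= rho ->
  uniformly_analytic_at f m (Complex u.1 u.2).
have nb (u : R * R) (d : R) : 0 < d ->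
    \forall u' \near u, cmod (Complex u'.1 u'.2 - Complex u.1 u.2) < d.
  move=> d0; exists (ball u.1 (d / 2), ball u.2 (d / 2)).
    by split; apply: nbhsx_ballx; rewrite divr_gt0.
  move=> [x y] [h1 h2]; apply: le_lt_trans (cmod_ReIm _) _ => /=.
  rewrite -ball_normE /= in h1; rewrite -ball_normE /= in h2.
  by rewrite (distrC x) (distrC y); lra.
have [|N _ Nh] := cK nat \oo P _.
  move=> u _; have [ur|ru] := leP (cmod (Complex u.1 u.2)) rho.
    have [|d d0 [m0 h]] := @analytic_near f (Complex u.1 u.2) fa.
      exact: le_lt_trans rho1.
    exists ([set v | cmod (Complex v.1 v.2 - Complex u.1 u.2) < d],
            [set m | (m0 <= m)%N]).
      by split; [exact: nb | exists m0].
    by move=> [u' m] [h1 h2] _; apply: h.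
  exists ([set v | cmod (Complex v.1 v.2 - Complex u.1 u.2) <
                   cmod (Complex u.1 u.2) - rho], setT).
    by split; [apply: nb; rewrite subr_gt0 | exact: filterT].
  move=> [u' m] [h _] u'r.
  have {h} : cmod (Complex u'.1 u'.2 - Complex u.1 u.2) < cmod (Complex u.1 u.2) - rho := h.
  rewrite cmodBC; have {u'r} : cmod (Complex u'.1 u'.2) <= rho := u'r.
  have := cmod_lerB (Complex u.1 u.2) (Complex u'.1 u'.2); lra.
exists N => z zr; have := Nh N (leqnn N) (complex.Re z, complex.Im z).
rewrite /P /=; case: z zr => x y zr; apply => //=.
have := cmod_Re (Complex x y); have := cmod_Im (Complex x y) => /= hy hx.
by rewrite !in_itv/= -!ler_norml; split; apply: ltW; apply: le_lt_trans rho1; exact: le_trans zr.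
Unshelve. all: by end_near. Qed.

(** Near z0 the local series given by uniform analyticity and the recentred series at 0 both
    represent f, so they agree by the identity theorem. The bound on the former thereby applies to
    the explicit sums of the latter. *)
Lemma taylor_local f a (rho : R) m z0 : 
  (forall z, cmod z < rho -> ccvg (series (fun n => a n * z ^+ n)) (f z)) ->
  uniformly_analytic_at f m z0 -> cmod z0 < rho ->
  exists b, [/\ forall k, ccvg (series (fun n => 'C(n, k)%:R * a n * z0 ^+ (n - k))) (b k),
    forall k, cmod (b k) <= m.+1%:R ^+ k.+1 &
    forall z, cmod (z - z0) < m.+1%:R^-1 ->
      ccvg (series (fun k => b k * (z - z0) ^+ k)) (f z)].
Proof.
move=> af [b [bm bf]] z0r; exists b; split => //.
set t := (rho - cmod z0) / 3.
have t0 : 0 < t by rewrite /t; lra.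
have z00 := cmod_ge0 z0.
have yc : cmod ((cmod z0 + 2 * t)%:C%C : R[i]) = cmod z0 + 2 * t.
  by rewrite cmod_real ger0_norm//; lra.
have [|B aB] := @power_series_abs _ a (cmod z0 + 2 * t)%:C%C _ (cmod z0 + t)
  (af (cmod z0 + 2 * t)%:C%C ltac:(rewrite yc /t; lra)).
  by rewrite yc; lra.
have [d [dk dB df]] := power_series_recenter z00 t0 (lexx _) aB.
suff db k : b k = d k by move=> k; rewrite db; exact: dk.
apply/eqP; rewrite -subr_eq0; apply/eqP.
pose r := Num.min t (m.+1%:R^-1 / 2).
have m0 : 0 < m.+1%:R^-1 :> R by rewrite invr_gt0.
have r0 : 0 < r by rewrite lt_min t0 divr_gt0.
have rt : r <= t by rewrite ge_min lexx.
have rm : r < m.+1%:R^-1.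
  by rewrite gt_min; apply/orP; right; rewrite ltr_pdivrMr// ltr_pMr// ltr1n.
have conv x : cmod x <= r -> ccvg (series (fun k => (b k - d k) * x ^+ k)) 0.
  move=> xr; have z0x : z0 + x - z0 = x by ring.
  have h1 := bf (z0 + x) ltac:(rewrite z0x; exact: le_lt_trans xr rm).
  have h2 : ccvg (series (fun n => a n * (z0 + x) ^+ n)) (f (z0 + x)).
    apply: af; apply: le_lt_trans (cmodD _ _) _.
    have := le_trans xr rt; rewrite /t; lra.
  have h3 := df x _ (le_trans xr rt) h2.
  rewrite -(subrr (f (z0 + x))).
  have -> : series (fun k => (b k - d k) * x ^+ k) = (fun N =>
     series (fun k => b k * (z0 + x - z0) ^+ k) N - series (fun k => d k * x ^+ k) N).
    by apply/funext => N; rewrite /series /= -sumrB; apply: eq_bigr => i _; rewrite z0x mulrBl.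
  exact: ccvgB.
have rc : cmod (r%:C%C : R[i]) = r by rewrite cmod_real ger0_norm// ltW.
have [|B' hB'] := @power_series_abs _ _ _ _ (r / 2) (conv r%:C%C ltac:(by rewrite rc)).
  by rewrite rc; lra.
apply: (@power_series_zero _ (fun k => b k - d k) (r / 2) B') => //; first lra.
move=> e e0; pose x := Num.min r (e / 2).
have x0 : 0 < x by rewrite lt_min r0 divr_gt0.
have xc : cmod (x%:C%C : R[i]) = x by rewrite cmod_real ger0_norm// ltW.
exists (x%:C%C : R[i]); last by apply: conv; rewrite xc ge_min lexx.
by rewrite xc x0 gt_min; apply/orP; right; lra.
Qed.

(** For fixed k the local coefficient f^(k)(z0)/k! is, as a function of z0, the power series \sum_j
    C(j+k, k) a_(j+k) z0^j, bounded by (m+1)^(k+1) on |z0| < rho. The Cauchy inequality on the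
    circle of radius r bounds its coefficient of index n - k. *)
Lemma taylor_coef_bound f a (rho : R) m : 0 < rho ->
  (forall z, cmod z < rho -> ccvg (series (fun n => a n * z ^+ n)) (f z)) ->
  (forall z, cmod z < rho -> uniformly_analytic_at f m z) ->
  forall n k (r : R), 0 < r < rho -> (k <= n)%N ->
    'C(n, k)%:R * cmod (a n) * r ^+ (n - k) <= m.+1%:R ^+ k.+1.
Proof.
move=> rho0 af fu n k r /andP[r0 rr] kn.
pose c j : R[i] := 'C(j + k, k)%:R * a (j + k)%N.
have hb z0 : exists G, cmod z0 < rho -> ccvg (series (fun j => c j * z0 ^+ j)) G /\
    cmod G <= m.+1%:R ^+ k.+1.
  have [z0rho|z0rho] := ltP (cmod z0) rho; last by exists 0.
  have [b [bk bm _]] := taylor_local af (fu _ z0rho) z0rho.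
  exists (b k) => _; split; last exact: bm.
  have := (ccvg_shift _ _ k).2 (bk k).
  apply: (@ccvg_eventually _ _ _ _ 0%N) => N _.
  rewrite /series /= (@big_cat_nat _ _ _ k) ?leq_addl//= big1_seq ?add0r.
    rewrite -{1}[k]add0n big_addn addnK; apply: eq_bigr => j _.
    by rewrite addnK /c.
  by move=> j; rewrite mem_index_iota /= => jk; rewrite bin_small// !mul0r.
have [G Gh] := choice hb.
pose rc : R[i] := r%:C%C.
have rcE : cmod rc = r by rewrite cmod_real ger0_norm// ltW.
pose r' := (r + rho) / 2.
pose rc' : R[i] := r'%:C%C.
have rcE' : cmod rc' = r' by rewrite cmod_real ger0_norm// /r'; lra.
have [hG _] := Gh rc' ltac:(rewrite rcE' /r'; lra).
have [|B cB] := @power_series_abs _ c rc' _ r hG; first by rewrite rcE' /r'; lra.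
have -> : 'C(n, k)%:R * cmod (a n) * r ^+ (n - k) =
    cmod (c (n - k)%N) * cmod rc ^+ (n - k).
  by rewrite rcE /c subnK// cmodM cmod_nat.
apply: (@cauchy_inequality _ c rc B _ G); first by rewrite rcE.
  by move=> x xr; have [|//] := Gh x; rewrite xr rcE.
by move=> x xr; have [|//] := Gh x; rewrite xr rcE.
Qed.

(** Summing the bounds of [taylor_coef_bound] against t^k with t = 1/(2M) gives |a_n| (r + t)^n <= M
    \sum_k 2^-k <= 2M for r < rho, and t does not depend on r. So the series converges beyond rho.
    That its sum is still f there follows by comparing local expansions at a point just inside. *)
Lemma taylor_extend f a (rho : R) : analytic_on_disc f -> 0 < rho < 1 ->
  (forall z, cmod z < rho -> ccvg (series (fun n => a n * z ^+ n)) (f z)) ->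
  exists2 rho', rho < rho' &
  forall z, cmod z < rho' -> ccvg (series (fun n => a n * z ^+ n)) (f z).
Proof.
move=> fa rho01 af; have /andP[rho0 rho1] := rho01.
have [m hm] := analytic_uniform fa rho01.
pose M : R := m.+1%:R.
have M0 : 0 < M by rewrite ltr0n.
pose t := (2 * M)^-1.
have t0 : 0 < t by rewrite invr_gt0 mulr_gt0.
have hm' z : cmod z < rho -> uniformly_analytic_at f m z by move=> /ltW/hm.
(* The coefficient bound needs a radius rho - q below rho; q <= t/2 leaves (rho - q) + t >= rho +
   t/2. *)
pose q := Num.min (rho / 2) (t / 2).
have q0 : 0 < q by rewrite lt_min !divr_gt0.
have q1 : q <= rho / 2 by rewrite ge_min lexx.
have q2 : q <= t / 2 by rewrite ge_min lexx orbT.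
have an n : cmod (a n) * (rho + t / 2) ^+ n <= 2 * M.
  apply: (@le_trans _ _ (cmod (a n) * ((rho - q) + t) ^+ n)).
    by rewrite ler_wpM2l ?cmod_ge0// lerXn2r ?nnegrE; lra.
  rewrite exprDn mulr_sumr.
  apply: (@le_trans _ _ (\sum_(i < n.+1) M * (1 / 2) ^+ i)).
    apply: ler_sum => i _.
    have := @taylor_coef_bound f a rho m rho0 af hm' n i (rho - q) ltac:(lra)
      ltac:(by rewrite -ltnS).
    rewrite -/M => h.
    have -> : cmod (a n) * ((rho - q) ^+ (n - i) * t ^+ i *+ 'C(n, i)) =
      'C(n, i)%:R * cmod (a n) * (rho - q) ^+ (n - i) * t ^+ i.
      by rewrite -[X in _ * X]mulr_natl; ring.
    have -> : M * (1 / 2) ^+ i = M ^+ i.+1 * t ^+ i.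
      have -> : 1 / 2 = M * t :> R by rewrite /t; field; rewrite gt_eqF.
      by rewrite exprMn exprS; ring.
    by rewrite ler_wpM2r// exprn_ge0// ltW.
  have -> : \sum_(i < n.+1) M * (1 / 2) ^+ i = M * 2 * (1 - (1 / 2) ^+ n.+1).
    elim: n => [|n IH]; first by rewrite big_ord1 expr0 expr1; lra.
    by rewrite big_ord_recr/= IH !exprS; lra.
  by rewrite (mulrC 2) ler_piMr ?mulr_ge0 ?(ltW M0)// gerBl exprn_ge0// divr_ge0.
pose r2 := rho + t / 4.
have r20 : 0 < r2 by rewrite /r2; lra.
pose p := r2 / (rho + t / 2).
have rt0 : 0 < rho + t / 2 by lra.
have aB N : series (fun n => cmod (a n) * r2 ^+ n) N <= 2 * M / (1 - p).
  by apply: series_terms_le; rewrite ?(ltW r20)// /r2; lra.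
(* Small enough that z, of modulus below rho + e, lies within 1/M of the point [z1] on its ray with
   modulus rho - e/2, and within the disc where the recentred series converges. *)
pose e := Num.min (t / 16) (Num.min rho (M^-1 / 4)).
have e0 : 0 < e by rewrite /e !lt_min rho0 !divr_gt0// invr_gt0.
have e1 : e <= t / 16 by rewrite /e ge_min lexx.
have e2 : e <= rho by rewrite /e !ge_min lexx orbT.
have e3 : e <= M^-1 / 4 by rewrite /e !ge_min lexx !orbT.
exists (rho + e) => [|z zr]; first lra.
have [/af//|rz] := ltP (cmod z) rho.
have z0 : 0 < cmod z by exact: lt_le_trans rz.
pose th := (rho - e / 2) / cmod z.
have thz : th * cmod z = rho - e / 2 by rewrite /th divfK// gt_eqF.
have th0 : 0 <= th by rewrite divr_ge0 ?ltW//; lra.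
have th1 : th <= 1 by rewrite ler_pdivrMr//; lra.
pose z1 : R[i] := th%:C%C * z.
have z1c : cmod z1 = rho - e / 2 by rewrite cmodM cmod_real ger0_norm.
have zz1 : cmod (z - z1) < 2 * e.
  have -> : z - z1 = (1 - th)%:C%C * z by rewrite /z1 rmorphB mulrBl mul1r.
  by rewrite cmodM cmod_real ger0_norm ?subr_ge0// mulrBl thz; lra.
have M1 : 0 < M^-1 by rewrite invr_gt0.
have z1r : cmod z1 < rho by lra.
have [b [bk _ bf]] := taylor_local af (hm' _ z1r) z1r.
have zM : cmod (z - z1) < M^-1 by move: e3 M1; move: (M^-1) => x; lra.
have hf := bf z zM.
have [] := @power_series_recenter _ a z1 (rho - e / 2) (r2 - (rho - e / 2)) (2 * M / (1 - p)).
- lra.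
- by rewrite /r2; lra.
- by rewrite z1c.
- by rewrite subrKC.
move=> b' [b'k _ b'f].
have [|l al] := @ccvg_series_abs _ (fun n => a n * z ^+ n) (2 * M / (1 - p)).
  move=> N; apply: le_trans (aB N); rewrite /series /= ler_sum// => n _.
  rewrite cmodM cmodX ler_wpM2l ?cmod_ge0// lerXn2r ?nnegrE ?ltW//.
  by rewrite /r2; lra.
suff -> : f z = l by [].
apply: ccvg_unique hf _.
have := b'f (z - z1) l ltac:(rewrite /r2; lra).
rewrite subrKC => /(_ al).
have -> // : b' = b.
by apply/funext => k; exact: ccvg_unique (b'k k) (bk k).
Qed.

(** Take the supremum of the radii t <= 1 on which the series at 0 represents f. The representation
    holds on the disc of that radius, and if the supremum were below 1, [taylor_extend] would push
    it further. *)
Lemma analytic_has_power_series f : analytic_on_disc f ->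
  exists a, has_power_series f a.
Proof.
move=> fa.
have [|r r0 [a ha]] := fa 0; first by change (cmod (0 : R[i]) < 1); rewrite cmod0.
have {}ha z : cmod z < r -> ccvg (series (fun n => a n * z ^+ n)) (f z).
  by move=> zr; have := ha z; rewrite subr0 => /(_ zr)/psum_atE; rewrite subr0.
pose S := [set t : R | 0 < t <= 1 /\
  forall z, cmod z < t -> ccvg (series (fun n => a n * z ^+ n)) (f z)].
have S0 : S (Num.min r 1).
  split; first by rewrite lt_min r0 ltr01 ge_min lexx orbT.
  by move=> z; rewrite lt_min => /andP[/ha].
have hS : has_sup S by split; [exists (Num.min r 1)|exists 1 => x [/andP[]]].
have sup0 : 0 < sup S.
  apply: (@lt_le_trans _ _ (Num.min r 1)); first by rewrite lt_min r0 ltr01.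
  exact: ub_le_sup hS.2 _ S0.
have hsup z : cmod z < sup S -> ccvg (series (fun n => a n * z ^+ n)) (f z).
  by move=> /(sup_gt hS.1)[t [_ h]] /h.
have [s1|s1] := leP 1 (sup S).
  exists a => z zD; apply/psum_atE; rewrite subr0; apply: hsup.
  exact: lt_le_trans s1.
have [|rho' rho1 h] := taylor_extend fa _ hsup; first by rewrite sup0.
have : S (Num.min rho' 1).
  split; first by rewrite lt_min ltr01 ge_min lexx orbT (lt_trans sup0).
  by move=> z; rewrite lt_min => /andP[/h].
by move=> /(ub_le_sup hS.2); rewrite leNgt lt_min rho1 s1.
Qed.

End TaylorSeries.

(** * Integration over the disc *)

Section PlaneLebesgue.
Variable R : realType.
Local Notation mR := (measurableTypeR R).
Local Notation mu := (@lebesgue_measure R).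
Local Notation mu2 := (@lebesgue_measure R \x @lebesgue_measure R)%E.
Local Notation plane := (measurableTypeR R * measurableTypeR R)%type.

Lemma measurable_affine (s c : R) : measurable_fun setT (fun x : mR => s * x + c : mR).
Proof.
by apply: measurable_funD => //; apply: measurable_funM.
Qed.

(** Uniqueness of Lebesgue measure: the right-hand side is a measure with the correct value on
    half-open intervals. *)
Lemma lebesgue_measure_affine (s c : R) (A : set mR) : 0 < s -> measurable A ->
  mu A = (s%:E * mu ((fun x : mR => (s * x + c)%R) @^-1` A))%E.
Proof.
move=> s0 mA.
have ms := measurable_affine s c.
pose f := fun x : mR => s * x + c : mR.
pose m' : {measure set mR -> \bar R} := mscale (NngNum (ltW s0)) (pushforward mu f).
rewrite (@lebesgue_measure_unique _ (m' ms))//= => _ [[a b]] _ <-.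
rewrite /m' /mscale /= /pushforward /=.
have -> : (fun x : R => s * x + c) @^-1` `]a, b] = `](a - c) / s, (b - c) / s]%classic.
  apply/seteqP; split => x /=; rewrite !in_itv/= ltr_pdivrMr// ler_pdivlMr//;
  by rewrite (mulrC x) ltrBlDr lerBrDr.
rewrite !lebesgue_measure_itv/= !lte_fin ltr_pM2r ?invr_gt0// ltrD2r.
case: ifPn => // ab; last by rewrite mule0.
by rewrite -EFinD -EFinB -EFinM; congr (_%:E); field; rewrite gt_eqF.
Qed.

Lemma ge0_integral_affine (s c : R) (F : R -> \bar R) : 0 < s ->
  measurable_fun setT F -> (forall x, 0 <= F x)%E ->
  (\int[mu]_x F x = s%:E * \int[mu]_x F (s * x + c)%R)%E.
Proof.
move=> s0 mF F0.
have ms := measurable_affine s c.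
pose f := fun x : mR => s * x + c : mR.
pose m' : {measure set mR -> \bar R} := mscale (NngNum (ltW s0)) (pushforward mu f).
rewrite (@eq_measure_integral _ _ _ _ (m' ms)); last first.
  by move=> A mA _; exact: lebesgue_measure_affine.
rewrite ge0_integral_mscale//=; congr (_ * _)%E.
by rewrite ge0_integral_pushforward.
Qed.

Lemma ge0_integral_scale2 (s : R) (F : R * R -> \bar R) : 0 < s ->
  measurable_fun setT (F : plane -> \bar R) -> (forall x, 0 <= F x)%E ->
  (\int[mu2]_u F u = (s ^+ 2)%:E * \int[mu2]_u F (s * u.1, s * u.2)%R)%E.
Proof.
move=> s0 mF F0.
have mFs : measurable_fun setT (fun u : plane => F (s * u.1, s * u.2)).
  apply: (measurableT_comp mF); apply/measurable_fun_pair; exact: measurable_funM.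
rewrite !fubini_tonelli1// /fubini_F /=.
rewrite (ge0_integral_affine 0 s0); last 2 first.
- exact: measurable_fun_fubini_tonelli_F.
- by move=> x; exact: integral_ge0.
rewrite expr2 EFinM -muleA; congr (_ * _)%E.
rewrite -ge0_integralZl//; last 3 first.
- exact: (@measurable_fun_fubini_tonelli_F _ _ _ _ _ mu _ mFs (fun x => F0 _)).
- by move=> x _; exact: integral_ge0.
- by rewrite lee_fin ltW.
apply: eq_integral => x _; rewrite addr0.
rewrite (ge0_integral_affine 0 s0)//; first by under eq_integral do rewrite addr0.
exact: measurableT_comp.
Qed.

(** A shear translates every horizontal line, so Tonelli reduces it to translation invariance in one
    variable. *)
Lemma ge0_integral_shear1 (a : R) (F : R * R -> \bar R) :
  measurable_fun setT (F : plane -> \bar R) -> (forall x, 0 <= F x)%E ->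
  (\int[mu2]_u F u = \int[mu2]_u F (u.1 + a * u.2, u.2)%R)%E.
Proof.
move=> mF F0.
have mFs : measurable_fun setT (fun u : plane => F (u.1 + a * u.2, u.2)).
  apply: (measurableT_comp mF); apply/measurable_fun_pair => //.
  by apply: measurable_funD => //; exact: measurable_funM.
rewrite !fubini_tonelli2// /fubini_G /=.
apply: eq_integral => y _.
rewrite (ge0_integral_affine (a * y) ltr01)//; last exact: measurableT_comp.
by rewrite mul1e; under eq_integral do rewrite mul1r.
Qed.

Lemma ge0_integral_shear2 (a : R) (F : R * R -> \bar R) :
  measurable_fun setT (F : plane -> \bar R) -> (forall x, 0 <= F x)%E ->
  (\int[mu2]_u F u = \int[mu2]_u F (u.1, u.2 + a * u.1)%R)%E.
Proof.
move=> mF F0.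
have mFs : measurable_fun setT (fun u : plane => F (u.1, u.2 + a * u.1)).
  apply: (measurableT_comp mF); apply/measurable_fun_pair => //.
  by apply: measurable_funD => //; exact: measurable_funM.
rewrite !fubini_tonelli1// /fubini_F /=.
apply: eq_integral => y _.
rewrite (ge0_integral_affine (a * y) ltr01)//; last exact: measurableT_comp.
by rewrite mul1e; under eq_integral do rewrite mul1r.
Qed.

Definition rotate (c : R[i]) (u : R * R) : R * R :=
  (complex.Re c * u.1 - complex.Im c * u.2, complex.Im c * u.1 + complex.Re c * u.2).

Lemma rotateE c u : Complex (rotate c u).1 (rotate c u).2 = c * Complex u.1 u.2.
Proof. by case: c => a b; rewrite /= (addrC (b * _)). Qed.

Lemma measurable_rotate c : measurable_fun setT (rotate c : plane -> plane).
Proof.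
by apply/measurable_fun_pair; [apply: measurable_funB|apply: measurable_funD];
  exact: measurable_funM.
Qed.

Lemma cmod1_sqr (c : R[i]) : cmod c = 1 -> complex.Re c ^+ 2 + complex.Im c ^+ 2 = 1.
Proof.
case: c => a b /= h; have := congr1 (fun x => x ^+ 2) h => /=.
by rewrite sqr_sqrtr ?addr_ge0 ?sqr_ge0// expr1n.
Qed.

(* A rotation is a product of three shears unless it is a half turn, and a half
   turn is the square of a quarter turn. *)
Lemma ge0_integral_rotate (c : R[i]) (F : R * R -> \bar R) : cmod c = 1 ->
  measurable_fun setT (F : plane -> \bar R) -> (forall x, 0 <= F x)%E ->
  (\int[mu2]_u F u = \int[mu2]_u F (rotate c u))%E.
Proof.
move=> /cmod1_sqr; case: c => u v /= uv1 mF F0.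
have main (u' v' : R) (G : R * R -> \bar R) : v' != 0 -> u' ^+ 2 + v' ^+ 2 = 1 ->
    measurable_fun setT (G : plane -> \bar R) -> (forall x, 0 <= G x)%E ->
    (\int[mu2]_x G x = \int[mu2]_x G (rotate (Complex u' v') x))%E.
  (* For u' = cos(theta) and v' = sin(theta) this is -tan(theta/2), the coefficient of the two outer
     shears; the middle one has coefficient v'. *)
  move=> v0 uv mG G0; pose a := (u' - 1) / v'.
  have ms1 b : measurable_fun setT (fun u : plane => (u.1 + b * u.2, u.2) : plane).
    by apply/measurable_fun_pair => //; apply: measurable_funD => //; exact: measurable_funM.
  have ms2 b : measurable_fun setT (fun u : plane => (u.1, u.2 + b * u.1) : plane).
    by apply/measurable_fun_pair => //; apply: measurable_funD => //; exact: measurable_funM.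
  rewrite (ge0_integral_shear1 a mG G0).
  rewrite (ge0_integral_shear2 v' (F := fun w => G (w.1 + a * w.2, w.2)))//; last first.
    exact: (measurableT_comp mG (ms1 a)).
  rewrite (ge0_integral_shear1 a
    (F := fun w => G (w.1 + a * (w.2 + v' * w.1), w.2 + v' * w.1)))//; last first.
    exact: (measurableT_comp (measurableT_comp mG (ms1 a)) (ms2 v')).
  apply: eq_integral => -[x y] _ /=; congr (G (_, _)) => /=.
    have E : v' * a = u' - 1 by rewrite /a mulrC divfK.
    have E2 : a * (1 + u') = - v'.
      apply: (mulfI v0); rewrite mulrA E mulrN -expr2.
      have -> : v' ^+ 2 = 1 - u' ^+ 2 by rewrite -uv; ring.
      ring.
    have -> : x + a * y + a * (y + v' * (x + a * y)) =
      (1 + v' * a) * x + (a + a * (1 + v' * a)) * y by ring.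
    rewrite E; have -> : a + a * (1 + (u' - 1)) = - v' by rewrite -E2; ring.
    ring.
  have E : v' * a = u' - 1 by rewrite /a mulrC divfK.
  have -> : y + v' * (x + a * y) = v' * x + (1 + v' * a) * y by ring.
  by rewrite E; ring.
have [v0|v0] := eqVneq v 0; last exact: main.
have [->|u1] := eqVneq u 1.
  by rewrite v0; apply: eq_integral => -[x y] _; rewrite /rotate /= !mul1r !mul0r subr0 add0r.
have uN1 : u = -1.
  move: uv1; rewrite v0 expr0n addr0 => /eqP; rewrite sqrf_eq1 (negbTE u1)/=.
  by move/eqP.
have h01 : (0 : R) ^+ 2 + 1 ^+ 2 = 1 by rewrite expr0n expr1n add0r.
rewrite (main 0 1 F (oner_neq0 _) h01 mF F0).
rewrite (main 0 1 (fun x => F (rotate (Complex 0 1) x)) (oner_neq0 _) h01)//; last first.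
  exact: (measurableT_comp mF (measurable_rotate _)).
apply: eq_integral => -[x y] _; rewrite v0 uN1 /rotate /=; congr (F (_, _)); ring.
Qed.

Lemma measurable_cmod2 : measurable_fun setT (fun u : plane => u.1 ^+ 2 + u.2 ^+ 2 : mR).
Proof. by apply: measurable_funD; exact: measurable_funX. Qed.

Lemma measurable_disc2 : measurable (@disc2 R : set plane).
Proof.
have -> : @disc2 R = [set u | u.1 ^+ 2 + u.2 ^+ 2 < 1].
  apply/seteqP; split => -[x y]; rewrite /disc2 /unit_disc /=.
    rewrite -[X in _ < X -> _]sqrtr1 ltr_sqrt//.
  by rewrite -[X in _ -> _ < X]sqrtr1 ltr_sqrt.
rewrite -[X in measurable X]setTI.
have -> : [set u : plane | u.1 ^+ 2 + u.2 ^+ 2 < 1] =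
  (fun u : plane => u.1 ^+ 2 + u.2 ^+ 2 : mR) @^-1` `]-oo, 1[%classic.
  by apply/seteqP; split => u /=; rewrite in_itv.
exact: measurable_cmod2.
Qed.

Lemma dA_rotation (c : R[i]) (F : R[i] -> \bar R) : cmod c = 1 ->
  measurable_fun (@disc2 R : set plane) (fun u : plane => F (Complex u.1 u.2)) ->
  (forall z, unit_disc z -> 0 <= F z)%E ->
  (\int[dA R]_(u in @disc2 R) F (c * Complex u.1 u.2)%R =
   \int[dA R]_(u in @disc2 R) F (Complex u.1 u.2))%E.
Proof.
move=> c1 mF F0; have mD := measurable_disc2.
have mp : measurable_fun setT ((fun u : plane => F (Complex u.1 u.2)) \_ (@disc2 R)).
  exact/(measurable_restrictT _ mD).
have discc u : disc2 (rotate c u) = disc2 u.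
  by rewrite /disc2 /unit_disc /mkset rotateE cmodM c1 mul1r.
have pE u : ((fun u : plane => F (Complex u.1 u.2)) \_ (@disc2 R)) (rotate c u) =
    ((fun u : plane => F (c * Complex u.1 u.2)) \_ (@disc2 R)) u.
  rewrite /patch rotateE; have [uD|uD] := pselect (disc2 u).
    by rewrite !mem_set// discc.
  by rewrite !memNset// discc.
have mpc : measurable_fun setT ((fun u : plane => F (c * Complex u.1 u.2)) \_ (@disc2 R)).
  have -> : (fun u : plane => F (c * Complex u.1 u.2)) \_ (@disc2 R) =
    ((fun u : plane => F (Complex u.1 u.2)) \_ (@disc2 R)) \o rotate c.
    by apply/funext => u; rewrite -pE.
  exact: (measurableT_comp mp (measurable_rotate c)).
have p0 u : (0 <= ((fun u : plane => F (Complex u.1 u.2)) \_ (@disc2 R)) u)%E.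
  by rewrite /patch; case: ifPn => //; rewrite inE => uD; exact: F0.
rewrite integral_mkcond [RHS]integral_mkcond.
rewrite !ge0_integral_mscale//; last by move=> x _; rewrite -pE.
congr (_ * _)%E; rewrite [RHS](ge0_integral_rotate c1)//.
by apply: eq_integral => u _; rewrite pE.
Qed.


(** The number pi, kept symbolic: comparison with two squares shows that it is finite and positive,
    and it ends up inside the constant [kappa] of [dA_radial]. *)
Definition disc_area : \bar R := mu2 [set u | u.1 ^+ 2 + u.2 ^+ 2 <= 1].

Lemma measurable_sqdisc (t : R) : measurable [set u : plane | u.1 ^+ 2 + u.2 ^+ 2 <= t].
Proof.
rewrite -[X in measurable X]setTI.
have -> : [set u : plane | u.1 ^+ 2 + u.2 ^+ 2 <= t] =
  (fun u : plane => u.1 ^+ 2 + u.2 ^+ 2 : mR) @^-1` `]-oo, t]%classic.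
  by apply/seteqP; split => u /=; rewrite in_itv.
exact: measurable_cmod2.
Qed.

Lemma disc_area_fin : (disc_area < +oo)%E.
Proof.
apply: (@le_lt_trans _ _ (mu2 (`[-1, 1]%classic `*` `[-1, 1]%classic))).
  apply: le_measure; rewrite ?inE; [exact: measurable_sqdisc|exact: measurableX|].
  move=> [x y] /= h; rewrite !in_itv/= -!ler_norml -!(@ler_sqr _ `|_|) ?nnegrE//.
  rewrite !real_normK ?num_real// expr1n.
  by have := sqr_ge0 x; have := sqr_ge0 y; split; lra.
by rewrite product_measure1E//= !lebesgue_measure_itv/=; case: ifP => _;
  rewrite -?EFinB -?EFinM ?mul0e ltry.
Qed.

Lemma disc_area_gt0 : (0 < disc_area)%E.
Proof.
apply: (@lt_le_trans _ _ (mu2 (`[0, 1/2]%classic `*` `[0, 1/2]%classic))).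
  rewrite product_measure1E//= !lebesgue_measure_itv/= lte_fin ifT; last lra.
  by rewrite -EFinB -EFinM lte_fin; lra.
apply: le_measure; rewrite ?inE; [exact: measurableX|exact: measurable_sqdisc|].
move=> [x y] /=; rewrite !in_itv/= => -[/andP[x0 x1] /andP[y0 y1]].
have : x ^+ 2 <= (1/2)^+2 by rewrite ler_sqr ?nnegrE//; lra.
have : y ^+ 2 <= (1/2)^+2 by rewrite ler_sqr ?nnegrE//; lra.
by rewrite expr2; lra.
Qed.

(** A homothety of ratio sqrt(t) multiplies areas by t. This linearity in t is what makes |u|^2
    distribute area uniformly. *)
Lemma sqdisc_area (t : R) : 0 <= t ->
  mu2 [set u : plane | u.1 ^+ 2 + u.2 ^+ 2 <= t] = (t%:E * disc_area)%E.
Proof.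
rewrite le_eqVlt => /predU1P[<-|t0].
  rewrite mul0e.
  have -> : [set u : plane | u.1 ^+ 2 + u.2 ^+ 2 <= 0] = [set 0] `*` [set 0].
    apply/seteqP; split => [[x y]/= h|[x y] /= [-> ->]].
      have x2 := sqr_ge0 x; have y2 := sqr_ge0 y.
      by split; apply/eqP; rewrite -sqrf_eq0; apply/eqP; lra.
    by rewrite expr0n addr0.
  rewrite product_measure1E; [|exact: measurable_set1|exact: measurable_set1].
  by rewrite [X in (X * _)%E](lebesgue_measure_set1 (0 : R)) mul0e.
have s0 : 0 < Num.sqrt t by rewrite sqrtr_gt0.
rewrite /disc_area -[X in mu2 X]setIT -integral_indic//; last exact: measurable_sqdisc.
rewrite -[X in (_ = _ * mu2 X)%E]setIT -integral_indic//; last exact: measurable_sqdisc.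
rewrite (ge0_integral_scale2 s0); last 2 first.
- by apply/measurable_EFinP; apply: measurable_indic; exact: measurable_sqdisc.
- by move=> x; rewrite lee_fin.
rewrite sqr_sqrtr ?ltW//; congr (_ * _)%E; apply: eq_integral => -[x y] _.
have sE : (Num.sqrt t * x) ^+ 2 + (Num.sqrt t * y) ^+ 2 = t * (x ^+ 2 + y ^+ 2).
  by rewrite !exprMn sqr_sqrtr ?ltW// -mulrDr.
rewrite !indicE (_ : (_ \in [set u | _ <= t]) =
    ((x, y) \in [set u : plane | u.1 ^+ 2 + u.2 ^+ 2 <= 1]))//.
by apply/idP/idP; rewrite !inE /= sE ger_pMr.
Qed.

(** The image of plane area under u -> |u|^2 is a multiple of Lebesgue measure on [0, oo).
    Uniqueness of Lebesgue measure concerns the whole line, so the rescaled image is completed by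
    Lebesgue measure on the negative half-line before the two are compared on intervals ]a, b]. *)
Lemma sq_pushforward (A : set mR) : measurable A -> A `<=` `[0, 1[ ->
  mu2 ((fun u : plane => u.1 ^+ 2 + u.2 ^+ 2) @^-1` A) = (disc_area * mu A)%E.
Proof.
have [k [k0 kE]] : exists k : R, 0 < k /\ disc_area = k%:E.
  have := disc_area_fin; have := disc_area_gt0; case: disc_area => // k.
  by rewrite lte_fin => k0 _; exists k.
pose q := fun u : plane => u.1 ^+ 2 + u.2 ^+ 2 : mR.
have ki0 : 0 <= k^-1 by rewrite invr_ge0 ltW.
have mneg : measurable (`]-oo, 0]%classic : set mR) by [].
pose nu0 : {measure set mR -> \bar R} := measure_add
   (mscale (NngNum ki0) (pushforward mu2 q)) (mrestr mu mneg).
pose nu := nu0 measurable_cmod2.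
have nuD B : nu B = ((k^-1)%:E * mu2 (q @^-1` B) + mu (B `&` `]-oo, 0%R]))%E.
  exact: measure_addE.
have qneg (b : R) : b < 0 -> [set u : plane | u.1 ^+ 2 + u.2 ^+ 2 <= b] = set0.
  move=> b0; apply/seteqP; split => // u /=; have := sqr_ge0 u.1; have := sqr_ge0 u.2; lra.
have qD (b : R) : mu2 [set u : plane | u.1 ^+ 2 + u.2 ^+ 2 <= b] = (Num.max b 0 * k)%:E.
  case: (leP 0 b) => b0; first by rewrite sqdisc_area// kE EFinM.
  by rewrite qneg// measure0 mul0r.
have nuE B : measurable B -> mu B = nu B.
  move=> mB; apply: lebesgue_measure_unique => // _ [[a b]] _ <-.
  rewrite nuD.
  have [ab|ba] := ltP a b; last first.
    by rewrite set_itv_ge ?bnd_simp -?leNgt// preimage_set0 set0I !measure0 mule0 adde0.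
  have -> : (fun u : R * R => u.1 ^+ 2 + u.2 ^+ 2) @^-1` `]a, b] =
     [set u : plane | u.1 ^+ 2 + u.2 ^+ 2 <= b] `\` [set u : plane | u.1 ^+ 2 + u.2 ^+ 2 <= a].
    apply/seteqP; split => u /=; rewrite in_itv/=.
      by move=> /andP[h1 h2]; split => //; apply/negP; rewrite -ltNge.
    by move=> [-> /negP]; rewrite -ltNge => ->.
  have -> : mu2 ([set u : plane | u.1 ^+ 2 + u.2 ^+ 2 <= b] `\`
      [set u : plane | u.1 ^+ 2 + u.2 ^+ 2 <= a]) = (Num.max b 0 * k - Num.max a 0 * k)%:E.
    transitivity (mu2 [set u : plane | (u.1 ^+ 2 + u.2 ^+ 2 <= b)%R] -
      mu2 ([set u : plane | (u.1 ^+ 2 + u.2 ^+ 2 <= b)%R] `&`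
           [set u : plane | (u.1 ^+ 2 + u.2 ^+ 2 <= a)%R]))%E.
      apply: measureD; [exact: measurable_sqdisc|exact: measurable_sqdisc|].
      by rewrite [X in (X < _)%E]qD ltry.
    rewrite setIidr; last by move=> u /= /le_trans; apply; exact: ltW.
    by rewrite !qD.
  have -> : `]a, b] `&` `]-oo, 0] = `]a, Num.min b 0]%classic.
    apply/seteqP; split => x /=; rewrite !in_itv/= le_min.
      by move=> [/andP[-> ->] ->].
    by move=> /and3P[-> -> ->].
  rewrite !lebesgue_measure_itv/= !lte_fin ab lt_min ab/=.
  rewrite -EFinB -EFinM.
  have kk : k^-1 * (Num.max b 0 * k - Num.max a 0 * k) = Num.max b 0 - Num.max a 0.
    by rewrite -mulrBl mulrCA mulVf ?mulr1// gt_eqF.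
  rewrite kk; case: (ltP a 0) => a0; rewrite -?EFinB -?EFinD ?adde0; congr (_%:E).
    by case: (ltP b 0) => b0; ring.
  by rewrite max_l ?addr0// (le_trans a0)// ltW.
move=> mA A01; rewrite nuE// nuD.
rewrite [X in (_ + X)%E](_ : _ = 0%E); last first.
  apply/eqP; rewrite -measure_le0.
  apply: le_trans (_ : (mu [set 0%R] <= 0)%E); last by rewrite lebesgue_measure_set1.
  apply: le_measure; rewrite ?inE; [exact: measurableI|exact: measurable_set1|].
  move=> x /= [/A01 /=]; rewrite !in_itv/= => /andP[x0 _] x0'.
  by apply/eqP; rewrite eq_le x0 x0'.
by rewrite adde0 kE muleA -EFinM mulfV ?gt_eqF// mul1e.
Qed.


Lemma sqr_derive : (fun x : R => x ^+ 2)^`()%classic = (fun x => 2 * x).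
Proof. by apply/funext => x; rewrite (exp_derive1 2 x) expr1. Qed.

Lemma mul2_continuous : continuous (fun x : R => 2 * x).
Proof. by move=> x; apply: cvgM; [exact: cvg_cst|exact: cvg_id]. Qed.

(** Substitution t = r^2. [G] is continuous only on the open interval and may blow up at 1, so the
    rule is applied on compact intervals exhausting ]0, 1[, and monotone convergence gives the
    rest. *)
Lemma integral_sqrt (G : R -> R) : {in `]0, 1[, continuous G} ->
  (forall r, 0 < r < 1 -> 0 <= G r) ->
  (\int[mu]_(t in `]0%R, 1%R[) (G (Num.sqrt t))%:E =
   \int[mu]_(r in `]0%R, 1%R[) (G r * (2 * r))%:E)%E.
Proof.
move=> cG G0.
have cGs : {in `]0, 1[, continuous (G \o Num.sqrt)}.
  move=> t; rewrite in_itv/= => /andP[t0 t1].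
  apply: continuous_comp; first exact: sqrt_continuous.
  by apply: cG; rewrite in_itv/= sqrtr_gt0 t0 -[ltRHS]sqrtr1 ltr_sqrt.
(* At most 1/2, so that [a i] <= 1 - [a i] for every i. *)
pose a (i : nat) : R := i.+2%:R^-1.
have a0 i : 0 < a i by rewrite invr_gt0.
have ah i : a i <= 1 / 2 by rewrite /a div1r lef_pV2 ?posrE// ler_nat.
have anti i j : (i <= j)%N -> a j <= a i by move=> ij; rewrite /a lef_pV2 ?posrE// ler_nat.
have acvg x : 0 < x -> exists i, a i <= x.
  move=> x0; exists (Num.truncn x^-1); rewrite /a -[leRHS]invrK lef_pV2 ?posrE ?invr_gt0//.
  by rewrite (le_trans (ltW (truncnS_gt _)))// ler_nat.
pose F1 i : set R := `[a i ^+ 2, (1 - a i) ^+ 2]%classic.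
pose F2 i : set R := `[a i, 1 - a i]%classic.
have F2E : \bigcup_i F2 i = `]0, 1[%classic.
  apply/seteqP; split => x /=.
    move=> [i _]; rewrite /F2 /= !in_itv/=; have := a0 i => h /andP[h1 h2].
    by apply/andP; split; lra.
  rewrite in_itv/= => /andP[x0 x1].
  have [|i hi] := acvg (Num.min x (1 - x)); first by rewrite lt_min x0 subr_gt0.
  exists i => //; rewrite /F2 /= in_itv/=; move: hi; rewrite le_min => /andP[-> h].
  by lra.
have F1E : \bigcup_i F1 i = `]0, 1[%classic.
  apply/seteqP; split => x /=.
    move=> [i _]; rewrite /F1 /= !in_itv/= => /andP[h1 h2].
    have h3 := a0 i; have h4 := ah i.
    rewrite (lt_le_trans _ h1) ?exprn_gt0//= (le_lt_trans h2)//.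
    by rewrite expr_lt1//; lra.
  rewrite in_itv/= => /andP[x0 x1].
  have : (\bigcup_i F2 i) (Num.sqrt x).
    by rewrite F2E /= in_itv/= sqrtr_gt0 x0 -[ltRHS]sqrtr1 ltr_sqrt.
  move=> [i _]; rewrite /F2 /= in_itv/= => /andP[h1 h2]; exists i => //.
  rewrite /F1 /= in_itv/= -[x](@sqr_sqrtr _ x) ?(ltW x0)//.
  have h4 := ah i; have h3 := a0 i.
  by rewrite !ler_sqr ?nnegrE ?sqrtr_ge0 ?h1 ?h2//; lra.
have mGs : measurable_fun (`]0, 1[ : set mR) (fun t => (G (Num.sqrt t))%:E).
  apply/measurable_EFinP; apply: open_continuous_measurable_fun => //.
  by move=> x; rewrite inE /= => xI; exact: cGs.
have mG2 : measurable_fun (`]0, 1[ : set mR) (fun r => (G r * (2 * r))%:E).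
  apply/measurable_EFinP; apply: measurable_funM.
    apply: open_continuous_measurable_fun => //.
    by move=> x; rewrite inE /= => xI; exact: cG.
  exact: measurable_funM.
have h1 : (\int[mu]_(t in F1 i) (G (Num.sqrt t))%:E)%E @[i --> \oo] -->
    (\int[mu]_(t in `]0%R, 1%R[) (G (Num.sqrt t))%:E)%E.
  rewrite -F1E; apply: ge0_nondecreasing_set_cvg_integral.
  - move=> i j ij; apply/subsetPset => x; rewrite /F1 /= !in_itv/= => /andP[h1 h2].
    have h3 := anti _ _ ij; have h4 := a0 j; have h5 := ah i.
    rewrite (le_trans _ h1) ?(le_trans h2)// ?ler_sqr ?nnegrE//; lra.
  - by move=> i; rewrite /F1.
  - move=> i; apply: measurable_funS mGs => //.
    by rewrite -F1E; exact: bigcup_sup.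
  - move=> i x F1x; have : `]0, 1[%classic x by rewrite -F1E; exists i.
    rewrite /= in_itv/= => /andP[x0 x1]; rewrite lee_fin G0//.
    by rewrite sqrtr_gt0 x0 -[ltRHS]sqrtr1 ltr_sqrt.
have h2 : (\int[mu]_(r in F2 i) (G r * (2 * r))%:E)%E @[i --> \oo] -->
    (\int[mu]_(r in `]0%R, 1%R[) (G r * (2 * r))%:E)%E.
  rewrite -F2E; apply: ge0_nondecreasing_set_cvg_integral.
  - move=> i j ij; apply/subsetPset => x; rewrite /F2 /= !in_itv/= => /andP[h2 h3].
    by have h4 := anti _ _ ij; apply/andP; split; lra.
  - by move=> i; rewrite /F2.
  - move=> i; apply: measurable_funS mG2 => //.
    by rewrite -F2E; exact: bigcup_sup.
  - move=> i x F2x; have : `]0, 1[%classic x by rewrite -F2E; exists i.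
    rewrite /= in_itv/= => x01; rewrite lee_fin mulr_ge0 ?G0//.
    by case/andP: x01 => x0 _; rewrite mulr_ge0// ltW.
have E : (fun i => \int[mu]_(t in F1 i) (G (Num.sqrt t))%:E)%E =
         (fun i => \int[mu]_(r in F2 i) (G r * (2 * r))%:E)%E.
  apply/funext => i; have h3 := a0 i; have h4 := ah i.
  rewrite (@integration_by_substitution_increasing R (fun x => x ^+ 2) (G \o Num.sqrt)).
  - apply: eq_integral => x; rewrite inE /= in_itv/= => /andP[x1 x2].
    rewrite sqr_derive -[LHS]/((G (Num.sqrt (x ^+ 2)) * (2 * x))%:E).
    by rewrite sqrtr_sqr ger0_norm//; lra.
  - lra.
  - move=> x y; rewrite !in_itv/= => /andP[x1 x2] /andP[y1 y2] xy.
    by rewrite ltr_sqr ?nnegrE//; lra.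
  - by rewrite sqr_derive => x _; exact: mul2_continuous.
  - rewrite sqr_derive; apply/cvg_ex; exists (2 * a i).
    by apply: cvg_at_right_filter; exact: mul2_continuous.
  - rewrite sqr_derive; apply/cvg_ex; exists (2 * (1 - a i)).
    by apply: cvg_at_left_filter; exact: mul2_continuous.
  - split.
    + by move=> x _; exact: exprn_derivable.
    + by apply: cvg_at_right_filter; exact: exprn_continuous.
    + by apply: cvg_at_left_filter; exact: exprn_continuous.
  - apply: continuous_in_subspaceT => x; rewrite inE /= => xF.
    apply: cGs; have : (\bigcup_i F1 i) x by exists i.
    by rewrite F1E.
by rewrite E in h1; exact: cvg_unique h1 h2.
Qed.

(** Push the area forward by |u|^2 and substitute t = r^2; the Jacobian 2 r supplies the factor r.
    The constant is 2/pi times the area of the unit disc, that is 2. *)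
Lemma dA_radial : exists2 kappa : R, 0 < kappa &
  forall G : R -> R, {in `]0, 1[, continuous G} ->
  (forall r, 0 <= r < 1 -> 0 <= G r) ->
  (\int[dA R]_(u in @disc2 R) (G (cmod (Complex u.1 u.2)))%:E =
   kappa%:E * \int[mu]_(r in `[0%R, 1%R[) (r * G r)%:E)%E.
Proof.
have [k [k0 kE]] : exists k : R, 0 < k /\ disc_area = k%:E.
  have := disc_area_fin; have := disc_area_gt0; case: disc_area => // k.
  by rewrite lte_fin => k0 _; exists k.
exists (pi^-1 * k * 2); first by rewrite !mulr_gt0 ?invr_gt0 ?pi_gt0.
move=> G cG G0.
pose q := fun u : plane => u.1 ^+ 2 + u.2 ^+ 2 : mR.
have discE : @disc2 R = q @^-1` `[0, 1[.
  apply/seteqP; split => -[x y]; rewrite /disc2 /unit_disc /q /= in_itv/= addr_ge0 ?sqr_ge0//=.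
    by rewrite -[X in _ < X -> _]sqrtr1 ltr_sqrt.
  by rewrite -[X in _ -> _ < X]sqrtr1 ltr_sqrt.
have cGs : {in `]0, 1[, continuous (G \o Num.sqrt)}.
  move=> t; rewrite in_itv/= => /andP[t0 t1].
  apply: continuous_comp; first exact: sqrt_continuous.
  by apply: cG; rewrite in_itv/= sqrtr_gt0 t0 -[ltRHS]sqrtr1 ltr_sqrt.
have mGo : measurable_fun (`]0, 1[ : set mR) (fun t => (G (Num.sqrt t))%:E).
  apply/measurable_EFinP; apply: open_continuous_measurable_fun => //.
  by move=> x; rewrite inE /= => xI; exact: cGs.
have mGo2 : measurable_fun (`]0, 1[ : set mR) (fun r => (r * G r)%:E).
  apply/measurable_EFinP; apply: measurable_funM => //.
  apply: open_continuous_measurable_fun => //.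
  by move=> x; rewrite inE /= => xI; exact: cG.
have mGc : measurable_fun (`[0, 1[ : set mR) (fun t => (G (Num.sqrt t))%:E).
  exact/emeasurable_fun_itv_obnd_cbndP.
have Gs0 t : `[0, 1[%classic t -> 0 <= G (Num.sqrt t).
  rewrite /= in_itv/= => /andP[t0 t1]; apply: G0.
  by rewrite sqrtr_ge0 -[ltRHS]sqrtr1 ltr_sqrt.
have mD := measurable_disc2.
have mF : measurable_fun (@disc2 R : set plane) (fun u : plane => (G (Num.sqrt (q u)))%:E).
  rewrite discE; apply: (@measurable_comp _ _ _ _ _ _ (`[0, 1[%classic : set mR)
    (fun t : mR => (G (Num.sqrt t))%:E) (q @^-1` `[0, 1[) q) => //.
    by move=> _ [x xI <-].
  exact: measurable_funTS measurable_cmod2.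
rewrite ge0_integral_mscale//; last first.
  by move=> u; rewrite discE => /= h; rewrite lee_fin; exact: Gs0 h.
rewrite -!mulrA EFinM -muleA; congr (_ * _)%E; rewrite [X in integral _ X]discE.
rewrite -(@ge0_integral_pushforward _ _ _ _ _ q measurable_cmod2 mu2 (`[0, 1[ : set mR)
   (fun t => (G (Num.sqrt t))%:E))//; last first.
  by move=> t; rewrite inE => /Gs0; rewrite lee_fin.
rewrite (@eq_measure_integral _ _ _ _ (mscale (NngNum (ltW k0)) mu));
  [ | exact: measurable_cmod2 | by move=> ? A mA /(sq_pushforward mA); rewrite kE].
rewrite ge0_integral_mscale//=.
rewrite EFinM -muleA; congr (_ * _)%E.
rewrite [LHS]integral_itv_bndoo// [X in (_ * X)%E]integral_itv_bndoo//.
rewrite integral_sqrt//; last first.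
  by move=> r /andP[r0 r1]; apply: G0; rewrite ltW.
rewrite -ge0_integralZl//.
  by apply: eq_integral => r _; rewrite -EFinM; congr (_%:E); ring.
by move=> r /=; rewrite in_itv/= => /andP[r0 r1]; rewrite lee_fin mulr_ge0 ?G0// ltW.
Qed.

End PlaneLebesgue.

(** * Inequalities and limit theorems for p-th powers *)

Section LpGeneralities.
Context d (T : measurableType d) (R : realType) (mu : {measure set T -> \bar R}).
Variables (D : set T) (mD : measurable D).

Lemma powR_cvg (u : nat -> R) (l q : R) : 0 < q -> (forall n, 0 <= u n) ->
  u @ \oo --> l -> (fun n => u n `^ q) @ \oo --> l `^ q.
Proof.
move=> q0 u0 ul.
have l0 : 0 <= l by apply: (cvgr_to_ge ul); exists 0%N => // n _; exact: u0.
move: l0; rewrite le_eqVlt => /predU1P[l0|l0].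
  rewrite -l0 in ul *; rewrite powR0 ?gt_eqF//.
  apply/cvgrPdist_lt => e e0.
  have e1 : 0 < e `^ q^-1 by rewrite powR_gt0.
  near=> n; rewrite sub0r normrN ger0_norm ?powR_ge0//.
  have -> : e = (e `^ q^-1) `^ q by rewrite -powRrM mulVf ?powRr1 ?ltW// gt_eqF.
  rewrite gt0_ltr_powR ?nnegrE ?(ltW e1)//.
  near: n; move/cvgrPdist_lt : ul => /(_ _ e1) [N _ Nh]; exists N => // n /Nh /=.
  by rewrite sub0r normrN ger0_norm.
have h0 : (fun n => q * ln (u n)) @ \oo --> q * ln l.
  apply: cvgM; first exact: cvg_cst.
  exact: (cvg_comp _ _ ul (continuous_ln l0)).
have h := cvg_comp _ _ h0 (@continuous_expR R (q * ln l)).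
rewrite {2}/powR gt_eqF//; apply: cvg_trans h; apply: near_eq_cvg.
near=> n; rewrite /powR gt_eqF//; near: n; exact: (cvgr_gt l).
Unshelve. all: by end_near. Qed.

Lemma measurable_funTS_powR (F : T -> R) (q : R) : measurable_fun D F ->
  measurable_fun D (fun x => F x `^ q).
Proof. by move=> mF; exact: (measurableT_comp (measurable_powR q) mF). Qed.

(** Minkowski's inequality for functions extended by 0 outside D, with the norms named as real
    numbers a and b. It is stated for integrals of p-th powers because this is the form of
    [bergman_int]. *)
Lemma minkowski_ge0 (p a b : R) (F G : T -> R) : 1 <= p -> 0 <= a -> 0 <= b ->
  measurable_fun D F -> measurable_fun D G ->
  (forall x, D x -> 0 <= F x) -> (forall x, D x -> 0 <= G x) ->
  (\int[mu]_(x in D) (F x `^ p)%:E = (a `^ p)%:E)%E ->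
  (\int[mu]_(x in D) (G x `^ p)%:E = (b `^ p)%:E)%E ->
  (\int[mu]_(x in D) ((F x + G x) `^ p)%:E <= ((a + b) `^ p)%:E)%E.
Proof.
move=> p1 a0 b0 mF mG F0 G0 IF IG.
have p0 : 0 < p by exact: lt_le_trans p1.
have NE (H : T -> R) : (forall x, D x -> 0 <= H x) ->
   ('N[mu]_p%:E[EFin \o (H \_ D)] `^ p = \int[mu]_(x in D) (H x `^ p)%:E)%E.
  move=> H0; rewrite (powR_Lnorm mu _ (lt0r_neq0 p0)) [RHS]integral_mkcond.
  apply: eq_integral => x _; rewrite /patch /=; case: ifPn => [|_].
    by rewrite inE => xD; rewrite ger0_norm// H0.
  by rewrite normr0 powR0// gt_eqF.
have NV (c : R) (H : T -> R) : 0 <= c ->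
  ('N[mu]_p%:E[EFin \o (H \_ D)] `^ p = (c `^ p)%:E -> 'N[mu]_p%:E[EFin \o (H \_ D)] = c%:E)%E.
  move=> c0 h; have := congr1 (fun x => x `^ p^-1)%E h => /=.
  rewrite -poweRrM mulfV ?gt_eqF// poweRe1 ?Lnorm_ge0// => ->.
  by rewrite -powRrM mulfV ?powRr1// gt_eqF.
have hF := NV a F a0 (etrans (NE F F0) IF).
have hG := NV b G b0 (etrans (NE G G0) IG).
have mFT : measurable_fun setT (F \_ D) by exact/(measurable_restrictT _ mD).
have mGT : measurable_fun setT (G \_ D) by exact/(measurable_restrictT _ mD).
have := minkowski_EFin mu mFT mGT p1.
rewrite hF hG -EFinD => h.
rewrite -(NE (fun x => F x + G x)); last by move=> x xD; rewrite addr_ge0 ?F0 ?G0.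
rewrite -poweR_EFin; apply: gt0_ler_poweR; first exact: ltW.
- by rewrite in_itv/= Lnorm_ge0 leey.
- by rewrite in_itv/= leey lee_fin addr_ge0.
apply: le_trans h; rewrite le_eqVlt; apply/orP; left; apply/eqP; congr Lnorm.
by apply/funext => x /=; rewrite /patch; case: ifP => // _; rewrite addr0.
Qed.

Lemma fatou_bound (h : nat -> T -> R) (g : T -> R) (C : \bar R) :
  (forall n, measurable_fun D (h n)) -> (forall n x, D x -> 0 <= h n x) ->
  (forall x, D x -> (fun n => h n x) @ \oo --> g x) ->
  (forall n, \int[mu]_(x in D) (h n x)%:E <= C)%E ->
  (\int[mu]_(x in D) (g x)%:E <= C)%E.
Proof.
move=> mh h0 hg hC.
have -> : (\int[mu]_(x in D) (g x)%:E =
           \int[mu]_(x in D) limn_einf (fun n => (h n x)%:E))%E.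
  apply: eq_integral => x; rewrite inE => xD.
  have /cvg_limn_einf_sup[-> _] // : (fun n => (h n x)%:E) @ \oo --> (g x)%:E.
  by apply: cvg_EFin; [exact: nearW | exact: hg].
apply: le_trans (fatou _ _ _ _) _ => //.
  by move=> n; exact/measurable_EFinP.
rewrite limn_einf_lim; apply: lime_le; first exact: is_cvg_einfs.
apply: nearW => n; apply: le_trans (hC n); apply: ereal_inf_lbound.
by exists n => //=.
Qed.

(** Convexity of x^p at the midpoint of 2x and 2y. *)
Lemma powR_sum_le (p x y : R) : 1 <= p -> 0 <= x -> 0 <= y ->
  (x + y) `^ p <= 2 `^ (p - 1) * (x `^ p + y `^ p).
Proof.
move=> p1 x0 y0.
have half : (2^-1 : R) = 1 - 2^-1 by rewrite {2}(splitr 1) div1r addrK.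
have h := @convex_powR R p p1 (Itv01 (ltac:(by []) : 0 <= (2^-1 : R)) (ltac:(by rewrite invf_le1// ler1n))) (2 * x) (2 * y).
have {h} : (2^-1 * (2 * x) + 2^-1 * (2 * y)) `^ p <=
    2^-1 * (2 * x) `^ p + 2^-1 * (2 * y) `^ p.
  rewrite {2 4}half; apply: h; rewrite inE /= in_itv/= andbT; exact: mulr_ge0.
rewrite !mulrA mulVf// !mul1r => /le_trans; apply.
rewrite !powRM// !mulrA -powR_inv1// -powRD ?pnatr_eq0 ?implybT//.
by rewrite (addrC _ p) -mulrDr.
Qed.

End LpGeneralities.

(** * Measurability of power series on the disc *)

Section DiscMeasurability.
Variable R : realType.
Local Notation mR := (measurableTypeR R).
Local Notation plane := (measurableTypeR R * measurableTypeR R)%type.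
Local Notation D := (@disc2 R : set plane).
Implicit Types (f g : R[i] -> R[i]).

(** Taken through real and imaginary parts, so that sums, products and pointwise limits reduce to
    real-valued functions. *)
Definition cmeasurable f :=
  measurable_fun D (fun u : plane => complex.Re (f (Complex u.1 u.2)) : mR) /\
  measurable_fun D (fun u : plane => complex.Im (f (Complex u.1 u.2)) : mR).

Lemma cmeasurable_cmod f : cmeasurable f ->
  measurable_fun D (fun u : plane => cmod (f (Complex u.1 u.2)) : mR).
Proof.
move=> [mr mi].
have -> : (fun u : plane => cmod (f (Complex u.1 u.2)) : mR) =
  (fun u : plane => Num.sqrt (complex.Re (f (Complex u.1 u.2)) ^+ 2 +
                             complex.Im (f (Complex u.1 u.2)) ^+ 2)).
  by apply/funext => u; case: (f _).
have ms : measurable_fun setT (@Num.sqrt R : mR -> mR).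
  by apply: continuous_measurable_fun; exact: sqrt_continuous.
by apply: (measurableT_comp ms); apply: measurable_funD; exact: measurable_funX.
Qed.

Lemma cmeasurable_cst c : cmeasurable (fun=> c).
Proof. by split; exact: measurable_cst. Qed.

Lemma cmeasurable_id : cmeasurable id.
Proof. by split => /=; [exact: measurable_funTS measurable_fst | exact: measurable_funTS measurable_snd]. Qed.

Lemma cmeasurableD f g : cmeasurable f -> cmeasurable g ->
  cmeasurable (fun z => f z + g z).
Proof.
move=> [fr fi] [gr gi]; split.
  by under eq_fun do rewrite raddfD; exact: measurable_funD.
by under eq_fun do rewrite raddfD; exact: measurable_funD.
Qed.

Lemma cmeasurableM f g : cmeasurable f -> cmeasurable g ->
  cmeasurable (fun z => f z * g z).
Proof.
move=> [fr fi] [gr gi]; split.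
  have -> : (fun u : plane => complex.Re (f (Complex u.1 u.2) * g (Complex u.1 u.2)) : mR) =
    (fun u : plane => complex.Re (f (Complex u.1 u.2)) * complex.Re (g (Complex u.1 u.2)) -
                      complex.Im (f (Complex u.1 u.2)) * complex.Im (g (Complex u.1 u.2))).
    by apply/funext => u; case: (f _) => ??; case: (g _).
  by apply: measurable_funB; exact: measurable_funM.
have -> : (fun u : plane => complex.Im (f (Complex u.1 u.2) * g (Complex u.1 u.2)) : mR) =
  (fun u : plane => complex.Re (f (Complex u.1 u.2)) * complex.Im (g (Complex u.1 u.2)) +
                    complex.Im (f (Complex u.1 u.2)) * complex.Re (g (Complex u.1 u.2))).
  by apply/funext => u; case: (f _) => ??; case: (g _).
by apply: measurable_funD; exact: measurable_funM.
Qed.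

Lemma cmeasurableZ c f : cmeasurable f -> cmeasurable (fun z => c * f z).
Proof. exact: cmeasurableM (cmeasurable_cst c). Qed.

Lemma cmeasurable_sum (I : Type) (r : seq I) (F : I -> R[i] -> R[i]) :
  (forall i, cmeasurable (F i)) -> cmeasurable (fun z => \sum_(i <- r) F i z).
Proof.
move=> mF; elim: r => [|i r IH].
  by under eq_fun do rewrite big_nil; exact: cmeasurable_cst.
by under eq_fun do rewrite big_cons; exact: cmeasurableD.
Qed.

Lemma cmeasurableX n : cmeasurable (fun z => z ^+ n).
Proof.
elim: n => [|n IH]; first by under eq_fun do rewrite expr0; exact: cmeasurable_cst.
by under eq_fun do rewrite exprS; apply: cmeasurableM => //; exact: cmeasurable_id.
Qed.

Lemma cmeasurable_cvg (F : nat -> R[i] -> R[i]) f : (forall n, cmeasurable (F n)) ->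
  (forall z, unit_disc z -> ccvg (fun n => F n z) (f z)) -> cmeasurable f.
Proof.
move=> mF Ff; split.
  apply: (measurable_fun_cvg (h := fun n (u : plane) => complex.Re (F n (Complex u.1 u.2)) : mR)).
    by move=> n; exact: (mF n).1.
  by move=> u uD; apply: ccvg_Re; exact: Ff.
apply: (measurable_fun_cvg (h := fun n (u : plane) => complex.Im (F n (Complex u.1 u.2)) : mR)).
  by move=> n; exact: (mF n).2.
by move=> u uD; apply: ccvg_Im; exact: Ff.
Qed.

Lemma has_power_seriesE f a : has_power_series f a <->
  forall z, unit_disc z -> ccvg (series (fun n => a n * z ^+ n)) (f z).
Proof.
by split => h z zD; have := h z zD; rewrite psum_atE subr0.
Qed.

Lemma power_series_cmeasurable f a : has_power_series f a -> cmeasurable f.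
Proof.
move=> /has_power_seriesE fa.
apply: (cmeasurable_cvg (F := fun N z => series (fun n => a n * z ^+ n) N)) => // n.
by apply: cmeasurable_sum => i; apply: cmeasurableZ; exact: cmeasurableX.
Qed.

Lemma power_series_unique f g a b : has_power_series f a -> has_power_series g b ->
  (forall z, unit_disc z -> f z = g z) -> a = b.
Proof.
move=> /has_power_seriesE fa /has_power_seriesE gb fg; apply/funext => n.
have h z : unit_disc z -> ccvg (series (fun n => (a n - b n) * z ^+ n)) 0.
  move=> zD; rewrite -(subrr (f z)) {2}fg//.
  have -> : series (fun n => (a n - b n) * z ^+ n) = (fun N =>
     series (fun k => a k * z ^+ k) N - series (fun k => b k * z ^+ k) N).
    by apply/funext => N; rewrite /series /= -sumrB; apply: eq_bigr => i _; rewrite mulrBl.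
  by apply: ccvgB; [exact: fa|exact: gb].
have rc (r : R) : 0 < r -> cmod (r%:C%C : R[i]) = r.
  by move=> r0; rewrite cmod_real ger0_norm// ltW.
have hD (r : R) : 0 < r < 1 -> unit_disc (r%:C%C : R[i]).
  by move=> /andP[r0 r1]; change (cmod (r%:C%C : R[i]) < 1); rewrite rc.
have [|B hB] := power_series_abs (r := 1 / 4) (h (1 / 2)%:C%C (hD (1 / 2) ltac:(lra))).
  by rewrite rc; lra.
apply/eqP; rewrite -subr_eq0; apply/eqP; move: n.
apply: (@power_series_zero _ (fun n => a n - b n) (1 / 4) B) => //.
move=> e e0; pose x := Num.min (1 / 2) (e / 2).
have x0 : 0 < x by rewrite lt_min !divr_gt0.
have x1 : x <= 1 / 2 by rewrite ge_min lexx.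
have x2 : x <= e / 2 by rewrite ge_min lexx orbT.
exists (x%:C%C : R[i]); first by rewrite rc// x0/=; lra.
by apply: h; apply: hD; rewrite x0/=; lra.
Qed.

(** Uniqueness pins down the choice made by [get]; from here on the coefficients of [Bshift] are
    known. *)
Lemma taylor_coefE f a : has_power_series f a -> taylor_coef f = a.
Proof.
move=> fa; have : has_power_series f (taylor_coef f).
  by apply: (@getPex _ [set a : nat -> R[i]^o | has_power_series f a]); exists a.
by move=> /power_series_unique/(_ fa)->.
Qed.

Lemma power_series_abs_disc f a (r : R) : has_power_series f a -> 0 <= r < 1 ->
  exists B, forall N, series (fun n => cmod (a n) * r ^+ n) N <= B.
Proof.
move=> /has_power_seriesE fa /andP[r0 r1].
have c0 : 0 < (1 + r) / 2 by lra.
have rc : cmod (((1 + r) / 2)%:C%C : R[i]) = (1 + r) / 2.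
  by rewrite cmod_real ger0_norm// ltW.
have h : unit_disc (((1 + r) / 2)%:C%C : R[i]).
  by change (cmod (((1 + r) / 2)%:C%C : R[i]) < 1); rewrite rc; lra.
by apply: power_series_abs (fa _ h) _; rewrite rc; lra.
Qed.

Lemma power_series_analytic f a : has_power_series f a -> analytic_on_disc f.
Proof.
move=> fa z0 z0D; have z00 := cmod_ge0 z0; have z01 : cmod z0 < 1 := z0D.
pose t := (1 - cmod z0) / 2; have t0 : 0 < t by rewrite /t; lra.
have [|B aB] := @power_series_abs_disc f a (cmod z0 + t) fa; first by rewrite /t; lra.
have [b [_ _ bf]] := power_series_recenter z00 t0 (lexx _) aB.
exists t => //; exists b => z zz0; apply/psum_atE; apply: bf; first exact: ltW.
rewrite subrKC; apply: ((has_power_seriesE f a).1 fa).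
have := cmodD z0 (z - z0); rewrite subrKC => h.
by apply: le_lt_trans h _; rewrite /t in zz0; lra.
Qed.

End DiscMeasurability.

(** * The weighted Bergman space *)

Section LimsupLiminf.
Variable R : realType.
Implicit Type u : nat -> R.

Lemma limn_esup_pinftyP u : limn_esup (fun n => (u n)%:E) = +oo%E <->
  forall (K : R) N, exists2 n, (N <= n)%N & K < u n.
Proof.
rewrite /limn_esup /limf_esup; split => [h K N|h].
  apply: contrapT => hn; have : (+oo <= K%:E)%E; last by rewrite leye_eq.
  rewrite -h; apply: ge_ereal_inf.
  exists (ereal_sup ((fun n => (u n)%:E) @` [set n | (N <= n)%N])).
    by exists [set n | (N <= n)%N] => //; exact: nbhs_infty_ge.
  apply: ge_ereal_sup => _ [n Nn <-]; rewrite lee_fin leNgt; apply/negP => Kn.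
  by apply: hn; exists n.
apply/eqP; rewrite -leye_eq; apply: le_ereal_inf_tmp => _ [V [N _ NV] <-].
rewrite leye_eq; apply/eqP/eqyP => K _; have [n Nn Kn] := h K N.
apply: (@le_trans _ _ (u n)%:E); first by rewrite lee_fin ltW.
by apply: ereal_sup_ubound; exists n => //; exact: NV.
Qed.

Lemma limn_einf0P u : (forall n, 0 <= u n) -> limn_einf (fun n => (u n)%:E) = 0%E <->
  forall (e : R) N, 0 < e -> exists2 n, (N <= n)%N & u n < e.
Proof.
move=> u0; rewrite /limn_einf /limn_esup /limf_esup; split => [/eqP|h].
  rewrite eqe_oppLR oppe0 => /eqP h e N e0.
  apply: contrapT => hn; have : (0 <= (- e)%:E)%E; last by rewrite lee_fin oppr_ge0 leNgt e0.
  rewrite -h; apply: ge_ereal_inf.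
  exists (ereal_sup ((fun n => - (u n)%:E)%E @` [set n | (N <= n)%N])).
    by exists [set n | (N <= n)%N] => //; exact: nbhs_infty_ge.
  apply: ge_ereal_sup => _ [n Nn <-]; rewrite -EFinN lee_fin lerN2 leNgt; apply/negP => Kn.
  by apply: hn; exists n.
apply/eqP; rewrite eqe_oppLR oppe0 eq_le; apply/andP; split.
  apply: ge_ereal_inf; exists (ereal_sup ((fun n => - (u n)%:E)%E @` setT)).
    by exists setT => //; exact: filterT.
  by apply: ge_ereal_sup => _ [n _ <-]; rewrite -EFinN lee_fin oppr_le0.
apply: le_ereal_inf_tmp => _ [V [N _ NV] <-].
have ub n : (N <= n)%N -> (- (u n)%:E <= ereal_sup [set (- (u x)%:E)%E | x in V])%E.
  by move=> Nn; apply: ereal_sup_ubound; exists n => //; exact: NV.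
case: (ereal_sup _) ub => [r||] ub; last 2 first.
- by rewrite leey.
- by have := ub N (leqnn N); rewrite -EFinN.
rewrite lee_fin leNgt; apply/negP => r0.
have [|n Nn un] := h (- r) N; first by rewrite oppr_gt0.
by have := ub n Nn; rewrite -EFinN lee_fin leNgt ltrNr un.
Qed.

End LimsupLiminf.

Section BergmanSpace.
Variables (R : realType) (p : R) (phi : R[i] -> R).
Hypotheses (p1 : 1 <= p) (phi_weight : is_weight phi) (phi_radial : is_radial phi).
Local Notation mR := (measurableTypeR R).
Local Notation plane := (measurableTypeR R * measurableTypeR R)%type.
Local Notation D := (@disc2 R : set plane).
Local Notation BI := (bergman_int p phi).
Local Notation bnorm := (bergman_norm p phi).
Implicit Types (f g : R[i] -> R[i]) (a b : nat -> R[i]).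

Lemma exponent_gt0 : 0 < p.
Proof. exact: lt_le_trans p1. Qed.

Lemma weight_measurable : measurable_fun D (fun u : plane => phi (Complex u.1 u.2) : mR).
Proof. by case: phi_weight => _ /measurable_int/measurable_EFinP. Qed.

Lemma weight_gt0 (u : plane) : D u -> 0 < phi (Complex u.1 u.2).
Proof. by case: phi_weight => h _ /h. Qed.

Lemma bergman_int_ext f g : (forall z, unit_disc z -> f z = g z) -> BI f = BI g.
Proof.
by move=> fg; apply: eq_integral => u; rewrite inE => uD; rewrite fg.
Qed.

Lemma bergman_norm_ext f g : (forall z, unit_disc z -> f z = g z) -> bnorm f = bnorm g.
Proof. by move=> /bergman_int_ext fg; rewrite /bergman_norm fg. Qed.

Lemma integrand_ge0 f (u : plane) : D u ->
  0 <= cmod (f (Complex u.1 u.2)) `^ p * phi (Complex u.1 u.2).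
Proof. by move=> uD; rewrite mulr_ge0 ?powR_ge0// ltW// weight_gt0. Qed.

Lemma bergman_int_ge0 f : (0 <= BI f)%E.
Proof. by apply: integral_ge0 => u uD; rewrite lee_fin; exact: integrand_ge0. Qed.

Lemma integrand_measurable f : cmeasurable f -> measurable_fun D
  (fun u : plane => cmod (f (Complex u.1 u.2)) `^ p * phi (Complex u.1 u.2) : mR).
Proof.
move=> mf; apply: measurable_funM; last exact: weight_measurable.
by apply: measurable_funTS_powR; exact: cmeasurable_cmod.
Qed.

(** Membership in the ambient L^p space, without analyticity: finite sums and pointwise limits can
    be handled there, and [in_bergmanP] returns to A^p_phi. *)
Definition in_Lp f := cmeasurable f /\ (BI f < +oo)%E.

Lemma bergman_norm_ge0 f : 0 <= bnorm f. Proof. exact: powR_ge0. Qed.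

(** Finiteness matters: [fine] sends +oo to 0, so a function of infinite integral would have norm 0.
    This is why norm estimates below come together with membership in [in_Lp]. *)
Lemma bergman_intE f : (BI f < +oo)%E -> BI f = (bnorm f `^ p)%:E.
Proof.
move=> ff; rewrite /bergman_norm -powRrM mulVf ?gt_eqF ?exponent_gt0// powRr1; last first.
  by apply: fine_ge0; exact: bergman_int_ge0.
by rewrite fineK// ge0_fin_numE// bergman_int_ge0.
Qed.

Lemma bergman_norm_le f M : 0 <= M -> (BI f <= (M `^ p)%:E)%E ->
  (BI f < +oo)%E /\ bnorm f <= M.
Proof.
move=> M0 fM; have ff : (BI f < +oo)%E by apply: le_lt_trans fM _; rewrite ltry.
split => //; rewrite leNgt; apply/negP => Mf.
move: fM; rewrite bergman_intE// lee_fin leNgt gt0_ltr_powR ?exponent_gt0 ?nnegrE ?bergman_norm_ge0//.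
Qed.

Lemma in_LpD f g : in_Lp f -> in_Lp g ->
  in_Lp (fun z => f z + g z) /\ bnorm (fun z => f z + g z) <= bnorm f + bnorm g.
Proof.
move=> [mf ff] [mg gg]; have mfg := cmeasurableD mf mg.
(* The weight is absorbed as phi^(1/p), so that Minkowski's inequality for [dA] applies. *)
pose F h := fun u : plane => cmod (h (Complex u.1 u.2)) * phi (Complex u.1 u.2) `^ p^-1.
have F0 h u : D u -> 0 <= F h u.
  by move=> uD; rewrite mulr_ge0 ?cmod_ge0 ?powR_ge0.
have mF h : cmeasurable h -> measurable_fun D (F h : plane -> mR).
  move=> mh; apply: measurable_funM; first exact: cmeasurable_cmod.
  by apply: measurable_funTS_powR; exact: weight_measurable.
have FE h u : D u -> F h u `^ p = cmod (h (Complex u.1 u.2)) `^ p * phi (Complex u.1 u.2).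
  move=> uD; rewrite powRM ?cmod_ge0 ?powR_ge0// -powRrM mulVf ?gt_eqF ?exponent_gt0// powRr1//.
  by rewrite ltW// weight_gt0.
have FI h : (BI h < +oo)%E -> (\int[dA R]_(u in D) (F h u `^ p)%:E = (bnorm h `^ p)%:E)%E.
  by move=> hh; rewrite -bergman_intE//; apply: eq_integral => u; rewrite inE => /FE->.
have := minkowski_ge0 (@measurable_disc2 R) p1 (bergman_norm_ge0 f) (bergman_norm_ge0 g)
   (mF _ mf) (mF _ mg) (F0 f) (F0 g) (FI _ ff) (FI _ gg).
move=> h; have /bergman_norm_le[] : (BI (fun z => (f z + g z)%R) <= ((bnorm f + bnorm g) `^ p)%:E)%E.
- apply: le_trans h; apply: ge0_le_integral; first exact: measurable_disc2.
  + by move=> u uD; rewrite lee_fin; exact: (integrand_ge0 (fun z => f z + g z)).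
  + by apply/measurable_EFinP; exact: (integrand_measurable mfg).
  + by apply/measurable_EFinP/measurable_funTS_powR; apply: measurable_funD; exact: mF.
  + move=> u uD; rewrite lee_fin -(FE (fun z => f z + g z))//.
    rewrite ge0_ler_powR ?nnegrE ?(ltW exponent_gt0) ?addr_ge0 ?F0//.
    by rewrite /F -mulrDl ler_wpM2r ?powR_ge0// cmodD.
- by rewrite addr_ge0 ?bergman_norm_ge0.
by [].
Qed.

Lemma in_LpZ c f : in_Lp f ->
  in_Lp (fun z => c * f z) /\ bnorm (fun z => c * f z) = cmod c * bnorm f.
Proof.
move=> [mf ff].
have E : (BI (fun z => (c * f z)%R) = (cmod c `^ p)%:E * BI f)%E.
  rewrite /bergman_int -ge0_integralZl_EFin ?powR_ge0//.
  - apply: eq_integral => u _; rewrite -EFinM; congr (_%:E).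
    by rewrite cmodM powRM ?cmod_ge0// mulrA.
  - exact: measurable_disc2.
  - by move=> u uD; rewrite lee_fin; exact: integrand_ge0.
  - by apply/measurable_EFinP; exact: integrand_measurable.
have E2 : BI (fun z => c * f z) = ((cmod c * bnorm f) `^ p)%:E.
  by rewrite E bergman_intE// -EFinM powRM ?cmod_ge0 ?bergman_norm_ge0.
have cf : (BI (fun z => (c * f z)%R) < +oo)%E by rewrite E2 ltry.
split; first by split => //; exact: cmeasurableZ.
by rewrite /bergman_norm E2 /= -powRrM mulfV ?gt_eqF ?exponent_gt0// powRr1// mulr_ge0 ?cmod_ge0 ?bergman_norm_ge0.
Qed.

Lemma in_LpB f g : in_Lp f -> in_Lp g ->
  in_Lp (fun z => f z - g z) /\ bnorm (fun z => f z - g z) <= bnorm f + bnorm g.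
Proof.
move=> Lf Lg; have [Lng nng] := in_LpZ (-1) Lg.
have [] := in_LpD Lf Lng; rewrite nng cmodN cmod1 mul1r.
by under eq_fun do rewrite mulN1r.
Qed.

Lemma in_Lp0 : in_Lp (fun=> 0) /\ bnorm (fun=> 0) = 0.
Proof.
have E : BI (fun=> 0) = 0%E.
  apply: integral0_eq => u _.
  by rewrite cmod0 powR0 ?gt_eqF ?exponent_gt0// mul0r.
split; first by split; [exact: cmeasurable_cst|rewrite E].
by rewrite /bergman_norm E /= powR0// invr_eq0 gt_eqF ?exponent_gt0.
Qed.

Lemma in_Lp_sum (I : Type) (r : seq I) (F : I -> R[i] -> R[i]) :
  (forall i, in_Lp (F i)) -> in_Lp (fun z => \sum_(i <- r) F i z) /\
  bnorm (fun z => \sum_(i <- r) F i z) <= \sum_(i <- r) bnorm (F i).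
Proof.
move=> LF; elim: r => [|i r [IH1 IH2]].
  by under eq_fun do rewrite big_nil; rewrite big_nil; have [? ->] := in_Lp0.
under eq_fun do rewrite big_cons; rewrite big_cons.
by have [h1 h2] := in_LpD (LF i) IH1; split => //; apply: le_trans h2 _; rewrite lerD2l.
Qed.

Lemma in_Lp_ext f g : (forall z, unit_disc z -> f z = g z) -> in_Lp f -> in_Lp g.
Proof.
move=> fg [[mr mi] ff]; split; last by rewrite -(bergman_int_ext fg).
split.
  apply: eq_measurable_fun mr => u; rewrite inE => uD; by rewrite fg.
by apply: eq_measurable_fun mi => u; rewrite inE => uD; rewrite fg.
Qed.

Lemma power_series_rotate f a c : has_power_series f a -> cmod c = 1 ->
  has_power_series (fun z => f (c * z)) (fun n => a n * c ^+ n).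
Proof.
move=> /has_power_seriesE fa c1; apply/has_power_seriesE => z zD.
have -> : (fun n => a n * c ^+ n * z ^+ n) = (fun n => a n * (c * z) ^+ n).
  by apply/funext => n; rewrite exprMn mulrA.
by apply: fa; change (cmod (c * z) < 1); rewrite cmodM c1 mul1r.
Qed.

Lemma in_Lp_rotate f a c : has_power_series f a -> in_Lp f -> cmod c = 1 ->
  in_Lp (fun z => f (c * z)) /\ bnorm (fun z => f (c * z)) = bnorm f.
Proof.
move=> fa [mf ff] c1.
have E : BI (fun z => f (c * z)) = BI f.
  rewrite /bergman_int -(@dA_rotation _ c (fun z => (cmod (f z) `^ p * phi z)%:E))//.
  - apply: eq_integral => u; rewrite inE => uD; congr (_ * _)%:E.
    rewrite phi_radial// [RHS]phi_radial; first by rewrite cmodM c1 mul1r.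
    by change (cmod (c * Complex u.1 u.2) < 1); rewrite cmodM c1 mul1r.
  - by apply/measurable_EFinP; exact: integrand_measurable.
  - by move=> [x y] zD; rewrite lee_fin; exact: (@integrand_ge0 f (x, y) zD).
split; last by rewrite /bergman_norm E.
by split; [exact: power_series_cmeasurable (power_series_rotate fa c1)|rewrite E].
Qed.

(** Norm balls are closed under pointwise convergence on the disc, by Fatou's lemma; no convergence
    in norm is asked for. *)
Lemma in_Lp_cvg (F : nat -> R[i] -> R[i]) f M : (forall n, in_Lp (F n)) ->
  (forall n, bnorm (F n) <= M) ->
  (forall z, unit_disc z -> ccvg (fun n => F n z) (f z)) ->
  in_Lp f /\ bnorm f <= M.
Proof.
move=> LF FM Ff.
have mf : cmeasurable f by apply: cmeasurable_cvg Ff => n; exact: (LF n).1.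
have M0 : 0 <= M by apply: le_trans (FM 0%N); exact: bergman_norm_ge0.
have [|ff fM] := @bergman_norm_le f M M0; last by [].
rewrite /bergman_int; apply: (fatou_bound (@measurable_disc2 R)
  (h := fun n u => cmod (F n (Complex u.1 u.2)) `^ p * phi (Complex u.1 u.2))).
- by move=> n; exact: integrand_measurable (LF n).1.
- by move=> n u uD; exact: integrand_ge0.
- move=> u uD; apply: cvgM; last exact: cvg_cst.
  apply: powR_cvg; [exact: exponent_gt0|move=> n; exact: cmod_ge0|apply: ccvg_cmod; exact: Ff].
- move=> n; rewrite -/(BI (F n)) (bergman_intE (LF n).2) lee_fin.
  by rewrite ge0_ler_powR ?nnegrE ?(ltW exponent_gt0) ?bergman_norm_ge0.
Qed.

Local Notation beta n := (bnorm (fun z => z ^+ n)).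

Lemma in_Lp_monomial n : in_Lp (fun z => z ^+ n).
Proof.
split; first exact: cmeasurableX.
case: phi_weight => _ /integrableP[mphi]; apply: le_lt_trans.
apply: ge0_le_integral; first exact: measurable_disc2.
- by move=> u uD; rewrite lee_fin; exact: (integrand_ge0 (fun z => z ^+ n)).
- by apply/measurable_EFinP; exact: (integrand_measurable (@cmeasurableX R n)).
- by apply: measurableT_comp => //; exact: mphi.
- move=> u uD; rewrite lee_fin ger0_norm ?(ltW (weight_gt0 uD))//.
  rewrite ler_piMl ?(ltW (weight_gt0 uD))//.
  have uD1 : cmod (Complex u.1 u.2) < 1 := uD.
  have h : cmod (Complex u.1 u.2 ^+ n) <= 1.
    by rewrite cmodX exprn_ile1 ?cmod_ge0// ltW.
  have := @ge0_ler_powR R p (ltW exponent_gt0) _ 1 _ _ h; rewrite powR1; apply; rewrite nnegrE//.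
  exact: cmod_ge0.
Qed.

Lemma bergman_int_def f : BI f = (\int[dA R]_(u in D)
  (cmod (f (Complex u.1 u.2)) `^ p * phi (Complex u.1 u.2))%:E)%E.
Proof. by []. Qed.

Local Opaque bergman_norm bergman_int.

Lemma in_Lp_rotate_sum f a (k : nat -> R[i]) w N : has_power_series f a -> in_Lp f ->
  cmod w = 1 -> in_Lp (fun z => \sum_(0 <= i < N) k i * f (w ^+ i * z)) /\
  bnorm (fun z => \sum_(0 <= i < N) k i * f (w ^+ i * z)) <=
    (\sum_(0 <= i < N) cmod (k i)) * bnorm f.
Proof.
move=> fa Lf w1.
have w1n n : cmod (w ^+ n) = 1 by rewrite cmodX w1 expr1n.
have h n : in_Lp (fun z => k n * f (w ^+ n * z)) /\
    bnorm (fun z => k n * f (w ^+ n * z)) = cmod (k n) * bnorm f.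
  have [Lw nw] := in_Lp_rotate fa Lf (w1n n).
  have [Lk E] := in_LpZ (k n) Lw.
  split; [exact Lk|rewrite E nw; reflexivity].
have [h1 h2] := in_Lp_sum (index_iota 0 N) (fun i => (h i).1).
split => //; apply: le_trans h2 _; rewrite mulr_suml.
by apply: ler_sum => i _; rewrite (h i).2.
Qed.

Lemma has_power_series_ext f g a : (forall z, unit_disc z -> f z = g z) ->
  has_power_series f a -> has_power_series g a.
Proof. by move=> fg fa z zD; rewrite -fg//; exact: fa. Qed.

Lemma polynomial_power_series b N : (forall k, (N <= k)%N -> b k = 0) ->
  has_power_series (fun z => \sum_(0 <= k < N) b k * z ^+ k) b.
Proof.
move=> b0; apply/has_power_seriesE => z zD.
apply: (@ccvg_eventually _ (fun=> \sum_(0 <= k < N) b k * z ^+ k) _ _ N _ (ccvg_cst _)).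
move=> n Nn; rewrite /series /= [RHS](@big_cat_nat _ _ _ N)//= [X in _ = _ + X]big1_seq ?addr0//.
by move=> k; rewrite mem_index_iota /= => /andP[/b0 -> _]; rewrite mul0r.
Qed.

Lemma monomial_power_series n : has_power_series (fun z : R[i] => z ^+ n) (fun k => (k == n)%:R).
Proof.
apply: (@has_power_series_ext (fun z => \sum_(0 <= k < n.+1) (k == n)%:R * z ^+ k)).
  move=> z _; rewrite (bigD1_seq n) ?mem_index_iota ?iota_uniq//=.
  by rewrite eqxx mul1r big1 ?addr0// => k /negbTE->; rewrite mul0r.
by apply: polynomial_power_series => k nk; case: eqP => // h; lia.
Qed.

Lemma root_averageE w n i j f : (0 < n)%N -> root_average w n i j f =
  (fun z => \sum_(0 <= k < n) (n%:R^-1 * ((w ^+ k) ^+ i / (w ^+ k) ^+ j)) * f (w ^+ k * z)).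
Proof.
move=> n0; apply/funext => z; rewrite /root_average mulr_sumr.
by apply: eq_bigr => k _; rewrite mulrA.
Qed.

Lemma root_average_cvg_disc f a om i j z : has_power_series f a ->
  (forall n, n.+1.-primitive_root (om n)) -> unit_disc z ->
  ccvg (fun n => root_average (om n) n.+1 i j f z)
       (if (i <= j)%N then a (j - i)%N * z ^+ (j - i) else 0).
Proof.
move=> fa hom zD; have zD' : cmod z < 1 := zD.
have [|B aB] := @power_series_abs_disc _ f a (cmod z) fa; first by rewrite cmod_ge0.
apply: root_average_cvg hom aB _ => x xz.
by apply: ((has_power_seriesE f a).1 fa); change (cmod x < 1); rewrite xz.
Qed.

(** The averages isolating a_j z^j combine n + 1 rotations of f with weights of modulus 1/(n+1), so
    their norms are at most ||f||, and the pointwise limit inherits the bound. *)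
Lemma coefficient_bound f a j : has_power_series f a -> in_Lp f ->
  cmod (a j) * beta j <= bnorm f.
Proof.
move=> fa Lf; have [om hom] := prim_root_choice R.
have omc n : cmod (om n) = 1 by exact: prim_root_cmod (hom n).
have [_ <-] := in_LpZ (a j) (in_Lp_monomial j).
have hF n : in_Lp (root_average (om n) n.+1 0 j f) /\
    bnorm (root_average (om n) n.+1 0 j f) <= bnorm f.
  rewrite (root_averageE _ _ _ _ (ltn0Sn n)).
  have [h1 h2] := in_Lp_rotate_sum
    (fun k => n.+1%:R^-1 * ((om n ^+ k) ^+ 0 / (om n ^+ k) ^+ j)) n.+1 fa Lf (omc n).
  split; first exact: h1.
  apply: le_trans h2 _; rewrite ler_piMl ?bergman_norm_ge0//.
  rewrite [leLHS](_ : _ = 1)//.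
  under eq_bigr do rewrite !cmodM !cmodV !cmodX omc !expr1n cmod_nat invr1 !mulr1.
  by rewrite sumr_const_nat subn0 -[LHS]mulr_natl mulfV// pnatr_eq0.
have [] // := @in_Lp_cvg _ (fun z => a j * z ^+ j) (bnorm f) (fun n => (hF n).1) (fun n => (hF n).2).
move=> z zD; have := root_average_cvg_disc 0 j fa hom zD.
by rewrite leq0n subn0.
Qed.

(** The difference d = j - i occurs N - d times, so the coefficient of z^d is (1 - d/N) a_d: the
    Fejer mean, in the double-sum form that matches [root_average]. *)
Definition cesaro_mean a N z : R[i] := N%:R^-1 *
  \sum_(0 <= i < N) \sum_(0 <= j < N) (if (i <= j)%N then a (j - i)%N * z ^+ (j - i) else 0).

Lemma invn_real n : n%:R^-1 = (n%:R^-1 : R)%:C%C :> R[i].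
Proof. by rewrite -(rmorph_nat (real_complex R)) -fmorphV. Qed.

Lemma invC_cmod1 (x : R[i]) : cmod x = 1 -> x^-1 = (x^*)%C.
Proof. by move=> x1; rewrite invc_norm -cmod_norm x1 expr1n invr1 mul1r. Qed.

(* The weights (1/N) |sum_(i < N) x^i|^2 are nonnegative and have mean 1. *)
Lemma fejer_weights n (w : R[i]) N : (N <= n)%N -> (0 < N)%N -> n.-primitive_root w ->
  \sum_(0 <= k < n) cmod (n%:R^-1 * (N%:R^-1 *
    \sum_(0 <= i < N) \sum_(0 <= j < N) (w ^+ k) ^+ i / (w ^+ k) ^+ j)) = 1.
Proof.
move=> Nn N0 hw; have n0 : (0 < n)%N by exact: leq_trans Nn.
have w1 k : cmod (w ^+ k) = 1 by rewrite cmodX (prim_root_cmod n0 hw) expr1n.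
pose s k := \sum_(0 <= i < N) (w ^+ k) ^+ i.
(* Inverses of numbers of modulus 1 are conjugates, so the double sum is |s_k|^2 and each weight
   equals its own modulus. *)
have sE k : \sum_(0 <= i < N) \sum_(0 <= j < N) (w ^+ k) ^+ i / (w ^+ k) ^+ j =
    (cmod (s k) ^+ 2)%:C%C.
  rewrite rmorphXn /= -/(real_complex R _) cmod_norm sqr_normc.
  have -> : ((s k)^*)%C = \sum_(0 <= j < N) ((w ^+ k) ^+ j)^-1.
    rewrite /s rmorph_sum; apply: eq_bigr => j _.
    by rewrite invC_cmod1// cmodX w1 expr1n.
  rewrite /s mulr_suml; apply: eq_bigr => i _; rewrite mulr_sumr.
  by apply: eq_bigr.
have cE k : (cmod (n%:R^-1 * (N%:R^-1 *
    \sum_(0 <= i < N) \sum_(0 <= j < N) (w ^+ k) ^+ i / (w ^+ k) ^+ j)))%:C%C =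
    n%:R^-1 * (N%:R^-1 *
    \sum_(0 <= i < N) \sum_(0 <= j < N) (w ^+ k) ^+ i / (w ^+ k) ^+ j).
  rewrite sE !invn_real -!(rmorphM (real_complex R)) cmod_real ger0_norm//.
  by rewrite !mulr_ge0 ?invr_ge0 ?ler0n ?exprn_ge0 ?cmod_ge0.
apply: complexI; rewrite rmorph_sum /=.
under eq_bigr do rewrite cE.
rewrite -!mulr_sumr.
rewrite exchange_big /=.
under eq_bigr do rewrite exchange_big /=.
rewrite !mulr_sumr.
under eq_bigr => i _.
  rewrite !mulr_sumr; under eq_bigr => j _.
    rewrite mulrCA.
    over.
  over.
rewrite (eq_big_nat _ _ (F2 := fun i => N%:R^-1)); last first.
  move=> i /andP[_ iN]; rewrite (bigD1_seq i) ?mem_index_iota ?iota_uniq//=.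
  rewrite (prim_root_average n0 hw) ?(leq_trans iN)// eqxx mulr1 big1_seq ?addr0//.
  move=> j /andP[ji]; rewrite mem_index_iota /= => jN.
  by rewrite (prim_root_average n0 hw) ?(leq_trans iN) ?(leq_trans jN)// eq_sym (negbTE ji) mulr0.
by rewrite sumr_const_nat subn0 -[LHS]mulr_natl mulfV// pnatr_eq0 -lt0n.
Qed.

(** Replace each term of the Cesaro mean by the root average that converges to it. The result
    combines rotations of f with the Fejer weights, whose moduli add up to 1, so its norm is at most
    ||f||; then let n tend to infinity. *)
Lemma cesaro_mean_norm f a N : (0 < N)%N -> has_power_series f a -> in_Lp f ->
  in_Lp (cesaro_mean a N) /\ bnorm (cesaro_mean a N) <= bnorm f.
Proof.
move=> N0 fa Lf; have [om hom] := prim_root_choice R.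
have omc n : cmod (om n) = 1 by exact: prim_root_cmod (hom n).
pose k n l := n.+1%:R^-1 * (N%:R^-1 *
    \sum_(0 <= i < N) \sum_(0 <= j < N) (om n ^+ l) ^+ i / (om n ^+ l) ^+ j).
pose F n z := N%:R^-1 * \sum_(0 <= i < N) \sum_(0 <= j < N) root_average (om n) n.+1 i j f z.
have FE n : F n = (fun z => \sum_(0 <= l < n.+1) k n l * f (om n ^+ l * z)).
  apply/funext => z; rewrite /F /k.
  under eq_bigr => i _ do (under eq_bigr do rewrite /root_average).
  under [RHS]eq_bigr => l _.
    rewrite -mulrA -mulrA mulrCA mulr_suml.
    under eq_bigr do rewrite mulr_suml.
    over.
  rewrite -mulr_sumr; congr (_ * _).
  under [LHS]eq_bigr do rewrite -mulr_sumr exchange_big /=.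
  by rewrite -mulr_sumr exchange_big /= -mulr_sumr.
(* The shift by N ensures that there are at least N roots of unity, as the Fejer weights require. *)
apply: (@in_Lp_cvg (fun n => F (n + N)%N)).
- move=> n; rewrite FE; exact: (in_Lp_rotate_sum _ _ fa Lf (omc _)).1.
- move=> n; rewrite FE; apply: le_trans (in_Lp_rotate_sum _ _ fa Lf (omc _)).2 _.
  by rewrite fejer_weights ?mul1r//; lia.
- move=> z zD; apply/(ccvg_shift (fun n => F n z)); apply: ccvgZ.
  apply: ccvg_sum => i; apply: ccvg_sum => j.
  exact: root_average_cvg_disc.
Qed.

Lemma cesaro_mean_cvg f a z : has_power_series f a -> unit_disc z ->
  ccvg (fun N => cesaro_mean a N.+1 z) (f z).
Proof.
move=> fa zD.
pose S j := series (fun n => a n * z ^+ n) j.+1.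
(* Regrouping by j turns the double sum into the arithmetic mean of the partial sums, to which
   Cesaro's theorem applies. *)
have SE : (fun N => cesaro_mean a N.+1 z) = (fun N => N.+1%:R^-1 * \sum_(0 <= j < N.+1) S j).
  apply/funext => N; rewrite /cesaro_mean exchange_big /=; congr (_ * _).
  apply: eq_big_nat => j /andP[_ jN].
  rewrite (@big_cat_nat _ _ _ j.+1)//= [X in _ + X]big1_seq ?addr0; last first.
    by move=> i; rewrite mem_index_iota /= => /andP[ji _]; rewrite leqNgt ji.
  rewrite /S /series /= big_nat_rev /= add0n.
  apply: eq_big_nat => i /andP[_ ij].
  by rewrite subSS leq_subr subKn.
have Sf : ccvg S (f z).
  have := (ccvg_shift _ _ 1).2 ((has_power_seriesE f a).1 fa z zD).
  by under eq_fun do rewrite addn1.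
rewrite SE; apply: ccvg_ReIm.
  rewrite (_ : (fun _ => _) = arithmetic_mean (fun n => complex.Re (S n))).
    by apply: cesaro; exact: ccvg_Re.
  apply/funext => N; rewrite /arithmetic_mean /= /series /= -raddf_sum.
  by rewrite invn_real; case: (\sum_(_ <= _ < _) _) => x y /=; ring.
rewrite (_ : (fun _ => _) = arithmetic_mean (fun n => complex.Im (S n))).
  by apply: cesaro; exact: ccvg_Im.
apply/funext => N; rewrite /arithmetic_mean /= /series /= -raddf_sum.
by rewrite invn_real; case: (\sum_(_ <= _ < _) _) => x y /=; ring.
Qed.

Lemma integral_powR_sum f g : in_Lp f -> in_Lp g -> forall c : R, 0 <= c ->
  (\int[dA R]_(u in D) (c * (cmod (f (Complex u.1 u.2)) `^ p * phi (Complex u.1 u.2) +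
     cmod (g (Complex u.1 u.2)) `^ p * phi (Complex u.1 u.2)))%:E =
   (c * (bnorm f `^ p + bnorm g `^ p))%:E)%E.
Proof.
move=> [mf ff] [mg gg] c c0.
under eq_integral do rewrite EFinM EFinD.
have mD := @measurable_disc2 R.
have mif : measurable_fun D (fun u : plane =>
    (cmod (f (Complex u.1 u.2)) `^ p * phi (Complex u.1 u.2))%:E).
  by apply/measurable_EFinP; exact: (integrand_measurable mf).
have mig : measurable_fun D (fun u : plane =>
    (cmod (g (Complex u.1 u.2)) `^ p * phi (Complex u.1 u.2))%:E).
  by apply/measurable_EFinP; exact: (integrand_measurable mg).
have f0 u : D u -> (0 <= (cmod (f (Complex u.1 u.2)) `^ p * phi (Complex u.1 u.2))%:E)%E.
  by move=> uD; rewrite lee_fin; exact: integrand_ge0.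
have g0 u : D u -> (0 <= (cmod (g (Complex u.1 u.2)) `^ p * phi (Complex u.1 u.2))%:E)%E.
  by move=> uD; rewrite lee_fin; exact: integrand_ge0.
rewrite ge0_integralZl_EFin//; last 2 first.
- by move=> u uD; rewrite adde_ge0 ?f0 ?g0.
- exact: emeasurable_funD.
rewrite ge0_integralD// -!bergman_int_def (bergman_intE ff) (bergman_intE gg).
by rewrite -EFinD -EFinM.
Qed.

(* Pointwise convergence together with limsup of the norms at most the norm of
   the limit gives convergence in norm: apply Fatou's lemma to
   2^(p-1) (|P_n|^p + |f|^p) - |P_n - f|^p. *)
Lemma norm_cvg_of_pointwise (P : nat -> R[i] -> R[i]) f e :
  (forall n, in_Lp (P n)) -> in_Lp f -> (forall n, bnorm (P n) <= bnorm f) ->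
  (forall z, unit_disc z -> ccvg (fun n => P n z) (f z)) -> 0 < e ->
  exists n, bnorm (fun z => P n z - f z) < e.
Proof.
have arith (b x A F K E : R) : x + K = b * (A + F) -> b * A <= b * F -> E <= K ->
    x <= b * (F + F) - E.
  by rewrite !mulrDr; lra.
move=> LP Lf Pf Pcvg e0; apply: contrapT => /forallNP hN.
have {}hN n : e <= bnorm (fun z => P n z - f z) by rewrite leNgt; apply/negP; exact: hN.
pose c : R := 2 `^ (p - 1).
have c0 : 0 <= c by exact: powR_ge0.
pose I g (u : plane) := cmod (g (Complex u.1 u.2)) `^ p * phi (Complex u.1 u.2).
have mI g : cmeasurable g -> measurable_fun D (I g : plane -> mR).
  by move=> mg; exact: integrand_measurable.
have LB n := (in_LpB (LP n) Lf).1.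
pose h n (u : plane) := c * (I (P n) u + I f u) - I (fun z => P n z - f z) u.
have mh n : measurable_fun D (h n : plane -> mR).
  apply: measurable_funB; last exact: mI (LB n).1.
  apply: measurable_funM => //; apply: measurable_funD; first exact: mI (LP n).1.
  exact: mI Lf.1.
have h0 n u : D u -> 0 <= h n u.
  move=> uD; rewrite subr_ge0 /I -mulrDl mulrA ler_wpM2r ?(ltW (weight_gt0 uD))//.
  apply: le_trans (powR_sum_le p1 (cmod_ge0 _) (cmod_ge0 _)).
  by rewrite ge0_ler_powR ?nnegrE ?(ltW exponent_gt0) ?addr_ge0 ?cmod_ge0// cmodB.
have hcvg u : D u -> (fun n => h n u) @ \oo --> c * (I f u + I f u) - 0.
  move=> uD; apply: cvgB.
    apply: cvgM; first exact: cvg_cst.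
    apply: cvgD; last exact: cvg_cst.
    apply: cvgM; last exact: cvg_cst.
    apply: powR_cvg; [exact: exponent_gt0|by move=> n; exact: cmod_ge0|].
    by apply: ccvg_cmod; exact: Pcvg.
  rewrite -(mul0r (phi (Complex u.1 u.2))) -(@powR0 R p) ?gt_eqF ?exponent_gt0//.
  apply: cvgM; last exact: cvg_cst.
  apply: powR_cvg; [exact: exponent_gt0|by move=> n; exact: cmod_ge0|].
  exact: Pcvg.
(* The integral is c (||P_n||^p + ||f||^p) - ||P_n - f||^p, with ||P_n|| <= ||f||. The pointwise
   limit of [h n] integrates to 2 c ||f||^p, so Fatou's lemma contradicts the deficit e^p. *)
have hint n : (\int[dA R]_(u in D) (h n u)%:E <=
    (c * (bnorm f `^ p + bnorm f `^ p) - e `^ p)%:E)%E.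
  have : (\int[dA R]_(u in D) (h n u)%:E + BI (fun z => (P n z - f z)%R) =
     (c * (bnorm (P n) `^ p + bnorm f `^ p))%:E)%E.
    rewrite -(integral_powR_sum (LP n) Lf c0) bergman_int_def -ge0_integralD.
    - by apply: eq_integral => u _; rewrite -EFinD /h subrK.
    - exact: measurable_disc2.
    - by move=> u uD; rewrite lee_fin; exact: h0.
    - by apply/measurable_EFinP; exact: mh.
    - by move=> u uD; rewrite lee_fin; exact: (integrand_ge0 (fun z => P n z - f z)).
    - by apply/measurable_EFinP; exact: mI (LB n).1.
  rewrite (bergman_intE (LB n).2).
  case: (integral _ _ _) => // x; rewrite -EFinD => -[xE].
  rewrite lee_fin.
  have k1 : bnorm (P n) `^ p <= bnorm f `^ p.
    by rewrite ge0_ler_powR ?nnegrE ?(ltW exponent_gt0) ?bergman_norm_ge0.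
  have k2 : e `^ p <= bnorm (fun z => P n z - f z) `^ p.
    by rewrite ge0_ler_powR ?nnegrE ?(ltW exponent_gt0) ?(ltW e0) ?bergman_norm_ge0.
  have k3 : c * bnorm (P n) `^ p <= c * bnorm f `^ p by exact: (ler_wpM2l c0 k1).
  exact: (arith _ _ _ _ _ _ xE k3 k2).
have := fatou_bound (@measurable_disc2 R) mh h0 hcvg hint.
under eq_integral do rewrite subr0.
rewrite (integral_powR_sum Lf Lf c0) lee_fin leNgt => /negP; apply.
by rewrite gtrBl powR_gt0.
Qed.

Lemma cesaro_polynomial a N : exists b : nat -> R[i], forall z,
  cesaro_mean a N z = \sum_(0 <= k < N) b k * z ^+ k.
Proof.
exists (fun k => N%:R^-1 * \sum_(0 <= i < N) \sum_(0 <= j < N)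
  (if (i <= j)%N && (j - i == k)%N then a k else 0)) => z.
rewrite /cesaro_mean; under [RHS]eq_bigr => k _.
  rewrite -mulrA mulr_suml; under eq_bigr do rewrite mulr_suml.
  over.
rewrite -mulr_sumr; congr (_ * _); rewrite [RHS]exchange_big /=; apply: eq_bigr => i _.
rewrite [RHS]exchange_big /=; apply: eq_big_nat => j /andP[_ jN].
case: ifP => ij /=; last by rewrite big1// => k _; rewrite mul0r.
rewrite (bigD1_seq (j - i)%N) ?mem_index_iota ?iota_uniq//=; last by lia.
rewrite eqxx big1 ?addr0// => k kj; rewrite eq_sym (negbTE kj) mul0r//.
Qed.

(** A finite list of rational pairs belongs to a countable type that can be enumerated; the default
    (0, 0) of [nth] makes the coefficients vanish beyond the length. *)
Definition rational_coef (s : seq (rat * rat)) (k : nat) : R[i] :=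
  Complex (ratr (nth (0, 0) s k).1) (ratr (nth (0, 0) s k).2).

Definition rational_poly (s : seq (rat * rat)) (z : R[i]) : R[i] :=
  \sum_(0 <= k < size s) rational_coef s k * z ^+ k.

Lemma rational_coef_default s k : (size s <= k)%N -> rational_coef s k = 0.
Proof. by move=> sk; rewrite /rational_coef nth_default//= rmorph0. Qed.

Lemma rational_poly_power_series s : has_power_series (rational_poly s) (rational_coef s).
Proof. by apply: polynomial_power_series => k; exact: rational_coef_default. Qed.

Lemma in_Lp_polynomial b N : in_Lp (fun z => \sum_(0 <= k < N) b k * z ^+ k) /\
  bnorm (fun z => \sum_(0 <= k < N) b k * z ^+ k) <= \sum_(0 <= k < N) cmod (b k) * beta k.
Proof.
have h k := in_LpZ (b k) (in_Lp_monomial k).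
have [h1 h2] := in_Lp_sum (index_iota 0 N) (fun k => (h k).1).
split; first exact: h1.
by apply: le_trans h2 _; apply: ler_sum => k _; rewrite (h k).2.
Qed.

Lemma rational_approx (x : R[i]) (d : R) : 0 < d ->
  exists q : rat * rat, cmod (x - Complex (ratr q.1) (ratr q.2)) <= d.
Proof.
move=> d0; case: x => x y.
have approx (t : R) : exists q : rat, `|t - ratr q| <= d / 2.
  have [|q] := @rat_in_itvoo R (t - d / 2) (t + d / 2); first lra.
  by rewrite in_itv/= => /andP[h1 h2]; exists q; rewrite ler_norml; apply/andP; split; lra.
have [q1 h1] := approx x; have [q2 h2] := approx y.
exists (q1, q2); apply: le_trans (cmod_ReIm _) _ => /=; lra.
Qed.

Lemma rational_poly_dense f a e : has_power_series f a -> in_Lp f -> 0 < e ->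
  exists s, bnorm (fun z => rational_poly s z - f z) < e.
Proof.
move=> fa Lf e0.
have e2 : 0 < e / 2 by rewrite divr_gt0.
have [N hN] := norm_cvg_of_pointwise (fun n => (cesaro_mean_norm (ltn0Sn n) fa Lf).1) Lf
   (fun n => (cesaro_mean_norm (ltn0Sn n) fa Lf).2) (fun z => @cesaro_mean_cvg f a z fa) e2.
have [b bE] := cesaro_polynomial a N.+1.
pose B := \sum_(0 <= k < N.+1) beta k.
have B0 : 0 <= B by apply: sumr_ge0 => k _; exact: bergman_norm_ge0.
(* Moving each of the N + 1 coefficients by at most d changes the norm by at most d B <= e/2. *)
pose d := e / 2 / (1 + B).
have d0 : 0 < d by rewrite divr_gt0// ltr_wpDr.
have /choice[q hq] : forall k, exists q : rat * rat, cmod (b k - Complex (ratr q.1) (ratr q.2)) <= d.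
  by move=> k; exact: rational_approx.
exists (mkseq q N.+1).
pose P z := \sum_(0 <= k < N.+1) (rational_coef (mkseq q N.+1) k - b k) * z ^+ k.
have PE z : rational_poly (mkseq q N.+1) z - f z = P z + (cesaro_mean a N.+1 z - f z).
  rewrite bE /P /rational_poly size_mkseq.
  under [X in _ = X + _]eq_bigr do rewrite mulrBl.
  by rewrite sumrB; ring.
have [LP nP] := in_Lp_polynomial (fun k => rational_coef (mkseq q N.+1) k - b k) N.+1.
have LC := (in_LpB (cesaro_mean_norm (ltn0Sn N) fa Lf).1 Lf).1.
have [_ nPC] := in_LpD LP LC.
rewrite (_ : bnorm _ = bnorm (fun z => P z + (cesaro_mean a N.+1 z - f z))); last first.
  by congr bergman_norm; apply/funext => z; exact: PE.
apply: le_lt_trans nPC _.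
have h : bnorm P <= e / 2.
  apply: le_trans nP _; apply: (@le_trans _ _ (d * B)).
    rewrite /B mulr_sumr; rewrite big_nat_cond [leRHS]big_nat_cond.
    apply: ler_sum => k /andP[/andP[_ kN] _].
    rewrite ler_wpM2r ?bergman_norm_ge0// cmodBC /rational_coef nth_mkseq//.
  rewrite /d mulrAC ler_pdivrMr ?ltr_wpDr//.
  by rewrite ler_wpM2l ?(ltW e2)// lerDr.
by rewrite [ltRHS]splitr; exact: ler_ltD h hN.
Qed.

(** On the annulus r <= |z| < 1 the modulus of z^m is at least r^m, and the integral J of phi over
    it is positive because phi > 0 and the annulus has positive area; c is J^(1/p). *)
Lemma monomial_norm_lower (r : R) : 0 < r < 1 ->
  exists2 c : R, 0 < c & forall m, c * r ^+ m <= beta m.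
Proof.
move=> /andP[r0 r1].
pose q := fun u : plane => u.1 ^+ 2 + u.2 ^+ 2 : mR.
pose A : set plane := q @^-1` `[r ^+ 2, 1[.
have mA : measurable A.
  by rewrite -[X in measurable X]setTI; apply: measurable_cmod2.
have AD : A `<=` D.
  move=> [x y]; rewrite /A /q /= in_itv/= => /andP[_ h].
  by rewrite /disc2 /unit_disc /= -[ltRHS]sqrtr1 ltr_sqrt.
have Ar u : A u -> r <= cmod (Complex u.1 u.2).
  case: u => x y; rewrite /A /q /= in_itv/= => /andP[h _].
  by rewrite -(ger0_norm (ltW r0)) -sqrtr_sqr ler_sqrt// addr_ge0 ?sqr_ge0.
have mphi : measurable_fun A (fun u : plane => (phi (Complex u.1 u.2))%:E).
  apply: (measurable_funS (@measurable_disc2 R) AD).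
  by apply/measurable_EFinP; exact: weight_measurable.
pose J := (\int[dA R]_(u in A) (phi (Complex u.1 u.2))%:E)%E.
have phi0 u : A u -> (0 <= (phi (Complex u.1 u.2))%:E)%E.
  by move=> /AD uD; rewrite lee_fin ltW ?weight_gt0.
have J0 : (0 <= J)%E by exact: integral_ge0.
have Jneq0 : J != 0%E.
  apply/eqP => J00.
  have /(ae_eq_integral_abs (dA R) mA mphi) : (\int[dA R]_(u in A) `|(phi (Complex u.1 u.2))%:E| = 0)%E.
    rewrite -J00; apply: eq_integral => u; rewrite inE => uA.
    by rewrite gee0_abs ?phi0.
  move=> [N [mN N0 hN]].
  have AN : A `<=` N.
    move=> u uA; apply: hN => /= /(_ uA) /eqP; rewrite eqe gt_eqF//.
    by apply: weight_gt0; exact: AD.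
  have : (dA R A <= 0)%E by rewrite -N0; apply: le_measure; rewrite ?inE.
  rewrite leNgt => /negP; apply.
  have muA : ((@lebesgue_measure R \x @lebesgue_measure R) A =
      disc_area R * @lebesgue_measure R `[(r ^+ 2)%R, 1%R[%classic)%E.
    apply: (sq_pushforward (A := `[r ^+ 2, 1[%classic)) => //.
    by move=> x /=; rewrite !in_itv/= => /andP[h ->]; rewrite (le_trans _ h) ?sqr_ge0.
  change (0 < (pi^-1)%:E * (@lebesgue_measure R \x @lebesgue_measure R) A)%E.
  rewrite muA lebesgue_measure_itv/= lte_fin expr_lt1 ?(ltW r0)// r1.
  rewrite mule_gt0 ?lte_fin ?invr_gt0 ?pi_gt0// mule_gt0 ?disc_area_gt0//.
  by rewrite -EFinB lte_fin subr_gt0 expr_lt1 ?(ltW r0).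
have Jlt m : (((r ^+ m) `^ p)%:E * J <= BI (fun z => (z ^+ m)%R))%E.
  rewrite -ge0_integralZl_EFin ?powR_ge0// bergman_int_def.
  have mm := integrand_measurable (@cmeasurableX R m).
  apply: le_trans (_ : (\int[dA R]_(u in A) (cmod (Complex u.1 u.2 ^+ m) `^ p *
     phi (Complex u.1 u.2))%:E <= _)%E); last first.
    apply: ge0_subset_integral => //; first exact: measurable_disc2.
      by apply/measurable_EFinP; exact: mm.
    by move=> u uD; rewrite lee_fin; exact: (integrand_ge0 (fun z => z ^+ m)).
  apply: ge0_le_integral => //.
  - by move=> u uA; rewrite -EFinM lee_fin mulr_ge0 ?powR_ge0// -lee_fin phi0.
  - exact: measurable_funeM.
  - by apply/measurable_EFinP; exact: (measurable_funS (@measurable_disc2 R) AD mm).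
  - move=> u uA; rewrite -EFinM lee_fin ler_wpM2r//; first by rewrite -lee_fin phi0.
    rewrite ge0_ler_powR ?nnegrE ?(ltW exponent_gt0) ?cmod_ge0 ?exprn_ge0 ?(ltW r0)//.
    by rewrite cmodX lerXn2r ?nnegrE ?(ltW r0) ?cmod_ge0// Ar.
have Jfin : (J < +oo)%E.
  have := Jlt 0%N; rewrite expr0 powR1 mul1e => /le_lt_trans; apply.
  exact: (in_Lp_monomial 0).2.
move: J0 Jneq0 Jlt Jfin; case: J => // x; rewrite lee_fin eqe => x0 xn0 Jlt _.
have {x0 xn0} x0 : 0 < x by rewrite lt_neqAle eq_sym xn0.
exists (x `^ p^-1); first exact: powR_gt0.
move=> m; have := Jlt m.
rewrite (bergman_intE (in_Lp_monomial m).2) -EFinM lee_fin => h.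
rewrite leNgt; apply/negP => h2; move: h; apply/negP; rewrite -ltNge.
have -> : (r ^+ m) `^ p * x = (x `^ p^-1 * r ^+ m) `^ p.
  rewrite powRM ?powR_ge0 ?exprn_ge0 ?(ltW r0)// -powRrM mulVf ?gt_eqF ?exponent_gt0//.
  by rewrite powRr1 ?(ltW x0)// mulrC.
rewrite gt0_ltr_powR ?exponent_gt0 ?nnegrE ?bergman_norm_ge0//.
by rewrite mulr_ge0 ?powR_ge0 ?exprn_ge0 ?(ltW r0).
Qed.

Lemma monomial_norm_gt0 m : 0 < beta m.
Proof.
have [|c c0 hc] := @monomial_norm_lower (1 / 2); first lra.
by apply: lt_le_trans (hc m); rewrite mulr_gt0 ?exprn_gt0//; lra.
Qed.

(** An absolutely convergent series of monomials. For each 0 < r < 1 there is c > 0 with ||z^m|| >=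
    c r^m, so the coefficients give a power series converging on the disc; its norm is bounded as a
    pointwise limit of the partial sums. *)
Lemma l1_in_Lp a S : (forall N, \sum_(0 <= m < N) cmod (a m) * beta m <= S) ->
  exists f, [/\ has_power_series f a, in_Lp f & bnorm f <= S].
Proof.
move=> aS.
have h z : exists l, unit_disc z -> ccvg (series (fun n => a n * z ^+ n)) l.
  have [zD|zD] := pselect (unit_disc z); last by exists 0 => /zD.
  have zD' : cmod z < 1 := zD.
  pose r := Num.max (cmod z) (1 / 2).
  have r0 : 0 < r by rewrite lt_max; apply/orP; right; lra.
  have r1 : r < 1 by rewrite gt_max zD'/=; lra.
  have zr : cmod z <= r by rewrite le_max lexx.
  have [|c c0 hc] := @monomial_norm_lower r; first by rewrite r0.
  have [|l hl] := @ccvg_series_abs _ (fun n => a n * z ^+ n) (S / c); last by exists l.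
  move=> N; rewrite ler_pdivlMr//; apply: le_trans (aS N).
  rewrite /series /= mulr_suml; apply: ler_sum => m _.
  rewrite cmodM cmodX -mulrA ler_wpM2l ?cmod_ge0//; apply: le_trans (hc m).
  by rewrite mulrC ler_wpM2l ?(ltW c0)// lerXn2r ?nnegrE ?cmod_ge0 ?(ltW r0).
have [f hf] := choice h.
have fa : has_power_series f a by apply/has_power_seriesE.
exists f.
have [|||Lf nf] := @in_Lp_cvg (fun N z => \sum_(0 <= k < N) a k * z ^+ k) f S.
- by move=> N; exact: (in_Lp_polynomial a N).1.
- by move=> N; apply: le_trans (in_Lp_polynomial a N).2 (aS N).
- exact: hf.
by split.
Qed.

Lemma has_power_series_uniq f g a : has_power_series f a -> has_power_series g a ->
  forall z, unit_disc z -> f z = g z.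
Proof.
by move=> /has_power_seriesE fa /has_power_seriesE ga z zD; exact: ccvg_unique (fa z zD) (ga z zD).
Qed.

Lemma has_power_seriesB f g a b : has_power_series f a -> has_power_series g b ->
  has_power_series (fun z => f z - g z) (fun n => a n - b n).
Proof.
move=> /has_power_seriesE fa /has_power_seriesE gb; apply/has_power_seriesE => z zD.
have -> : series (fun n => (a n - b n) * z ^+ n) = (fun N =>
    series (fun k => a k * z ^+ k) N - series (fun k => b k * z ^+ k) N).
  by apply/funext => N; rewrite /series /= -sumrB; apply: eq_bigr => i _; rewrite mulrBl.
exact: ccvgB (fa z zD) (gb z zD).
Qed.

(** The forward direction is where the Taylor expansion on the whole disc enters. *)
Lemma in_bergmanP f : in_bergman p phi f <-> (exists a, has_power_series f a) /\ in_Lp f.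
Proof.
split=> [[/analytic_has_power_series[a fa] ff]|[[a fa] [_ ff]]].
  split; first by exists a.
  split; [exact: power_series_cmeasurable fa|exact: ff].
split; [exact: power_series_analytic fa|exact: ff].
Qed.

Lemma monomial_norm_radial : {in `]0, 1[, continuous (profile phi)} ->
  exists2 kappa : R, 0 < kappa & forall n, beta n `^ p =
    kappa * \int[@lebesgue_measure R]_(r in `[0%R, 1%R[) (r `^ (p * n%:R + 1) * profile phi r).
Proof.
move=> cphi; have [kappa k0 hk] := dA_radial R; exists kappa => // n.
pose G r := (r ^+ n) `^ p * profile phi r.
have cG : {in `]0, 1[, continuous G}.
  move=> r rI; have c1 : {for r, continuous (fun x : R => (x ^+ n) `^ p)}; last first.
    exact: cvgM c1 (cphi r rI).
  move: rI; rewrite in_itv/= => /andP[r0 r1].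
  apply: (@continuous_comp _ _ _ (fun x : R => x ^+ n) (fun x => x `^ p) r).
    exact: exprn_continuous.
  apply: differentiable_continuous; apply/derivable1_diffP; apply: derivable_powR.
  by rewrite in_itv/= andbT exprn_gt0.
have prof0 r : 0 <= r < 1 -> 0 < profile phi r.
  move=> /andP[r0 r1]; apply: phi_weight.1.
  by change (cmod (r%:C%C : R[i]) < 1); rewrite cmod_real ger0_norm.
have G0 r : 0 <= r < 1 -> 0 <= G r.
  by move=> /prof0 h; rewrite mulr_ge0 ?powR_ge0// ltW.
have E : BI (fun z => z ^+ n) = (kappa%:E * \int[@lebesgue_measure R]_(r in `[0%R, 1%R[)
    (r `^ (p * n%:R + 1) * profile phi r)%:E)%E.
  rewrite bergman_int_def; transitivity (\int[dA R]_(u in D) (G (cmod (Complex u.1 u.2)))%:E)%E.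
    apply: eq_integral => u; rewrite inE => uD; rewrite /G /profile cmodX.
    by rewrite [in LHS]phi_radial.
  rewrite (hk _ cG G0); congr (_ * _)%E; apply: eq_integral => r.
  rewrite inE/= in_itv/= => /andP[r0 r1]; congr (_%:E).
  rewrite /G mulrA; congr (_ * _).
  (* At r = 0 both sides vanish because the exponent p n + 1 is positive. *)
  move: r0; rewrite le_eqVlt => /predU1P[<-|r0].
    rewrite mul0r powR0// gt_eqF// ltr_wpDl//.
    by apply: mulr_ge0; [exact: ltW exponent_gt0|exact: ler0n].
  rewrite powRD; last by rewrite (gt_eqF r0) implybT.
  by rewrite powRr1 ?(ltW r0)// mulrC (mulrC p) powRrM powR_mulrn// ltW.
(* [Rintegral] would turn an infinite integral into 0; the finite norm on the other side rules that
   out. *)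
have := bergman_intE (in_Lp_monomial n).2; rewrite E /Rintegral.
case: integral => [x||].
- by rewrite -EFinM => -[<-].
- by rewrite mulry gtr0_sg// mul1e.
- by rewrite mulrNy gtr0_sg// mul1e.
Qed.

(** * Dynamics of the weighted shift *)

Section WeightedShift.
Variable w : nat -> R[i].
Hypothesis w_neq0 : forall n, (0 < n)%N -> w n != 0.
Hypothesis shift_bounded : Bshift_bounded p phi w.
Local Notation B := (Bshift w).
Local Notation W n := (\prod_(1 <= k < n.+1) w k).

Lemma weight_prodS n : W n.+1 = W n * w n.+1.
Proof. by rewrite big_nat_recr. Qed.

Lemma weight_prod_neq0 n : W n != 0.
Proof.
elim: n => [|n IH]; first by rewrite big_geq ?oner_neq0.
by rewrite weight_prodS mulf_neq0 ?w_neq0.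
Qed.

Lemma Bshift_power_series f a : has_power_series f a -> in_Lp f ->
  has_power_series (B f) (Bcoef w a) /\ in_Lp (B f).
Proof.
move=> fa Lf; have fB : in_bergman p phi f by apply/in_bergmanP; split; [exists a|exact: Lf].
have := shift_bounded.1 f fB; rewrite (taylor_coefE fa) => h; split; first exact: h.
have [M hM] := shift_bounded.2.
by have /in_bergmanP[_ h2] := (hM f fB).1; exact: h2.
Qed.

Lemma iter_Bcoef a n m : iter n (Bcoef w) a m = W (m + n) / W m * a (m + n)%N.
Proof.
elim: n m => [|n IH] m; first by rewrite addn0 divff ?mul1r ?weight_prod_neq0.
rewrite iterS {1}/Bcoef IH addSnnS mulrA; congr (_ * _).
rewrite mulrCA; congr (_ * _).
by rewrite weight_prodS invfM mulrCA mulfV ?mulr1// w_neq0.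
Qed.

Lemma iter_Bshift f a n : has_power_series f a -> in_Lp f ->
  has_power_series (iter n B f) (fun m => W (m + n) / W m * a (m + n)%N) /\
  in_Lp (iter n B f).
Proof.
move=> fa Lf; have -> : (fun m => W (m + n) / W m * a (m + n)%N) = iter n (Bcoef w) a.
  by apply/funext => m; rewrite iter_Bcoef.
elim: n => [|n [IH1 IH2]]; first by split; [exact: fa|exact: Lf].
by rewrite !iterS; exact: Bshift_power_series.
Qed.

Lemma Bshift_norm_bound : exists2 M : R, 1 <= M & forall f a n,
  has_power_series f a -> in_Lp f -> bnorm (iter n B f) <= M ^+ n * bnorm f.
Proof.
(* The maximum with 1 makes the powers of the bound nondecreasing in the exponent. *)
have [M hM] := shift_bounded.2; exists (Num.max 1 M); first by rewrite le_max lexx.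
move=> f a n fa Lf; elim: n => [|n IH]; first by rewrite expr0 mul1r.
have [fn Ln] := iter_Bshift n fa Lf.
have nB : in_bergman p phi (iter n B f).
  by apply/in_bergmanP; split; [eexists; exact: fn|exact: Ln].
rewrite iterS; apply: le_trans (hM _ nB).2 _.
apply: (@le_trans _ _ (Num.max 1 M * bnorm (iter n B f))).
  by apply: ler_wpM2r; [exact: bergman_norm_ge0|rewrite le_max lexx orbT].
rewrite exprS -mulrA; apply: ler_wpM2l; last exact: IH.
by rewrite le_max ler01.
Qed.

(** Aim the orbit at the constant c = 1/||1|| + K' ||f|| with tolerance 1. The constant term W_n a_n
    is then within 1/||1|| of c, so K' ||f|| < |W_n a_n| <= (|W_n| / ||z^n||) ||f||. *)
Lemma hypercyclic_unbounded : hypercyclic p phi B ->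
  forall (K : R) N, exists2 n, (N <= n)%N & K < cmod (W n) / beta n.
Proof.
have arith (r k u x d : R) : d < r -> r + k <= u + d -> u <= x -> k < x by lra.
move=> [f /in_bergmanP[[a fa] Lf] dense] K N.
pose x n := cmod (W n) / beta n.
have x0 n : 0 <= x n by rewrite divr_ge0 ?cmod_ge0 ?(ltW (monomial_norm_gt0 n)).
(* Adding the first N values of x forces the index n found at the end to be at least N. *)
pose K' := `|K| + \sum_(0 <= n < N) x n.
have K'0 : 0 <= K' by rewrite addr_ge0// sumr_ge0.
pose c := (beta 0)^-1 + K' * bnorm f.
have c0 : 0 <= c.
  by rewrite addr_ge0 ?invr_ge0 ?(ltW (monomial_norm_gt0 0)) ?mulr_ge0 ?bergman_norm_ge0.
have cp : has_power_series (fun=> c%:C%C : R[i]) (fun n => if n is 0 then c%:C%C else 0).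
  apply: (@has_power_series_ext (fun z => \sum_(0 <= k < 1) (if k is 0 then c%:C%C else 0) * z ^+ k)).
    by move=> z _; rewrite big_nat1 expr0 mulr1.
  by apply: polynomial_power_series => -[].
have Lc : in_Lp (fun=> c%:C%C : R[i]).
  have := (in_LpZ c%:C%C (in_Lp_monomial 0)).1; apply: in_Lp_ext => z _.
  by rewrite expr0 mulr1.
have [|n hn] := dense (fun=> c%:C%C) _ 1 ltr01.
  by apply/in_bergmanP; split; [eexists; exact: cp|exact: Lc].
have [fn Ln] := iter_Bshift n fa Lf.
have W0 : W 0 = 1 by rewrite big_geq.
have := coefficient_bound 0 (has_power_seriesB fn cp) (in_LpB Ln Lc).1.
rewrite W0 divr1 add0n => /le_lt_trans /(_ hn).
rewrite -ltr_pdivlMr ?monomial_norm_gt0// div1r => h1.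
have h2 : c <= cmod (W n * a n) + cmod (W n * a n - c%:C%C).
  have := cmodB (W n * a n) (W n * a n - c%:C%C).
  by rewrite opprB addrC subrK cmod_real ger0_norm.
have h3 : cmod (W n * a n) <= x n * bnorm f.
  rewrite cmodM /x -mulrA; apply: ler_wpM2l; first exact: cmod_ge0.
  rewrite mulrC; rewrite ler_pdivlMr ?monomial_norm_gt0//; exact: coefficient_bound fa Lf.
have h4 : K' < x n.
  have f0 := bergman_norm_ge0 f.
  have : K' * bnorm f < x n * bnorm f by exact: (arith _ _ _ _ _ h1 h2 h3).
  move: f0; rewrite le_eqVlt => /predU1P[<-|f0]; first by rewrite !mulr0 ltxx.
  by rewrite ltr_pM2r.
exists n; last first.
  apply: le_lt_trans h4; rewrite /K' (le_trans (ler_norm _))// lerDl; exact: sumr_ge0.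
rewrite leqNgt; apply/negP => nN; move: h4; rewrite ltNge => /negP; apply.
rewrite /K' (bigD1_seq n) ?mem_index_iota ?iota_uniq//= addrCA lerDl.
by rewrite addr_ge0// sumr_ge0.
Qed.

Local Notation b n := (beta n / cmod (W n)).

Lemma ratio_ge0 n : 0 <= b n.
Proof. by rewrite divr_ge0 ?bergman_norm_ge0 ?cmod_ge0. Qed.

(** Apply B_w^j to z^(n+j): the coefficient of z^n is W_(n+j) / W_n, and the coefficient bound
    compares it with M^j ||z^(n+j)||. *)
Lemma ratio_step : exists2 M : R, 1 <= M & (forall n j, b n <= M ^+ j * b (n + j)) /\
  forall f a n, has_power_series f a -> in_Lp f -> bnorm (iter n B f) <= M ^+ n * bnorm f.
Proof.
have [M M1 hM] := Bshift_norm_bound; exists M => //; split => // n j.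
have zn := @monomial_power_series (n + j)%N; have Ln := in_Lp_monomial (n + j)%N.
have [fn LBn] := iter_Bshift j zn Ln.
have := coefficient_bound n fn LBn; rewrite eqxx mulr1 cmodM cmodV => h.
have := le_trans h (hM _ _ j zn Ln) => {}h.
have W0 m : 0 < cmod (W m) by rewrite cmod_gt0 weight_prod_neq0.
rewrite mulrA ler_pdivlMr//; apply: le_trans h.
by rewrite mulrAC (mulrC (beta n)) mulrAC.
Qed.

(* Small ratios come in arbitrarily long runs, because B_w is bounded. *)
Lemma small_ratio_run : (forall e N, 0 < e -> exists2 n, (N <= n)%N & b n < e) ->
  forall e N L, 0 < e -> exists2 n, (N <= n)%N & forall j, (j < L)%N -> b (n + j) <= e.
Proof.
move=> small e N L e0; have [M M1 [step _]] := ratio_step.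
have M0 : 0 < M by exact: lt_le_trans M1.
(* A very small ratio at n spreads to the L indices before it, each step back costing at most a
   factor M. *)
have [|n Nn hn] := small (e / M ^+ L) (N + L)%N; first by rewrite divr_gt0 ?exprn_gt0.
exists (n - L)%N => [|j jL]; first by lia.
have := step (n - L + j)%N (L - j)%N; rewrite (_ : (n - L + j + (L - j))%N = n); last by lia.
move=> /le_trans; apply; apply: (@le_trans _ _ (M ^+ L * b n)).
  by apply: ler_wpM2r; [exact: ratio_ge0|apply: ler_weXn2l => //; exact: leq_subr].
by rewrite mulrC -ler_pdivlMr ?exprn_gt0//; exact: ltW.
Qed.

Lemma geometric_half_sum k N : \sum_(k <= l < N) (1 / 2) ^+ l <= 2 * (1 / 2) ^+ k :> R.
Proof.
have h n : \sum_(0 <= i < n) (1 / 2) ^+ i = 2 - 2 * (1 / 2) ^+ n :> R.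
  elim: n => [|n IH]; first by rewrite big_geq// expr0 mulr1 subrr.
  by rewrite big_nat_recr//= IH exprS; move: ((1 / 2) ^+ n) => x; lra.
rewrite -{1}(add0n k) big_addn; under eq_bigr do rewrite exprD.
rewrite -mulr_suml h; apply: ler_wpM2r; first by rewrite exprn_ge0//; lra.
by rewrite gerBl mulr_ge0// exprn_ge0//; lra.
Qed.

(** Codes of pairs (polynomial, integer) with the integer forgotten, so that every polynomial is
    listed infinitely often. *)
Definition rational_seq (l : nat) : seq (rat * rat) :=
  if (unpickle l : option (seq (rat * rat) * nat)) is Some x then x.1 else [::].

(** Pigeonhole: the N + 1 codes of the pairs (s, k) with k <= N are distinct, so they cannot all be
    below N. *)
Lemma rational_seq_unbounded s N : exists2 l, (N <= l)%N & rational_seq l = s.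
Proof.
apply: contrapT => h.
have lt_pickle (k : 'I_N.+1) : (pickle (s, val k) < N)%N.
  rewrite ltnNge; apply/negP => Nk; apply: h; exists (pickle (s, val k)) => //.
  by rewrite /rational_seq pickleK.
pose F (k : 'I_N.+1) := Ordinal (lt_pickle k).
have /leq_card : injective F.
  by move=> i j /(congr1 val) /= /(pcan_inj pickleK) [] /val_inj.
by rewrite !card_ord ltnn.
Qed.

(* If F_n denotes the shift of a polynomial by n places with coefficients
   rescaled so that B_w^n F_n is that polynomial again, then the sum of the
   shifts of all rational polynomials, along indices n_l chosen one after the
   other where the ratios are tiny, is a hypercyclic vector. *)
Lemma hypercyclic_of_small_ratios :
  (forall e N, 0 < e -> exists2 n, (N <= n)%N & b n < e) -> hypercyclic p phi B.
Proof.
move=> small; have [M M1 [_ hM]] := ratio_step.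
have M0 : 0 < M by exact: lt_le_trans M1.
have M1X n : 1 <= M ^+ n by exact: exprn_ege1.
have half0 n : 0 < (1 / 2 : R) ^+ n by rewrite exprn_gt0//; lra.
pose c l := rational_coef (rational_seq l).
have c0 l k : (size (rational_seq l) <= k)%N -> c l k = 0 by exact: rational_coef_default.
(* Bounds the norm of the l-th polynomial after it has been shifted by n places and rescaled. *)
pose T l n := \sum_(0 <= j < size (rational_seq l)) cmod (c l j) * cmod (W j) * b (n + j).
have T0 l n : 0 <= T l n.
  apply: sumr_ge0 => j _; apply: mulr_ge0 (ratio_ge0 _).
  exact: mulr_ge0 (cmod_ge0 _) (cmod_ge0 _).
(* [x.2] will exceed the earlier indices, so the factor [M ^+ x.2] pays for the iterates of B_w
   belonging to earlier blocks. *)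
have nextP (x : nat * nat) : exists n, (x.2 <= n)%N /\ T x.1 n * M ^+ x.2 <= (1 / 2) ^+ x.1.
  case: x => l N /=.
  pose S := \sum_(0 <= j < size (rational_seq l)) cmod (c l j) * cmod (W j).
  have S0 : 0 <= S by apply: sumr_ge0 => j _; rewrite mulr_ge0 ?cmod_ge0.
  pose e := (1 / 2) ^+ l / M ^+ N / (1 + S).
  have e0 : 0 < e by rewrite !divr_gt0 ?exprn_gt0// ltr_wpDr.
  have [n Nn hn] := small_ratio_run small N (size (rational_seq l)) e0.
  exists n; split => //; rewrite -ler_pdivlMr ?exprn_gt0//.
  apply: (@le_trans _ _ (S * e)).
    rewrite /T /S mulr_suml big_nat_cond [leRHS]big_nat_cond.
    apply: ler_sum => j /andP[/andP[_ jL] _].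
    by apply: ler_wpM2l; [rewrite mulr_ge0 ?cmod_ge0|exact: hn].
  rewrite /e mulrCA ler_piMr ?divr_ge0 ?(ltW (half0 _)) ?exprn_ge0 ?(ltW M0)//.
  by rewrite ler_pdivrMr ?ltr_wpDr// mul1r lerDr.
have [nxt hnxt] := choice nextP.
(* The next block starts beyond the last degree of the previous one, so blocks never overlap. *)
pose n := fix n l := if l is l'.+1
  then nxt (l'.+1, (n l' + size (rational_seq l')).+1) else nxt (0, 0).
have n_step l : (n l + size (rational_seq l) < n l.+1)%N.
  by have [] := hnxt (l.+1, (n l + size (rational_seq l)).+1).
have n_mono k l : (k < l)%N -> (n k + size (rational_seq k) < n l)%N.
  elim: l => // l IH; rewrite ltnS leq_eqVlt => /predU1P[->|/IH h]; first exact: n_step.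
  by have := n_step l; lia.
have n_ge l : (l <= n l)%N by elim: l => // l IH; have := n_step l; lia.
have T_half l : T l (n l) <= (1 / 2) ^+ l.
  have [x h] : exists x : nat, T l (n l) * M ^+ x <= (1 / 2) ^+ l.
    case: l => [|l]; first by exists 0; have [] := hnxt (0, 0).
    exists (n l + size (rational_seq l)).+1.
    by have [] := hnxt (l.+1, (n l + size (rational_seq l)).+1).
  by apply: le_trans h; rewrite ler_peMr.
have T_tail k l : (k < l)%N -> T l (n l) <= (1 / 2) ^+ l / M ^+ n k.
  case: l => // l kl; rewrite ler_pdivlMr ?exprn_gt0//.
  have [_ /=] := hnxt (l.+1, (n l + size (rational_seq l)).+1).
  apply: le_trans; apply: ler_wpM2l; first exact: T0.
  apply: ler_weXn2l => //; move: kl; rewrite ltnS leq_eqVlt => /predU1P[->|/n_mono h].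
    by rewrite leqW// leq_addr.
  by lia.
(* Coefficients of the l-th block: the polynomial placed at degrees from n_l on, with the factor W_j
   / W_(n_l+j) that B_w^(n_l) undoes. *)
pose s l m := if (n l <= m)%N then c l (m - n l)%N * W (m - n l) / W m else 0.
have s_sum l N : \sum_(0 <= m < N) cmod (s l m) * beta m <= T l (n l).
  pose F m := cmod (s l m) * beta m.
  have F0 m : 0 <= F m by rewrite mulr_ge0 ?cmod_ge0 ?bergman_norm_ge0.
  have -> : T l (n l) = \sum_(0 <= m < n l + (size (rational_seq l) + N)) F m.
    rewrite [RHS](@big_cat_nat _ _ _ (n l))//=; last exact: leq_addr.
    rewrite [X in X + _]big1_seq ?add0r; last first.
      by move=> m; rewrite mem_index_iota /= => mn; rewrite /F /s ifN ?cmod0 ?mul0r// -ltnNge.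
    rewrite -{2}[n l]add0n big_addn addKn.
    rewrite [RHS](@big_cat_nat _ _ _ (size (rational_seq l)))//=; last exact: leq_addr.
    rewrite [X in _ + X]big1_seq ?addr0; last first.
      move=> j; rewrite mem_index_iota /= => /andP[hj _].
      by rewrite /F /s leq_addl addnK c0// !mul0r cmod0 mul0r.
    apply: eq_bigr => j _; rewrite /F /s leq_addl addnK !cmodM cmodV (addnC (n l)) -!mulrA.
    by congr (_ * (_ * _)); rewrite mulrC.
  rewrite [leRHS](@big_cat_nat _ _ _ N)//=; last by rewrite addnA leq_addl.
  by rewrite lerDl sumr_ge0.
(* The blocks from k on. Since n_l >= l, blocks with l > m do not reach degree m, so the finite sum
   is the whole one. *)
pose t k m := \sum_(k <= l < m.+1) s l m.
have t_sum k N : \sum_(0 <= m < N) cmod (t k m) * beta m <= \sum_(k <= l < N) T l (n l).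
  apply: (@le_trans _ _ (\sum_(k <= l < N) \sum_(0 <= m < N) cmod (s l m) * beta m)); last first.
    by apply: ler_sum => l _; exact: s_sum.
  rewrite exchange_big /= big_nat_cond [leRHS]big_nat_cond.
  apply: ler_sum => m /andP[/andP[_ mN] _].
  rewrite -mulr_suml; apply: ler_wpM2r; first exact: bergman_norm_ge0.
  apply: le_trans (cmod_sum _ _ _) _.
  have [km|mk] := leqP k m.+1; last by rewrite big_geq ?(ltnW mk)// sumr_ge0// => l _; exact: cmod_ge0.
  by rewrite [leRHS](@big_cat_nat _ _ _ m.+1)//= lerDl sumr_ge0// => l _; exact: cmod_ge0.
have [f [fa Lf _]] : exists f, [/\ has_power_series f (t 0), in_Lp f & bnorm f <= 2].
  apply: l1_in_Lp => N; apply: le_trans (t_sum 0 N) _.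
  apply: le_trans (_ : \sum_(0 <= l < N) (1 / 2) ^+ l <= _); first exact: ler_sum.
  by apply: le_trans (geometric_half_sum 0 N) _; rewrite expr0 mulr1.
exists f; first by apply/in_bergmanP; split; [exists (t 0)|exact: Lf].
move=> g /in_bergmanP[[d gd] Lg] e e0; have e2 : 0 < e / 2 by rewrite divr_gt0.
have [q hq] := rational_poly_dense gd Lg e2.
have [N Nh] : exists N, forall k, (N <= k)%N -> (1 / 2) ^+ k < e / 2.
  have /cvgrPdist_lt/(_ _ e2)[N _ Nh] : (fun k => (1 / 2 : R) ^+ k) @ \oo --> 0.
    by apply: cvg_expr; rewrite ger0_norm; lra.
  by exists N => k /Nh /=; rewrite sub0r normrN ger0_norm// (ltW (half0 _)).
have [k Nk kq] := rational_seq_unbounded q N.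
have [h [ht Lh nh]] : exists h, [/\ has_power_series h (t k.+1), in_Lp h &
    bnorm h <= (1 / 2) ^+ k / M ^+ n k].
  apply: l1_in_Lp => L; apply: le_trans (t_sum _ _) _.
  apply: (@le_trans _ _ (\sum_(k.+1 <= l < L) (1 / 2) ^+ l / M ^+ n k)).
    rewrite big_nat_cond [leRHS]big_nat_cond.
    by apply: ler_sum => l /andP[/andP[kl _] _]; exact: T_tail.
  rewrite -mulr_suml; apply: ler_wpM2r; first by rewrite invr_ge0 exprn_ge0 ?(ltW M0).
  apply: le_trans (geometric_half_sum _ _) _.
  by rewrite exprS; move: ((1 / 2) ^+ k) => x; lra.
have [fn Ln] := iter_Bshift (n k) fa Lf; have [hn Lhn] := iter_Bshift (n k) ht Lh.
have qp := @rational_poly_power_series q.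
have Lq : in_Lp (rational_poly q) by exact: (in_Lp_polynomial _ _).1.
(* In B_w^(n_k) f the blocks before k have degree below n_k and disappear, block k returns q
   exactly, and the later blocks are those of [h]. *)
have coefE : (fun m => W (m + n k) / W m * t 0 (m + n k)%N - rational_coef q m) =
    (fun m => W (m + n k) / W m * t k.+1 (m + n k)%N).
  apply/funext => m.
  rewrite /t [X in _ * X - _](@big_cat_nat _ _ _ k.+1)//=; last first.
    by rewrite ltnS (leq_trans (n_ge k)) ?leq_addl.
  have -> : \sum_(0 <= l < k.+1) s l (m + n k)%N = s k (m + n k)%N.
    rewrite big_nat_recr//= big1_seq ?add0r// => l /andP[_].
    rewrite mem_index_iota => /andP[_ /n_mono lk].
    by rewrite /s c0 ?mul0r ?if_same//; lia.
  rewrite mulrDr /s leq_addl addnK /c kq addrAC.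
  rewrite [X in X - _](_ : _ = rational_coef q m) ?subrr ?add0r//.
  move: (weight_prod_neq0 m) (weight_prod_neq0 (m + n k)).
  by move: (W m) (W (m + n k)) (rational_coef q m) => x y u x0 y0; field; rewrite x0 y0.
have E z : unit_disc z -> iter (n k) B f z - rational_poly q z = iter (n k) B h z.
  have := has_power_seriesB fn qp; rewrite coefE.
  by move=> /has_power_series_uniq; apply; exact: hn.
exists (n k).
have [Lqg _] := in_LpB Lq Lg.
have [_ nsum] := in_LpD Lhn Lqg.
rewrite (@bergman_norm_ext _ (fun z => iter (n k) B h z + (rational_poly q z - g z))); last first.
  by move=> z zD; rewrite -E//= addrA subrK.
apply: le_lt_trans nsum _; rewrite [ltRHS]splitr; apply: ler_ltD; last exact: hq.
apply: le_trans (hM _ _ (n k) ht Lh) _; rewrite mulrC.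
rewrite -ler_pdivlMr ?exprn_gt0//; apply: le_trans nh _.
by apply: ler_wpM2r; [rewrite invr_ge0 exprn_ge0 ?(ltW M0)|apply: ltW; exact: Nh].
Qed.

End WeightedShift.

End BergmanSpace.

Theorem theorem4p5 (R : realType) (p : R) (phi : R[i] -> R) (w : nat -> R[i])
  (hp : 1 <= p) (hphi : normal_weight phi)
  (hw : forall n : nat, (0 < n)%N -> w n != 0)
  (hB : Bshift_bounded p phi w) :
  [<-> (* (i) *)
       hypercyclic p phi (Bshift w);
       (* (ii) *)
       limn_esup (fun n : nat =>
         (cmod (\prod_(1 <= k < n.+1) w k) *
          (\int[@lebesgue_measure R]_(r in `[0%R, 1%R[)
             (r `^ (p * n%:R + 1) * profile phi r)) `^ (- p^-1))%:E) = +oo%E;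
       (* (iii) *)
       limn_einf (fun n : nat =>
         ((cmod (\prod_(1 <= k < n.+1) w k))^-1 *
          bergman_norm p phi (fun z => z ^+ n))%:E) = 0%E].
Proof.
have [phi_w phi_r cphi _] := hphi.
have cphi' : {in `]0, 1[, continuous (profile phi)}.
  move=> r; rewrite in_itv/= => /andP[r0 r1].
  (* Two-sided continuity at r, from a compact interval with r in its interior. *)
  apply: (@within_continuous_continuous _ _ _ (r / 2) ((r + 1) / 2)).
  - lra.
  - apply: continuous_subspaceW cphi => x; rewrite /= !in_itv/= => /andP[xr xr1].
    by apply/andP; split; lra.
  - by rewrite in_itv/=; apply/andP; split; lra.
have p0 : 0 < p by exact: lt_le_trans hp.
have [kappa k0 hk] := monomial_norm_radial hp phi_w phi_r cphi'.
have beta0 n : 0 < bergman_norm p phi (fun z => z ^+ n) by exact: monomial_norm_gt0.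
have W0 n : 0 < cmod (\prod_(1 <= k < n.+1) w k).
  by rewrite cmod_gt0; exact: weight_prod_neq0.
(* The integral is ||z^n||^p / kappa, so (ii) is about kappa^(1/p) |W_n| / ||z^n||, a constant times
   the reciprocal of the quantity in (iii). *)
have E n : (\int[@lebesgue_measure R]_(r in `[0%R, 1%R[)
    (r `^ (p * n%:R + 1) * profile phi r)) `^ (- p^-1) =
    kappa `^ p^-1 / bergman_norm p phi (fun z => z ^+ n).
  have -> : \int[@lebesgue_measure R]_(r in `[0%R, 1%R[) (r `^ (p * n%:R + 1) * profile phi r) =
      kappa^-1 * bergman_norm p phi (fun z => z ^+ n) `^ p.
    by rewrite hk mulKf// gt_eqF.
  rewrite powRN powRM ?invr_ge0 ?(ltW k0) ?powR_ge0// -powRrM mulfV ?gt_eqF//.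
  rewrite powRr1 ?(ltW (beta0 n))// invfM; congr (_ / _).
  by rewrite -powR_inv1 ?(ltW k0)// -powRrM mulN1r powRN invrK.
have kp0 : 0 < kappa `^ p^-1 by exact: powR_gt0.
have b0 n : 0 <= (cmod (\prod_(1 <= k < n.+1) w k))^-1 * bergman_norm p phi (fun z => z ^+ n).
  by rewrite mulr_ge0 ?invr_ge0 ?(ltW (W0 n)) ?(ltW (beta0 n)).
tfae => [hyp|/limn_esup_pinftyP h|/limn_einf0P h].
- apply/limn_esup_pinftyP => K N.
  have [n Nn hn] := hypercyclic_unbounded hp phi_w phi_r hw hB hyp (K / kappa `^ p^-1) N.
  exists n => //; rewrite E mulrCA mulrC -ltr_pdivrMr//.
- apply/(limn_einf0P b0) => e N e0; have [n Nn hn] := h (kappa `^ p^-1 / e) N.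
  exists n => //; move: hn; rewrite E mulrCA ltr_pM2l//.
  rewrite ltr_pdivlMr// => hn.
  by rewrite mulrC ltr_pdivrMr// -ltr_pdivrMl// mulrC.
- apply: (hypercyclic_of_small_ratios hp phi_w phi_r hw hB) => e N e0.
  by have [n Nn hn] := h b0 e N e0; exists n => //; rewrite mulrC.
Qed.
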